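(* Let $c_1, c_2 \in BV(I;\mathbb{R}^d)$. Then $$\hat S(c_1,c_2) = \int_I \Bigl\langle \frac{dDc_1}{d|Dc_1|},\frac{dDc_2}{d|Dc_2|}\Bigr\rangle^+ \sqrt{\frac{d|Dc_1|}{d(|Dc_1|+|Dc_2|)}\,\frac{d|Dc_2|}{d(|Dc_1|+|Dc_2|)}}\;d(|Dc_1|+|Dc_2|),$$ where the integrand is set to zero at points where either $\frac{d|Dc_1|}{d(|Dc_1|+|Dc_2|)}=0$ or $\frac{d|Dc_2|}{d(|Dc_1|+|Dc_2|)}=0$, and $(\cdot)^+=\max\{\cdot,0\}$ denotes the positive part. In particular, if $c_1,c_2\in SBV(I;\mathbb{R}^d)$, then $$\hat S(c_1,c_2) = \int_I \Bigl\langle \frac{\dot c_1}{|\dot c_1|},\frac{\dot c_2}{|\dot c_2|}\Bigr\rangle^+ \sqrt{|\dot c_1|\,|\dot c_2|}\,dx + \sum_{x\in\Sigma(c_1)\cap\Sigma(c_2)} \Bigl\langle \frac{[c_1](x)}{|[c_1](x)|},\frac{[c_2](x)}{|[c_2](x)|}\Bigr\rangle^+ \sqrt{|[c_1](x)|\,|[c_2](x)|}.$$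
   Context: $I=[0,1]$. $AC(I;\mathbb{R}^d)$ and $BV(I;\mathbb{R}^d)$ are the spaces of absolutely continuous curves and of curves of bounded variation. For $c\in BV(I;\mathbb{R}^d)$, $Dc$ is its distributional derivative (a finite $\mathbb{R}^d$-valued Radon measure), $|Dc|$ its total variation measure, $\frac{dDc}{d|Dc|}$ the polar density (a unit vector $|Dc|$-a.e.), and $\mathrm{len}(c):=|Dc|(I)$. A sequence $c^{(k)}$ in $BV(I;\mathbb{R}^d)$ converges strictly to $c\in BV(I;\mathbb{R}^d)$, written $c^{(k)}\to^s c$, if $\|c^{(k)}-c\|_{L^1}\to 0$ and $\mathrm{len}(c^{(k)})\to\mathrm{len}(c)$. For $c_1,c_2\in AC(I;\mathbb{R}^d)$ define $$S(c_1,c_2)=\int_I\Bigl\langle\frac{\dot c_1}{|\dot c_1|},\frac{\dot c_2}{|\dot c_2|}\Bigr\rangle\sqrt{|\dot c_1|\,|\dot c_2|}\,dx,$$ the integrand being zero where $\dot c_1=0$ or $\dot c_2=0$ (the same convention is used for the absolutely continuous integral in the claim). For $c_1,c_2\in BV(I;\mathbb{R}^d)$ define $$\hat S(c_1,c_2):=\sup\Bigl\{\limsup_k S(c_1^{(k)},c_2^{(k)}) : c_i^{(k)}\in AC(I;\mathbb{R}^d),\ c_i^{(k)}\to^s c_i,\ i=1,2\Bigr\}.$$ Write $Dc=\dot c\,\mathcal{L}^1+D^jc+D^cc$, where $\dot c$ is the a.e. existing classical derivative (density of the absolutely continuous part), $D^jc$ is the purely atomic (jump) part and $D^cc$ the non-atomic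 singular (Cantor) part. $SBV(I;\mathbb{R}^d)$ is the set of $c\in BV(I;\mathbb{R}^d)$ with $D^cc=0$. With $c^\ell(x),c^r(x)$ the left and right essential limits of $c$ at $x$, $\Sigma(c)=\{x: c^\ell(x)\ne c^r(x)\}$ is the jump set and $[c](x)=c^r(x)-c^\ell(x)$ for $x\in\Sigma(c)$. *)

(* Defs.v *)
From HB Require Import structures.
From mathcomp Require Import all_boot all_order all_algebra.
From mathcomp Require Import all_classical all_reals all_analysis.
From mathcomp Require Import ring lra.

Set Implicit Arguments.
Unset Strict Implicit.
Unset Printing Implicit Defensive.

Import Order.TTheory GRing.Theory Num.Theory.
Import numFieldNormedType.Exports.

Local Open Scope classical_set_scope.
Local Open Scope ring_scope.

Section euclidean.
Context {R : realType} {d : nat}.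
Implicit Types u v w : 'rV[R]_d.

Definition edot u v : R := \sum_(i < d) u 0 i * v 0 i.

(* The norm that the library puts on 'rV[R]_d is the sup norm. *)
Definition enorm u : R := Num.sqrt (edot u u).

Lemma edot_ge0 u : 0 <= edot u u.
Proof. by apply: sumr_ge0 => i _; rewrite -expr2 sqr_ge0. Qed.

Lemma enorm_ge0 u : 0 <= enorm u. Proof. exact: sqrtr_ge0. Qed.

Lemma edot_sqr_le u v : edot u v ^+ 2 <= edot u u * edot v v.
Proof.
have : 0 <= \sum_(i < d) \sum_(j < d) (u 0 i * v 0 j - u 0 j * v 0 i) ^+ 2.
  by do 2!apply: sumr_ge0 => ? _; exact: sqr_ge0.
have -> : \sum_(i < d) \sum_(j < d) (u 0 i * v 0 j - u 0 j * v 0 i) ^+ 2 =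
    2%:R * (edot u u * edot v v - edot u v ^+ 2).
  have e a b a' b' : edot a b * edot a' b' =
      \sum_(i < d) \sum_(j < d) (a 0 i * b 0 i) * (a' 0 j * b' 0 j).
    by rewrite /edot mulr_suml; apply: eq_bigr => i _; rewrite mulr_sumr.
  have -> : 2%:R * (edot u u * edot v v - edot u v ^+ 2) =
     edot u u * edot v v + edot v v * edot u u - 2%:R * (edot u v * edot u v).
    by ring.
  rewrite !e mulr_sumr -sumrN -!big_split/=; apply: eq_bigr => i _.
  rewrite mulr_sumr -sumrN -!big_split/=; apply: eq_bigr => j _.
  by ring.
by lra.
Qed.

Lemma enormD u v : enorm (u + v) <= enorm u + enorm v.
Proof.
have huv : edot u v <= enorm u * enorm v.
  rewrite (le_trans (ler_norm _))// -sqrtrM ?edot_ge0// -sqrtr_sqr.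
  by rewrite ler_wsqrtr// edot_sqr_le.
rewrite -(@ler_pXn2r _ 2)// ?nnegrE ?addr_ge0 ?enorm_ge0//.
rewrite sqr_sqrtr ?edot_ge0// sqrrD ![enorm _ ^+ 2]sqr_sqrtr ?edot_ge0//.
suff -> : edot (u + v) (u + v) = edot u u + 2%:R * edot u v + edot v v.
  rewrite -mulr_natl; lra.
rewrite /edot mulr_sumr -!big_split/=; apply: eq_bigr => i _.
by rewrite !mxE; ring.
Qed.

Lemma enorm0 : enorm 0 = 0.
Proof. by rewrite /enorm /edot big1 ?sqrtr0// => i _; rewrite mxE mul0r. Qed.

Lemma enorm_sum n (u : nat -> 'rV[R]_d) :
  enorm (\sum_(0 <= k < n) u k) <= \sum_(0 <= k < n) enorm (u k).
Proof.
elim: n => [|n IH]; first by rewrite !big_nil enorm0.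
by rewrite !big_nat_recr//= (le_trans (enormD _ _))// lerD2r.
Qed.

Lemma enorm_le_sum u : enorm u <= \sum_(i < d) `|u 0 i|.
Proof.
have S0 : 0 <= \sum_(i < d) `|u 0 i| by apply: sumr_ge0.
rewrite -(ger0_norm S0) -sqrtr_sqr ler_wsqrtr// /edot expr2 mulr_suml.
apply: ler_sum => i _; rewrite (le_trans (ler_norm _))// normrM ler_wpM2l//.
by rewrite (bigD1 i)//= lerDl sumr_ge0.
Qed.

Lemma cvg_enorm (u : nat -> 'rV[R]_d) v :
  (forall i, (fun n => u n 0 i) @ \oo --> v 0 i) ->
  (fun n => enorm (u n)) @ \oo --> enorm v.
Proof.
move=> uv.
apply: (@continuous_cvg _ _ _ _ _ (fun n => edot (u n) (u n)) (@Num.sqrt R)).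
  exact: sqrt_continuous.
rewrite /edot; apply: cvg_big => [|i _]; last exact: cvgM.
exact: add_continuous.
Qed.

End euclidean.

Section vector_measure.
Context {R : realType} {d : nat} {disp : measure_display}
  {T : measurableType disp}.
Variable nu : 'I_d -> {charge set T -> \bar R}.
Local Open Scope ereal_scope.

Definition vmeas (A : set T) : 'rV[R]_d := \row_i fine (nu i A).

Definition measurable_partition (A : set T) (F : (set T)^nat) :=
  [/\ forall n, measurable (F n), trivIset setT F & \bigcup_n F n = A].

(* The added 0 is the value on sets that are not measurable. *)
Definition tvar (A : set T) : \bar R :=
  ereal_sup (0 |` [set \sum_(n <oo) (enorm (vmeas (F n)))%:E |
                   F in measurable_partition A]).

Lemma tvar_ge0 A : 0 <= tvar A.
Proof. by apply: ereal_sup_ubound; left. Qed.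

Lemma vmeas0 : vmeas set0 = 0%R.
Proof. by apply/rowP => i; rewrite !mxE charge0. Qed.

Let e_ge0 A : 0 <= (enorm (vmeas A))%:E.
Proof. by rewrite lee_fin enorm_ge0. Qed.

Lemma tvar_ub A F : measurable_partition A F ->
  \sum_(n <oo) (enorm (vmeas (F n)))%:E <= tvar A.
Proof. by move=> AF; apply: ereal_sup_ubound; right; exists F. Qed.

Let PN i := cid (Hahn_decomposition (nu i)).
Let vP i := projT2 (cid (projT2 (PN i))).
Let var : {measure set T -> \bar R} :=
  msum (fun k => if insub k is Some i then charge_variation (vP i) else mzero) d.

Let varE A : var A = \sum_(i < d) charge_variation (vP i) A.
Proof.
rewrite /var/= /msum; apply: eq_bigr => i _.
by rewrite valK.
Qed.

Let var_fin A : measurable A -> var A \is a fin_num.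
Proof.
move=> mA; rewrite varE; apply/sum_fin_numP => i _ _.
by rewrite fin_num_measure.
Qed.

Let enorm_var A : measurable A -> (enorm (vmeas A))%:E <= var A.
Proof.
move=> mA; rewrite varE.
apply: (@le_trans _ _ (\sum_(i < d) `|nu i A|)).
  rewrite (@eq_bigr _ _ _ _ _ _ _ (fun i => (`|fine (nu i A)|%R)%:E)); last first.
    by move=> i _; rewrite -abse_EFin fineK ?fin_num_measure.
  rewrite sumEFin lee_fin (le_trans (enorm_le_sum _))//.
  by rewrite le_eqVlt; apply/orP; left; apply/eqP/eq_bigr => i _; rewrite mxE.
by apply: lee_sum => i _; exact: abse_charge_variation.
Qed.

Let tvar_le_var A : tvar A <= var A.
Proof.
apply: ge_ereal_sup => _ [->//|[F [mF tF FA] <-]].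
have -> : var A = \sum_(n <oo) var (F n).
  apply/esym/cvg_lim => //; rewrite -FA.
  by apply: measure_semi_sigma_additive => //; exact: bigcupT_measurable.
by apply: lee_nneseries => // n _ ; exact: enorm_var.
Qed.

Lemma tvar_fin A : measurable A -> tvar A \is a fin_num.
Proof.
move=> mA; rewrite ge0_fin_numE ?tvar_ge0// (le_lt_trans (tvar_le_var _))//.
by rewrite -ge0_fin_numE// var_fin.
Qed.

Lemma tvar0 : tvar set0 = 0.
Proof.
apply/eqP; rewrite eq_le tvar_ge0 andbT (le_trans (tvar_le_var _))//.
by rewrite measure0.
Qed.

Let tvarU A B : measurable A -> measurable B -> A `&` B = set0 ->
  tvar A + tvar B <= tvar (A `|` B).
Proof.
move=> mA mB AB0.
have key F G : measurable_partition A F -> measurable_partition B G ->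
    \sum_(n <oo) (enorm (vmeas (F n)))%:E +
    \sum_(n <oo) (enorm (vmeas (G n)))%:E <= tvar (A `|` B).
  move=> [mF tF FA] [mG tG GB].
  pose H k := if odd k then G k./2 else F k./2.
  have FG0 i j : F i `&` G j = set0.
    apply/seteqP; split => // x [Fx Gx]; rewrite -AB0 -FA -GB.
    by split; [exists i|exists j].
  have HAB : measurable_partition (A `|` B) H.
    split.
    - by move=> n; rewrite /H; case: ifP.
    - move=> i j _ _; rewrite /H; case: ifPn => oi; case: ifPn => oj [x [Hi Hj]].
      + have /tG : G i./2 `&` G j./2 !=set0 by exists x.
        by move=> /(_ I I) e; rewrite -(odd_double_half i) -(odd_double_half j)
          oi oj e.
      + by have : (F j./2 `&` G i./2) x by []; rewrite FG0.
      + by have : (F i./2 `&` G j./2) x by []; rewrite FG0.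
      + have /tF : F i./2 `&` F j./2 !=set0 by exists x.
        by move=> /(_ I I) e; rewrite -(odd_double_half i) -(odd_double_half j)
          (negbTE oi) (negbTE oj) e.
    - apply/seteqP; split.
        move=> x [n _]; rewrite /H -FA -GB; case: ifP => _ ?; [right|left];
        by exists n./2.
      move=> x; rewrite -FA -GB => -[[n _ ?]|[n _ ?]].
        by exists n.*2 => //; rewrite /H odd_double doubleK.
      by exists n.*2.+1 => //; rewrite /H /= odd_double /= uphalf_double.
  rewrite -nneseriesD//; apply: le_trans (tvar_ub HAB).
  apply: lime_le; first by apply: is_cvg_nneseries => n _ _; rewrite adde_ge0.
  apply: nearW => n.
  have -> : \sum_(0 <= k < n) ((enorm (vmeas (F k)))%:E +
      (enorm (vmeas (G k)))%:E) = \sum_(0 <= k < n.*2) (enorm (vmeas (H k)))%:E.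
    elim: n => [|n IH]; first by rewrite !big_nil.
    rewrite doubleS !big_nat_recr//= IH -addeA; congr (_ + (_ + _)).
      by rewrite /H odd_double doubleK.
    by rewrite /H /= odd_double /= uphalf_double.
  by apply: nneseries_lim_ge.
have pt C : measurable C ->
    measurable_partition C (fun n => if n is 0%N then C else set0).
  move=> mC; split.
  - by case.
  - by move=> [|i] [|j] _ _ // [x []].
  - by apply/seteqP; split => [x [[|n] _]//|x Cx]; exists 0%N.
rewrite -leeBrDr ?tvar_fin//; apply: ge_ereal_sup => _ [->|[F AF <-]].
  rewrite leeBrDr ?tvar_fin// add0e.
  apply: ge_ereal_sup => _ [->|[G BG <-]]; first exact: tvar_ge0.
  by apply: le_trans (key _ _ (pt _ mA) BG); rewrite leeDr// nneseries_ge0.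
rewrite leeBrDr ?tvar_fin// addeC.
have Ffin : \sum_(n <oo) (enorm (vmeas (F n)))%:E \is a fin_num.
  rewrite ge0_fin_numE ?nneseries_ge0//.
  by rewrite (le_lt_trans (tvar_ub AF))// -ge0_fin_numE ?tvar_ge0// tvar_fin.
rewrite -leeBrDr//; apply: ge_ereal_sup => _ [->|[G BG <-]].
  rewrite leeBrDr// add0e.
  by apply: le_trans (key _ _ AF (pt _ mB)); rewrite leeDl// nneseries_ge0.
by rewrite leeBrDr// addeC key.
Qed.

Let tvar_mono A B : measurable A -> measurable B -> A `<=` B ->
  tvar A <= tvar B.
Proof.
move=> mA mB AB; have := @tvarU A (B `\` A) mA (measurableD mB mA).
rewrite setDIK setDUK// => /(_ erefl); apply: le_trans.
by rewrite leeDl// tvar_ge0.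
Qed.

Lemma tvar_semi_sigma_additive : semi_sigma_additive tvar.
Proof.
move=> A mA tA mUA.
suff -> : tvar (\bigcup_n A n) = \sum_(n <oo) tvar (A n).
  by apply: is_cvg_nneseries => n _ _; exact: tvar_ge0.
apply/eqP; rewrite eq_le; apply/andP; split; last first.
  apply: lime_le; first by apply: is_cvg_nneseries => n _ _; exact: tvar_ge0.
  apply: nearW => n; apply: (@le_trans _ _ (tvar (\big[setU/set0]_(0 <= i < n) A i))).
    elim: n => [|n IH]; first by rewrite !big_nil tvar0.
    rewrite !big_nat_recr//= (le_trans (leeD IH (lexx _)))// tvarU//.
      by apply: bigsetU_measurable => i _.
    rewrite big_mkord big_distrl/= big1// => i _; apply: contrapT.
    by move/eqP/set0P => /tA => /(_ I I) e; move: (ltn_ord i); rewrite e ltnn.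
  apply: tvar_mono => //.
    by apply: bigsetU_measurable => i _.
  by rewrite big_mkord; exact: bigsetU_bigcup.
apply: ge_ereal_sup => _ [->|[F [mF tF FA] <-]].
  by apply: nneseries_ge0 => n _ _; exact: tvar_ge0.
apply: (@le_trans _ _ (\sum_(k <oo) \sum_(n <oo) (enorm (vmeas (F k `&` A n)))%:E)).
  apply: lee_nneseries => // k _.
  have mFA n : measurable (F k `&` A n) by exact: measurableI.
  have tFA : trivIset setT (fun n => F k `&` A n) by exact: trivIset_setIl.
  have Fk : F k = \bigcup_n (F k `&` A n).
    rewrite -setI_bigcupr -FA; apply/esym/setIidPl => x Fx; by exists k.
  have c : (fun n => enorm (\sum_(0 <= m < n) vmeas (F k `&` A m))%R) @ \oo
      --> enorm (vmeas (F k)).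
    apply: cvg_enorm => i.
    have := @charge_semi_sigma_additive _ _ _ (nu i) _ mFA tFA.
    rewrite -Fk => /(_ (mF k)).
    have -> : (fun n => \sum_(0 <= m < n) nu i (F k `&` A m)) =
        EFin \o (fun n => ((\sum_(0 <= m < n) vmeas (F k `&` A m)) 0 i)%R).
      apply/funext => n /=; rewrite summxE -sumEFin; apply: eq_bigr => m _.
      by rewrite mxE fineK// fin_num_measure.
    rewrite -[nu i (F k)]fineK ?fin_num_measure//.
    by move/fine_cvgP => [_]; rewrite mxE.
  have -> : (enorm (vmeas (F k)))%:E =
      limn (fun n => (enorm (\sum_(0 <= m < n) vmeas (F k `&` A m))%R)%:E).
    by apply/esym/cvg_lim => //; apply: cvg_EFin c; exact: nearW.
  apply: lee_lim.
  - by apply/cvg_ex; exists (enorm (vmeas (F k)))%:E; apply: cvg_EFin c; exact: nearW.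
  - exact: is_cvg_nneseries.
  - by apply: nearW => n; rewrite sumEFin lee_fin; exact: enorm_sum.
rewrite nneseries_interchange//.
apply: lee_nneseries => [n _ |n _]; first by move=> *; apply: nneseries_ge0.
apply: (@tvar_ub (A n) (fun k => F k `&` A n)); split.
- by move=> k; exact: measurableI.
- exact: trivIset_setIr.
- rewrite -setI_bigcupl FA; apply/setIidPr => x Ax; by exists n.
Qed.

HB.instance Definition _ := isMeasure.Build _ _ _ tvar
  tvar0 tvar_ge0 tvar_semi_sigma_additive.

HB.instance Definition _ := @Measure_isFinite.Build _ _ _ tvar tvar_fin.

End vector_measure.

Section measure_add_finite.
Context {R : realType} {disp : measure_display} {T : measurableType disp}.
Variables m1 m2 : {finite_measure set T -> \bar R}.
Local Open Scope ereal_scope.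

HB.instance Definition _ := Measure.on (measure_add m1 m2).

Let measure_add_fin : fin_num_fun (measure_add m1 m2).
Proof. by move=> A mA; rewrite measure_addE fin_numD !fin_num_measure. Qed.

HB.instance Definition _ := @Measure_isFinite.Build _ _ _
  (measure_add m1 m2) measure_add_fin.

End measure_add_finite.

Section curves.
Context {R : realType} {d : nat}.
Local Notation leb := (@lebesgue_measure R).
Local Notation mR := (measurableTypeR R).

Definition unit_itv : set R := `[0, 1]%classic.

Implicit Type c : R -> 'rV[R]_d.

Local Open Scope charge_scope.
Local Open Scope ereal_scope.

Definition charge_integral (nu : {charge set mR -> \bar R}) (f : R -> R)
    : \bar R :=
  let P := cid (Hahn_decomposition nu) in
  let N := cid (projT2 P) in
  \int[jordan_pos (projT2 N)]_x (f x)%:E - \int[jordan_neg (projT2 N)]_x (f x)%:E.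

Definition test_function (phi : R -> R) :=
  (forall n x, derivable (derive1n n phi) x 1) /\
  exists a b : R, [/\ (0 < a)%R, (b < 1)%R &
    forall x, ~ (a <= x <= b)%R -> phi x = 0%R].

(* The distributional derivative lives on the open interval ]0, 1[; it is
   represented by signed measures on the line that charge nothing else. *)
Definition is_distr_derivative c (nu : 'I_d -> {charge set mR -> \bar R}) :=
  (forall i (A : set mR), measurable A -> nu i A = nu i (A `&` `]0%R, 1%R[)) /\
  (forall i phi, test_function phi ->
    \int[leb]_(x in unit_itv) (c x 0 i * derive1 phi x)%:E =
    - charge_integral (nu i) phi).

(* Only the restriction of c to [0, 1], up to a Lebesgue null set, matters. *)
Definition BV c :=
  (forall i, leb.-integrable unit_itv (fun x => (c x 0%R i)%:E)) /\
  exists nu, is_distr_derivative c nu.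

Definition Dcurve c : 'I_d -> {charge set mR -> \bar R} :=
  if pselect (exists nu, is_distr_derivative c nu) is left h then sval (cid h)
  else fun=> czero.

Definition polar c (x : R) : 'rV[R]_d :=
  \row_i fine (('d (Dcurve c i) '/d (tvar (Dcurve c))) x).

Definition len c : \bar R := tvar (Dcurve c) unit_itv.

Definition abs_continuous c := forall eps : R, (0 < eps)%R ->
  exists2 delta : R, (0 < delta)%R &
    forall n (a b : 'I_n -> R),
      (forall k, (0 <= a k)%R /\ (a k <= b k)%R /\ (b k <= 1)%R) ->
      trivIset setT (fun k => `]a k, b k[%classic) ->
      (\sum_(k < n) (b k - a k) < delta)%R ->
      (\sum_(k < n) enorm (c (b k) - c (a k)) < eps)%R.

Definition strict_cvg (u : nat -> R -> 'rV[R]_d) c :=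
  [/\ forall k, BV (u k), BV c,
    \int[leb]_(x in unit_itv) (enorm (u k x - c x))%:E @[k --> \oo] --> 0 &
    len (u k) @[k --> \oo] --> len c].

Definition curve_derivative c (x : R) : 'rV[R]_d :=
  \row_i derive1 (fun y => c y 0%R i) x.

Definition direction (v : 'rV[R]_d) : 'rV[R]_d := ((enorm v)^-1 *: v)%R.

Definition similarity c1 c2 : \bar R :=
  \int[leb]_(x in unit_itv)
    (let v1 := curve_derivative c1 x in let v2 := curve_derivative c2 x in
     if (v1 == 0%R) || (v2 == 0%R) then 0%R
     else edot (direction v1) (direction v2)
          * Num.sqrt (enorm v1 * enorm v2))%:E.

Definition relaxed_similarity c1 c2 : \bar R :=
  ereal_sup [set s | exists u1 u2 : nat -> R -> 'rV[R]_d,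
    [/\ forall k, abs_continuous (u1 k) /\ abs_continuous (u2 k),
      strict_cvg u1 c1, strict_cvg u2 c2 &
      s = limn_esup (fun k => similarity (u1 k) (u2 k))]].

(* Lebesgue decomposition: nu - f leb is concentrated on the null set N. *)
Definition is_ac_density (nu : {charge set mR -> \bar R}) (f : R -> R) :=
  leb.-integrable setT (fun x => (f x)%:E) /\
  exists N : set mR, [/\ measurable N, leb N = 0 &
    forall A : set mR, measurable A ->
      nu A = \int[leb]_(x in A) (f x)%:E + nu (A `&` N)].

(* For a BV curve the pointwise derivative depends on the representative in
   the Lebesgue class, and may exist nowhere; the density does not. *)
Definition ac_derivative c (x : R) : 'rV[R]_d :=
  \row_i (xget (cst 0%R) [set f | is_ac_density (Dcurve c i) f]) x.

Definition atoms c : set R := [set x | exists i, Dcurve c i [set x] != 0].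

Definition jump_part c i (A : set mR) : \bar R := Dcurve c i (A `&` atoms c).

Definition cantor_part c i (A : set mR) : \bar R :=
  Dcurve c i A - \int[leb]_(x in A) (ac_derivative c x 0%R i)%:E
  - jump_part c i A.

Definition SBV c :=
  BV c /\ forall i (A : set mR), measurable A -> cantor_part c i A = 0.

Definition is_left_ess_lim c (x : R) (l : 'rV[R]_d) :=
  forall eps : R, (0 < eps)%R -> exists2 delta : R, (0 < delta)%R &
    {ae leb, forall y, (x - delta < y < x)%R -> (enorm (c y - l) < eps)%R}.

Definition is_right_ess_lim c (x : R) (l : 'rV[R]_d) :=
  forall eps : R, (0 < eps)%R -> exists2 delta : R, (0 < delta)%R &
    {ae leb, forall y, (x < y < x + delta)%R -> (enorm (c y - l) < eps)%R}.

Definition left_lim c (x : R) : 'rV[R]_d := xget 0%R [set l | is_left_ess_lim c x l].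

Definition right_lim c (x : R) : 'rV[R]_d := xget 0%R [set l | is_right_ess_lim c x l].

(* At 0 and at 1 only one of the two limits is taken inside [0, 1]. *)
Definition jump_set c : set R :=
  [set x | (0 < x < 1)%R /\ left_lim c x <> right_lim c x].

Definition jump c (x : R) : 'rV[R]_d := (right_lim c x - left_lim c x)%R.

Definition variation_sum c1 c2 :=
  measure_add (tvar (Dcurve c1)) (tvar (Dcurve c2)).

HB.instance Definition _ c1 c2 := FiniteMeasure.on (variation_sum c1 c2).

Definition variation_density c (m : {finite_measure set mR -> \bar R}) (x : R) : R :=
  fine (('d (charge_of_finite_measure (tvar (Dcurve c))) '/d m) x).

End curves.

(* Main.v *)
(* With [srv u = |u|^(-1/2) u], the integrand of the similarity is
   [sim u v = <srv u, srv v>]. It is 1-homogeneous, so the first formula says that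
   the relaxation is the integral of the positive part [psim] of [sim (f1, f2)],
   where [f_i] is the density of [D c_i] with respect to [m = |D c_1| + |D c_2|].

   For a grid of ]0, 1] put [v_i = D c_i(J)] and [n_i = |D c_i|(J)] on each cell
   [J]. The sums of [<v_1, v_2>^+ (n_1 n_2)^(-1/2)] over the cells converge to that
   integral as the mesh tends to 0, because cell averages converge in [L^1(m)].

   Upper bound: if absolutely continuous curves with derivatives [g_k] converge
   strictly to [c], replace on each cell the direction of [g_k] by [(v / n) phi],
   with a test function [phi] close to the indicator of the cell. The squared error,
   weighted by [|g_k|], is at most twice the defect [|g_k| - <(v / n) phi, g_k>],
   which is nonnegative and has total mass [len u_k - sum <v / n, int phi g_k>]; by
   weak convergence this is eventually as small as [sum (n - |v|^2 / n)], hence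
   small on a fine grid.

   Lower bound: let the derivative of [u_i] on [J] be [v_i] divided by the length of
   an interval on which it is supported: all of [J] if [<v_1, v_2> >= 0], and one of
   the two halves of [J] otherwise, a different one for each curve.

   For SBV curves, [D c_i] is absolutely continuous away from a countable set of
   atoms, where the integral is computed with respect to the Lebesgue measure, and
   an atom has mass equal to the jump. *)

Require Import Defs.
From HB Require Import structures.
From mathcomp Require Import all_boot all_order all_algebra.
From mathcomp Require Import all_classical all_reals all_analysis.
From mathcomp Require Import measurable_realfun ring lra.

Set Implicit Arguments.
Unset Strict Implicit.
Unset Printing Implicit Defensive.

Import Order.TTheory GRing.Theory Num.Theory.
Import numFieldNormedType.Exports.

Local Open Scope classical_set_scope.
Local Open Scope ring_scope.

(** * Euclidean vectors and square root velocities *)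

(** The derivative [Dcurve c] is picked by choice among the charges that satisfy the integration by
    parts formula, so its link with the classical derivative of an absolutely continuous curve must
    be built: by the lemma of du Bois-Reymond, [c] is almost everywhere a constant plus the
    distribution function of [Dcurve c], and absolute continuity then forces a Lebesgue density. The
    obstacle in the upper bound is that strict convergence says nothing directly about lengths on
    cells; it gives weak limits of the vector measures and the limit of the total length. The
    integrand, on the other hand, is a product of square roots. Young's inequality with a parameter
    [l] replaces such products by [l] times a length plus a defect over [l], both of which can be
    summed over the cells. So [l] is fixed first by the lengths, then the admissible defect by [l],
    then the grid, and the index of the sequence last. Interior grid points avoid the atoms of [m],
    as the test functions vanish at the ends of the cells and would miss mass sitting there. *)

Section euclidean_complements.
Context {R : realType} {d : nat}.
Implicit Types (u v w : 'rV[R]_d) (a b : R).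

Lemma edotC u v : edot u v = edot v u.
Proof. by apply: eq_bigr => i _; rewrite mulrC. Qed.

Lemma edotDl u v w : edot (u + v) w = edot u w + edot v w.
Proof. by rewrite /edot -big_split; apply: eq_bigr => i _; rewrite mxE mulrDl. Qed.

Lemma edotZl a u v : edot (a *: u) v = a * edot u v.
Proof. by rewrite /edot mulr_sumr; apply: eq_bigr => i _; rewrite mxE mulrA. Qed.

Lemma edotNl u v : edot (- u) v = - edot u v.
Proof. by rewrite -scaleN1r edotZl mulN1r. Qed.

Lemma edotBl u v w : edot (u - v) w = edot u w - edot v w.
Proof. by rewrite edotDl edotNl. Qed.

Lemma edotZr a u v : edot u (a *: v) = a * edot u v.
Proof. by rewrite !(edotC u) edotZl. Qed.

Lemma edotBr u v w : edot u (v - w) = edot u v - edot u w.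
Proof. by rewrite !(edotC u) edotBl. Qed.

Lemma edot0l u : edot 0 u = 0.
Proof. by rewrite -(scale0r 0) edotZl mul0r. Qed.

Lemma edot0r u : edot u 0 = 0.
Proof. by rewrite edotC edot0l. Qed.

Lemma sqr_enorm u : enorm u ^+ 2 = edot u u.
Proof. by rewrite sqr_sqrtr// edot_ge0. Qed.

Lemma normr_edot_le u v : `|edot u v| <= enorm u * enorm v.
Proof.
rewrite -sqrtr_sqr /enorm -sqrtrM ?edot_ge0//.
by rewrite ler_wsqrtr// edot_sqr_le.
Qed.

Lemma edot_le u v : edot u v <= enorm u * enorm v.
Proof. exact: le_trans (ler_norm _) (normr_edot_le _ _). Qed.

Lemma enormZ a u : enorm (a *: u) = `|a| * enorm u.
Proof. by rewrite /enorm edotZl edotZr mulrA -expr2 sqrtrM ?sqr_ge0// sqrtr_sqr. Qed.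

Lemma enormN u : enorm (- u) = enorm u.
Proof. by rewrite -scaleN1r enormZ normrN1 mul1r. Qed.

Lemma enormBC u v : enorm (u - v) = enorm (v - u).
Proof. by rewrite -enormN opprB. Qed.

Lemma enormB u v : enorm (u - v) <= enorm u + enorm v.
Proof. by rewrite -(enormN v) enormD. Qed.

Lemma enorm_coord u i : `|u 0 i| <= enorm u.
Proof.
rewrite -sqrtr_sqr ler_wsqrtr// /edot (bigD1 i)//= expr2 lerDl sumr_ge0// => j _.
by rewrite -expr2 sqr_ge0.
Qed.

Lemma enorm_eq0 u : (enorm u == 0) = (u == 0).
Proof.
apply/eqP/eqP => [u0|->]; last exact: enorm0.
apply/rowP => i; rewrite mxE; apply/eqP; rewrite -normr_eq0 eq_le normr_ge0 andbT.
by rewrite -u0 enorm_coord.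
Qed.

Lemma enorm_gt0 u : (0 < enorm u) = (u != 0).
Proof. by rewrite lt_def enorm_ge0 enorm_eq0 andbT. Qed.

Lemma enorm_triB u v : `|enorm u - enorm v| <= enorm (u - v).
Proof.
have h x y : enorm x - enorm y <= enorm (x - y).
  by rewrite lerBlDr (le_trans _ (enormD _ _))// subrK.
by rewrite ler_norml h andbT lerNl opprB enormBC h.
Qed.

Lemma enorm_direction_le u : enorm (direction u) <= 1.
Proof.
rewrite /direction enormZ ger0_norm ?invr_ge0 ?enorm_ge0//.
have [->|u0] := eqVneq (enorm u) 0; first by rewrite mulr0.
by rewrite mulVf.
Qed.

Lemma edot_direction u : edot (direction u) u = enorm u.
Proof.
rewrite /direction edotZl -sqr_enorm.
have [->|u0] := eqVneq (enorm u) 0; first by rewrite expr0n mulr0.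
by rewrite expr2 mulKf.
Qed.

Lemma normB_max a b : `|Num.max a 0 - Num.max b 0| <= `|a - b|.
Proof.
rewrite ler_norml !maxElt; case: ifP => ha; case: ifP => hb; move: ha hb;
  have [h|h] := lerP 0 (a - b); rewrite ?(ger0_norm h) ?(ltr0_norm h) => /[swap];
  move: h; lra.
Qed.

(* The square root velocity transform of the paper: the similarity of two
   curves is the L^2 product of the transforms of their derivatives. *)
Definition srv u := (Num.sqrt (enorm u))^-1 *: u.

Definition sim u v := edot (srv u) (srv v).

Definition psim u v := Num.max (sim u v) 0.

Lemma enorm_srv u : enorm (srv u) = Num.sqrt (enorm u).
Proof.
rewrite /srv enormZ ger0_norm ?invr_ge0 ?sqrtr_ge0//.
have [->|u0] := eqVneq (Num.sqrt (enorm u)) 0; first by rewrite invr0 mul0r.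
by rewrite -{2}(sqr_sqrtr (enorm_ge0 u)) expr2 mulKf.
Qed.

(** Since the inverse of 0 is 0, both sides vanish when one of the vectors does, which is the
    convention of the integrand in [similarity]. *)
Lemma simE u v :
  sim u v = edot (direction u) (direction v) * Num.sqrt (enorm u * enorm v).
Proof.
rewrite /sim /srv /direction !edotZl !edotZr sqrtrM ?enorm_ge0//.
have e x : (enorm x)^-1 = ((Num.sqrt (enorm x))^-1)^+2.
  by rewrite exprVn sqr_sqrtr// enorm_ge0.
rewrite 2!e.
have gen (a b k : R) : a^-1 * (b^-1 * k) = a^-1 ^+ 2 * (b^-1 ^+ 2 * k) * (a * b).
  have [->|a0] := eqVneq a 0; first by rewrite invr0 expr0n !mul0r.
  have [->|b0] := eqVneq b 0; first by rewrite invr0 expr0n !(mul0r, mulr0).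
  by field; rewrite ?a0 ?b0.
exact: gen.
Qed.

Lemma psimE u v : psim u v =
  Num.max (edot (direction u) (direction v)) 0 * Num.sqrt (enorm u * enorm v).
Proof. by rewrite /psim simE maxr_pMl ?sqrtr_ge0// mul0r. Qed.

Lemma sim0l v : sim 0 v = 0.
Proof. by rewrite /sim /srv scaler0 edot0l. Qed.

Lemma sim0r v : sim v 0 = 0.
Proof. by rewrite /sim /srv scaler0 edot0r. Qed.

Lemma psim_ge0 u v : 0 <= psim u v.
Proof. by rewrite le_max lexx orbT. Qed.

Lemma simZ a u v : 0 <= a -> sim (a *: u) (a *: v) = a * sim u v.
Proof.
rewrite le_eqVlt => /predU1P[<-|a0]; first by rewrite !scale0r sim0l mul0r.
rewrite /sim /srv !enormZ !gtr0_norm// !sqrtrM ?(ltW a0)//.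
rewrite !scalerA !edotZl !edotZr.
(* Writing [a] as the square of its root makes the identity rational. *)
have e : a = Num.sqrt a ^+ 2 by rewrite sqr_sqrtr ?ltW.
have s0 : Num.sqrt a != 0 by rewrite gt_eqF// sqrtr_gt0.
rewrite {2 4 5}e; set s := Num.sqrt a in s0 *; rewrite !invfM.
move: (Num.sqrt (enorm u))^-1 (Num.sqrt (enorm v))^-1 => x y.
by field.
Qed.

Lemma psimZ a u v : 0 <= a -> psim (a *: u) (a *: v) = a * psim u v.
Proof. by move=> a0; rewrite /psim simZ// maxr_pMr// mulr0. Qed.

Lemma psim0l v : psim 0 v = 0.
Proof. by rewrite /psim sim0l maxxx. Qed.

Lemma psim0r v : psim v 0 = 0.
Proof. by rewrite /psim sim0r maxxx. Qed.

Lemma sim_le u v : sim u v <= Num.sqrt (enorm u) * Num.sqrt (enorm v).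
Proof. by rewrite (le_trans (edot_le _ _))// !enorm_srv. Qed.

Lemma psim_le u v : psim u v <= Num.sqrt (enorm u) * Num.sqrt (enorm v).
Proof. by rewrite ge_max sim_le mulr_ge0 ?sqrtr_ge0. Qed.

Lemma normr_sim_le u v : `|sim u v| <= (enorm u + enorm v) / 2.
Proof.
rewrite (le_trans (normr_edot_le _ _))// !enorm_srv.
rewrite -{2}(sqr_sqrtr (enorm_ge0 u)) -{2}(sqr_sqrtr (enorm_ge0 v)).
move: (Num.sqrt _) (Num.sqrt _) => a b.
have := sqr_ge0 (a - b); rewrite sqrrB; lra.
Qed.

Lemma normB_psim (P1 P2 Q1 Q2 : 'rV[R]_d) :
  enorm P2 <= 1 -> enorm Q1 <= 1 ->
  `|Num.max (edot P1 P2) 0 - Num.max (edot Q1 Q2) 0| <=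
  enorm (P1 - Q1) + enorm (P2 - Q2).
Proof.
move=> h1 h2; rewrite (le_trans (normB_max _ _))//.
have -> : edot P1 P2 - edot Q1 Q2 = edot (P1 - Q1) P2 + edot Q1 (P2 - Q2).
  by rewrite edotBl edotBr addrA subrK.
rewrite (le_trans (ler_normD _ _))// lerD// (le_trans (normr_edot_le _ _))//.
  by rewrite -[leRHS]mulr1 ler_wpM2l ?enorm_ge0.
by rewrite -[leRHS]mul1r ler_wpM2r ?enorm_ge0.
Qed.

(** Square roots of deviations come out of [normalize_dev], while only integrals of deviations are
    known to be small. This linear bound passes to the integral, at the price of the free parameter
    [b], fixed before the grid. *)
Lemma sqrt_le_lin a b : 0 <= a -> 0 < b -> Num.sqrt a <= b + a / b.
Proof.
move=> a0 b0; rewrite -{2}(sqr_sqrtr a0); set s := Num.sqrt a.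
have s0 : 0 <= s by exact: sqrtr_ge0.
rewrite -(ler_pM2r b0) mulrDl divfK ?gt_eqF//.
have [h|h] := lerP s b; first by have := sqr_ge0 s; nra.
nra.
Qed.

End euclidean_complements.

(** * Densities of vector measures *)

Section integral_complements.
Import HBNNSimple.
Context {R : realType} {disp : measure_display} {T : measurableType disp}.
Variable mu : {measure set T -> \bar R}.
Implicit Types (A B D N : set T) (f g : T -> R).

(* Unlike ae_eq_integral, no measurability is required: a curve may have
   arbitrary derivatives on a null set. *)
Lemma ge0_le_integral_off_null N (f g : T -> \bar R) :
  measurable N -> mu N = 0%E -> (forall x, 0 <= f x)%E -> (forall x, 0 <= g x)%E ->
  (forall x, ~ N x -> f x <= g x)%E -> (\int[mu]_x f x <= \int[mu]_x g x)%E.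
Proof.
move=> mN N0 f0 g0 fg; rewrite !ge0_integralTE//.
apply: ge_ereal_sup => _ [h hf <-]; apply: ereal_sup_ubound.
exists (proj_nnsfun h (measurableC mN)).
  move=> x /=; rewrite mindicE in_setC; have [xN|xN] := boolP (x \in N).
    by rewrite mulr0.
  by rewrite mulr1 (le_trans (hf x))// fg//; move=> /mem_set; apply/negP.
rewrite -!integralT_nnsfun; apply: ge0_ae_eq_integral => //=.
- by apply/measurable_EFinP; apply: measurable_funM => //; exact: measurable_funP.
- by apply/measurable_EFinP; exact: measurable_funP.
- by move=> x _; rewrite lee_fin mulr_ge0// mindicE.
- by move=> x _; rewrite lee_fin.
exists N; split => // x; apply: contra_notP => xN /= _.
  by rewrite mindicE in_setC memNset// mulr1.
Qed.

Lemma eq_integral_off_null N D (f g : T -> \bar R) :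
  measurable N -> mu N = 0%E -> (forall x, D x -> ~ N x -> f x = g x) ->
  (\int[mu]_(x in D) f x = \int[mu]_(x in D) g x)%E.
Proof.
move=> mN N0 fg.
have key (u v : T -> \bar R) : (forall x, 0 <= u x)%E -> (forall x, 0 <= v x)%E ->
    (forall x, ~ N x -> u x = v x) -> (\int[mu]_x u x = \int[mu]_x v x)%E.
  by move=> u0 v0 uv; apply/eqP; rewrite eq_le; apply/andP; split;
    apply: (ge0_le_integral_off_null mN) => // x Nx; rewrite uv.
have h x : ~ N x -> (f \_ D) x = (g \_ D) x.
  by move=> Nx; rewrite !patchE; case: ifPn => // /set_mem Dx; exact: fg.
rewrite integral_mkcond [RHS]integral_mkcond integralE [RHS]integralE.
congr (_ - _)%E; apply: key => // x Nx.
- by rewrite !funeposE h.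
- by rewrite !funenegE h.
Qed.

(** On the set where [f >= 0] the integral is both nonnegative and nonpositive, so [f] vanishes
    there almost everywhere. *)
Lemma ae_le0_of_integral_le0 f : mu.-integrable setT (EFin \o f) ->
  (forall B, measurable B -> \int[mu]_(x in B) (f x)%:E <= 0)%E ->
  {ae mu, forall x, f x <= 0}.
Proof.
move=> If h.
have mf : measurable_fun setT f by exact/measurable_EFinP/(measurable_int mu).
pose B := [set x | 0 <= f x].
have mB : measurable B.
  by rewrite -[B]setTI; apply: measurable_fun_le.
have IB := integrableS measurableT mB (@subsetT _ B) If.
have : (\int[mu]_(x in B) `|(f x)%:E| = 0)%E.
  apply/eqP; rewrite eq_le integral_ge0// andbT (le_trans _ (h _ mB))//.
  rewrite le_eqVlt; apply/orP; left; apply/eqP/eq_integral => x /set_mem Bx.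
  by rewrite gee0_abs.
move/(ae_eq_integral_abs _ mB); have mfB : measurable_fun B (EFin \o f).
  by apply/measurable_EFinP; exact: measurable_funTS.
move=> /(_ mfB); apply: filterS => x /= xB.
have [|/ltW//] := leP 0 (f x) => fx.
by have := xB fx => -[->].
Qed.

End integral_complements.

Section vector_measurable.
Context {R : realType} {disp : measure_display} {T : measurableType disp} {d : nat}.
Implicit Types f g : T -> 'rV[R]_d.

Definition vmeasurable f := forall i, measurable_fun setT (fun x => f x 0 i).

Lemma measurable_edot f g : vmeasurable f -> vmeasurable g ->
  measurable_fun setT (fun x => edot (f x) (g x)).
Proof. by move=> mf mg; apply: measurable_sum => i; exact: measurable_funM. Qed.

Lemma measurable_enorm f : vmeasurable f -> measurable_fun setT (fun x => enorm (f x)).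
Proof.
move=> mf; apply: measurableT_comp (continuous_measurable_fun (@sqrt_continuous R)) _.
exact: measurable_edot.
Qed.

Lemma vmeasurable_scale (a : T -> R) f : measurable_fun setT a -> vmeasurable f ->
  vmeasurable (fun x => a x *: f x).
Proof.
move=> ma mf i; rewrite (_ : (fun x => _) = fun x => a x * f x 0 i); last first.
  by apply/funext => x; rewrite mxE.
exact: measurable_funM.
Qed.

Lemma vmeasurable_cst v : vmeasurable (cst v). Proof. by move=> i. Qed.

Lemma measurable_sim f g : vmeasurable f -> vmeasurable g ->
  measurable_fun setT (fun x => sim (f x) (g x)).
Proof.
have h u : vmeasurable u -> vmeasurable (fun x => srv (u x)).
  move=> mu; apply: vmeasurable_scale => //.
  (* The inverse of the root is discontinuous at 0; as the real power of exponent -1/2 it is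
     measurable, and the values at 0 agree. *)
  rewrite (_ : (fun x => _) = fun x => enorm (u x) `^ (- 2^-1)).
    exact: measurableT_comp (measurable_powR _) (measurable_enorm mu).
  by apply/funext => x; rewrite powRN powR12_sqrt// enorm_ge0.
by move=> mf mg; apply: measurable_edot; exact: h.
Qed.

Lemma measurable_psim f g : vmeasurable f -> vmeasurable g ->
  measurable_fun setT (fun x => psim (f x) (g x)).
Proof.
by move=> mf mg; apply: measurable_maxr => //; exact: measurable_sim.
Qed.

End vector_measurable.

Section vector_density.
Context {R : realType} {disp : measure_display} {T : measurableType disp} {d : nat}.
Implicit Types (mu : {measure set T -> \bar R}) (A B : set T)
  (f : T -> 'rV[R]_d) (nu : 'I_d -> {charge set T -> \bar R}).

Definition vintegrable mu f :=
  forall i, mu.-integrable setT (EFin \o (fun x => f x 0 i)).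

Definition vdensity mu nu f := vintegrable mu f /\
  forall i A, measurable A -> nu i A = (\int[mu]_(x in A) (f x 0 i)%:E)%E.

Lemma vintegrable_measurable mu f : vintegrable mu f -> vmeasurable f.
Proof. by move=> If i; apply/measurable_EFinP/(measurable_int mu)/If. Qed.

Lemma integrable_edot mu f (q : 'rV[R]_d) : vintegrable mu f ->
  mu.-integrable setT (EFin \o (fun x => edot q (f x))).
Proof.
move=> If; rewrite (_ : _ \o _ = fun x => (\sum_(i < d) (q 0 i)%:E * (f x 0 i)%:E)%E).
  by apply: integrable_sum => // i _; apply: integrableZl => //; exact: If.
by apply/funext => x /=; rewrite -sumEFin.
Qed.

Lemma integral_edot mu f (q : 'rV[R]_d) A : measurable A -> vintegrable mu f ->
  (\int[mu]_(x in A) (edot q (f x))%:E =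
   \sum_(i < d) (q 0 i)%:E * \int[mu]_(x in A) (f x 0 i)%:E)%E.
Proof.
move=> mA If.
under eq_integral do rewrite -sumEFin.
rewrite integral_sum//; last first.
  move=> i; under eq_fun do rewrite EFinM.
  by apply: integrableZl => //; exact: integrableS (If i).
apply: eq_bigr => i _; under eq_integral do rewrite EFinM.
by rewrite integralZl//; exact: integrableS (If i).
Qed.

Lemma integrable_enorm mu f : vintegrable mu f ->
  mu.-integrable setT (EFin \o (fun x => enorm (f x))).
Proof.
move=> If; apply: (@le_integrable _ _ _ _ _ measurableT _
    (fun x => (\sum_(i < d) `|(f x 0 i)%:E|)%E)).
- by apply/measurable_EFinP/measurable_enorm; exact: vintegrable_measurable If.
- move=> x _ /=; rewrite ger0_norm ?enorm_ge0//.
  by rewrite sumEFin lee_fin (le_trans (enorm_le_sum _))// ler_norm.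
- apply: integrable_sum => // i _.
  by have := integrable_norm (If i).
Qed.

Lemma vdensity_edot mu nu f (q : 'rV[R]_d) A : measurable A -> vdensity mu nu f ->
  ((edot q (vmeas nu A))%:E = \int[mu]_(x in A) (edot q (f x))%:E)%E.
Proof.
move=> mA [If nuE]; rewrite integral_edot// -sumEFin; apply: eq_bigr => i _.
by rewrite mxE EFinM fineK ?fin_num_measure// nuE.
Qed.

(** Pairing with the direction of [vmeas nu A] turns its norm into a scalar integral, which
    Cauchy-Schwarz bounds pointwise. *)
Lemma vdensity_enorm_vmeas_le mu nu f A : measurable A -> vdensity mu nu f ->
  ((enorm (vmeas nu A))%:E <= \int[mu]_(x in A) (enorm (f x))%:E)%E.
Proof.
move=> mA dnu; rewrite -edot_direction (vdensity_edot _ mA dnu).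
apply: le_integral => //.
- by apply: integrableS (integrable_edot _ dnu.1).
- by apply: integrableS (integrable_enorm dnu.1).
- move=> x _; rewrite lee_fin (le_trans (edot_le _ _))//.
  by rewrite -[leRHS]mul1r ler_wpM2r ?enorm_ge0// enorm_direction_le.
Qed.

Lemma tvar_le_density mu nu f A : measurable A -> vdensity mu nu f ->
  (tvar nu A <= \int[mu]_(x in A) (enorm (f x))%:E)%E.
Proof.
move=> mA dnu; apply: ge_ereal_sup => _ [->|[F [mF tF FA] <-]].
  by apply: integral_ge0 => x _; rewrite lee_fin enorm_ge0.
rewrite -FA ge0_integral_bigcup//; last first.
  - by move=> x _; rewrite lee_fin enorm_ge0.
  - apply/measurable_EFinP/measurable_funTS/measurable_enorm.
    exact: vintegrable_measurable dnu.1.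
apply: lee_nneseries => n _ ; first by rewrite lee_fin enorm_ge0.
exact: vdensity_enorm_vmeas_le.
Qed.

Lemma edot_vmeas_le_tvar nu (q : 'rV[R]_d) A : measurable A ->
  ((edot q (vmeas nu A))%:E <= (enorm q)%:E * tvar nu A)%E.
Proof.
move=> mA; rewrite (@le_trans _ _ ((enorm q * enorm (vmeas nu A))%:E))%E//.
  by rewrite lee_fin edot_le.
rewrite EFinM lee_wpmul2l ?lee_fin ?enorm_ge0//.
have FA : measurable_partition A (fun n => if n is 0%N then A else set0).
  split; [by case|by move=> [|i] [|j] _ _ // [x []]|].
  by apply/seteqP; split => [x [[|n] _]//|x Ax]; exists 0%N.
apply: le_trans (tvar_ub nu FA); rewrite (nneseries_split 0%N 1%N)//; last first.
  by move=> k _; rewrite lee_fin enorm_ge0.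
by rewrite big_nat1 leeDl// nneseries_ge0// => n _ _; rewrite lee_fin enorm_ge0.
Qed.

Lemma rat_vec_dense (v : 'rV[R]_d) (e : R) : 0 < e ->
  exists q : 'rV[rat]_d, enorm (v - map_mx ratr q) <= e.
Proof.
(* Dividing by [d + 1] instead of [d] covers [d = 0]. *)
move=> e0; pose e' := e / d.+1%:R.
have e'0 : 0 < e' by rewrite divr_gt0.
have h i : {q : rat | `|v 0 i - ratr q| <= e'}.
  apply: cid; have [q] := @rat_in_itvoo R (v 0 i - e') (v 0 i) ltac:(lra).
  by rewrite in_itv/= => /andP[h1 h2]; exists q; rewrite ler_norml; lra.
exists (\row_i sval (h i)); rewrite (le_trans (enorm_le_sum _))//.
apply: (@le_trans _ _ (\sum_(i < d) e')).
  by apply: ler_sum => i _; rewrite !mxE; exact: (svalP (h i)).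
rewrite sumr_const card_ord -mulr_natr /e' -mulrA ger_pMr// mulrC.
by rewrite ler_pdivrMr// mul1r ler_nat.
Qed.

(* [dtvar/dmu] dominates [<q, f> / |q|] almost everywhere for each of the
   countably many rational vectors [q], hence it dominates [|f|]. *)
Lemma tvar_density (mu : {sigma_finite_measure set T -> \bar R}) nu f A :
  measurable A -> vdensity mu nu f ->
  tvar nu A = (\int[mu]_(x in A) (enorm (f x))%:E)%E.
Proof.
move=> mA dnu; apply/eqP; rewrite eq_le tvar_le_density//=.
have If := dnu.1.
have mf := vintegrable_measurable If.
pose tv : {finite_measure set T -> \bar R} := tvar nu.
have tvmu : charge_of_finite_measure tv `<< mu.
  apply/null_content_dominatesP => B mB B0.
  apply/eqP; rewrite eq_le measure_ge0 andbT (le_trans (tvar_le_density mB dnu))//.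
  rewrite null_set_integral//.
  by apply/measurable_EFinP/measurable_funTS/measurable_enorm.
pose h x := fine (Radon_Nikodym (charge_of_finite_measure tv) mu x).
have hE : EFin \o h = Radon_Nikodym (charge_of_finite_measure tv) mu.
  by apply/funext => x /=; rewrite fineK// Radon_Nikodym_fin_num.
have Ih : mu.-integrable setT (EFin \o h).
  by rewrite hE; exact: Radon_Nikodym_integrable.
have tvE B : measurable B -> tvar nu B = (\int[mu]_(x in B) (h x)%:E)%E.
  move=> mB; rewrite -[LHS]/(charge_of_finite_measure tv B).
  by rewrite (Radon_Nikodym_integral tvmu mB) -hE.
have h0 : {ae mu, forall x, 0 <= h x}.
  have : {ae mu, forall x, - h x <= 0}.
    apply: ae_le0_of_integral_le0.
      by have := integrableN Ih.
    move=> B mB; under eq_integral do rewrite EFinN.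
    rewrite (_ : (fun x => - (h x)%:E)%E = (\- (EFin \o h))%E)//.
    rewrite integralN; last first.
      by apply: integrable_add_def => //; exact: integrableS Ih.
    by rewrite -tvE// oppe_le0 tvar_ge0.
  by apply: filterS => x; rewrite oppr_le0.
have hq : {ae mu, forall x (q : 'rV[rat]_d),
    edot (map_mx ratr q) (f x) <= enorm (map_mx ratr q : 'rV[R]_d) * h x}.
  (* The rational vectors are enumerated through [pickle], so that a countable union of null sets
     suffices. *)
  have : {ae mu, forall x (n : nat), forall q : 'rV[rat]_d, unpickle n = Some q ->
    edot (map_mx ratr q) (f x) <= enorm (map_mx ratr q : 'rV[R]_d) * h x}.
    apply: ae_foralln => n; case: (unpickle n) => [q|]; last exact: aeW.
    set q' : 'rV[R]_d := map_mx ratr q.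
    have : {ae mu, forall x, edot q' (f x) - enorm q' * h x <= 0}.
      have I1 := integrable_edot q' If.
      have I2 : mu.-integrable setT (EFin \o (fun x => enorm q' * h x)).
        by have := integrableZl measurableT (enorm q') Ih.
      apply: ae_le0_of_integral_le0; first by have := integrableB measurableT I1 I2.
      move=> B mB; under eq_integral do rewrite EFinB.
      rewrite integralB_EFin//; [|exact: integrableS I1|exact: integrableS I2].
      rewrite -(vdensity_edot _ mB dnu).
      under eq_integral do rewrite EFinM.
      rewrite integralZl//; last exact: integrableS Ih.
      by rewrite -tvE// sube_le0 edot_vmeas_le_tvar.
    by apply: filterS => x hx _ [<-]; rewrite -subr_le0.
  by apply: filterS => x hx q; apply: (hx (pickle q)); rewrite pickleK.
rewrite tvE//.
have mh : measurable_fun setT h by exact/measurable_EFinP/(measurable_int mu).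
have -> : (\int[mu]_(x in A) (h x)%:E = \int[mu]_(x in A) `|h x|%:E)%E.
  apply: ae_eq_integral => //.
  - by apply/measurable_EFinP; exact: measurable_funTS.
  - by apply/measurable_EFinP; apply: measurable_funTS; exact: measurableT_comp.
  - by apply: filterS h0 => x hx _; rewrite ger0_norm.
apply: ae_ge0_le_integral => //.
- by move=> x _; rewrite lee_fin enorm_ge0.
- by apply/measurable_EFinP/measurable_funTS/measurable_enorm.
- by apply/measurable_EFinP; apply: measurable_funTS; exact: measurableT_comp.
apply: filterS2 hq h0 => x qx hx _; rewrite lee_fin ger0_norm//.
(* With [q] within [e] of [f x], [|f|^2 = <q, f> + <f - q, f>] is at most [(|f| + e) h + e |f|].
   Letting [e] tend to 0 and dividing by [|f|] gives [|f| <= h]. *)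
have key e : 0 < e -> enorm (f x) ^+ 2 <= enorm (f x) * h x + e * (h x + enorm (f x)).
  move=> e0; have [q qe] := rat_vec_dense (f x) e0.
  have := qx q; set q' : 'rV[R]_d := map_mx _ q in qe *.
  have -> : enorm (f x) ^+ 2 = edot q' (f x) + edot (f x - q') (f x).
    by rewrite sqr_enorm -edotDl addrC subrK.
  have h1 := edot_le (f x - q') (f x).
  have h2 : enorm q' <= enorm (f x) + e.
    rewrite -[q'](subrK (f x)) (le_trans (enormD _ _))// addrC lerD2l.
    by rewrite enormBC.
  have := enorm_ge0 (f x); have := enorm_ge0 q'; have := enorm_ge0 (f x - q').
  move: (edot _ _) (edot _ _) h1 => A1 A2; nra.
have {}key : enorm (f x) ^+ 2 <= enorm (f x) * h x.
  apply/ler_addgt0Pr => e e0.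
  have s0 : 0 < h x + enorm (f x) + 1 by have := enorm_ge0 (f x); lra.
  rewrite (le_trans (key (e / (h x + enorm (f x) + 1)) _)) ?divr_gt0//.
  rewrite lerD2l mulrAC -mulrA ger_pMr// ler_pdivrMr// mul1r; lra.
have [f0|] := eqVneq (enorm (f x)) 0; first by rewrite f0.
move=> f0; move: key; rewrite expr2 ler_pM2l//.
by rewrite lt_def f0 enorm_ge0.
Qed.

End vector_density.

Section integral_density.
Context {R : realType} {disp : measure_display} {T : measurableType disp}.
Variables (mu : {sigma_finite_measure set T -> \bar R}).
Variables (la : {finite_measure set T -> \bar R}) (g : T -> R).
Hypothesis Ig : mu.-integrable setT (EFin \o g).
Hypothesis laE : forall A, measurable A -> la A = (\int[mu]_(x in A) (g x)%:E)%E.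

Let lamu : charge_of_finite_measure la `<< mu.
Proof.
apply/null_content_dominatesP => A mA A0.
rewrite -[LHS]/(la A) laE// null_set_integral//.
exact: measurable_funTS (measurable_int mu Ig).
Qed.

Lemma density_RN : ae_eq mu setT (Radon_Nikodym (charge_of_finite_measure la) mu)
  (EFin \o g).
Proof.
apply: integral_ae_eq => //.
- exact: Radon_Nikodym_integrable.
- exact: measurable_int Ig.
- by move=> E _ mE; rewrite -Radon_Nikodym_integral// -[LHS]/(la E) laE.
Qed.

Lemma integral_density E (phi : T -> R) : measurable E ->
  la.-integrable E (EFin \o phi) ->
  (\int[la]_(x in E) (phi x)%:E = \int[mu]_(x in E) (phi x * g x)%:E)%E.
Proof.
move=> mE Iphi; rewrite -(Radon_Nikodym_change_of_variables lamu)//.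
have mphi := measurable_int la Iphi.
apply: ae_eq_integral => //.
- apply: emeasurable_funM => //; apply: measurable_funTS.
  by apply: measurable_int (Radon_Nikodym_integrable lamu).
- under eq_fun do rewrite EFinM; apply: emeasurable_funM => //.
  exact: measurable_funTS (measurable_int mu Ig).
- by apply: filterS density_RN => x /= h _; rewrite EFinM -(h I).
Qed.

End integral_density.

(** * Integration against a charge that has a density *)

Section jordan_integral_density.
Context {R : realType} {disp : measure_display} {T : measurableType disp}.

Lemma le_integrableR (mu : {measure set T -> \bar R}) (D : set T) (f g : T -> R) :
  measurable D -> measurable_fun D f -> (forall x, D x -> `|f x| <= `|g x|) ->
  mu.-integrable D (EFin \o g) -> mu.-integrable D (EFin \o f).
Proof.
move=> mD mf fg; apply: le_integrable => //; exact/measurable_EFinP.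
Qed.

Lemma bounded_integrable (la : {finite_measure set T -> \bar R}) (D : set T)
    (phi : T -> R) : measurable D ->
  measurable_fun D phi -> (exists M, forall x, `|phi x| <= M) ->
  la.-integrable D (EFin \o phi).
Proof.
move=> mD mphi [M hM]; apply: measurable_bounded_integrable => //.
  by have := fin_num_measure la _ mD; rewrite ge0_fin_numE.
exists M; split; first exact: num_real.
by move=> x Mx y _ /=; rewrite (le_trans (hM y))// ltW.
Qed.

Variables (mu : {sigma_finite_measure set T -> \bar R}).
Variables (nu : {charge set T -> \bar R}) (g : T -> R).
Hypothesis Ig : mu.-integrable setT (EFin \o g).
Hypothesis nuE : forall A : set T, measurable A -> nu A = (\int[mu]_(x in A) (g x)%:E)%E.

(** Stated for every Hahn decomposition, because [charge_integral] uses one picked by choice. The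
    positive and negative variations have densities [g 1_P] and [- g 1_N], and [1_P + 1_N = 1]. *)
Lemma jordan_integral_density P N (PN : hahn_decomposition nu P N) (phi : T -> R) :
  measurable_fun setT phi -> (exists M, forall x, `|phi x| <= M) ->
  (\int[jordan_pos PN]_x (phi x)%:E - \int[jordan_neg PN]_x (phi x)%:E =
     \int[mu]_x (phi x * g x)%:E)%E.
Proof.
move=> mphi bphi.
have [[mP _] [mN _] PNT PN0] := PN.
have mg : measurable_fun (setT : set T) g by apply/measurable_EFinP; exact: measurable_int Ig.
have IgA (A : set T) : measurable A -> mu.-integrable setT (EFin \o (fun x => g x * \1_A x)).
  move=> mA; apply: (@le_integrableR mu _ _ g) => //.
    exact: measurable_funM.
  move=> x _ /=; rewrite normrM indicE; case: (_ \in _); rewrite ?normr1 ?mulr1//.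
  by rewrite normr0 mulr0.
have IgAE (A B : set T) : measurable A -> measurable B ->
    (\int[mu]_(x in B) (g x * \1_A x)%:E = \int[mu]_(x in B `&` A) (g x)%:E)%E.
  move=> mA mB; rewrite integral_mkcondr; apply: eq_integral => x _.
  by rewrite patchE indicE; case: (_ \in _); rewrite ?mulr1 ?mulr0.
have posE (A : set T) : measurable A ->
    jordan_pos PN A = (\int[mu]_(x in A) (g x * \1_P x)%:E)%E.
  move=> mA; rewrite IgAE// jordan_posE cjordan_posE /crestr0 mem_set//= /crestr.
  by rewrite nuE//; exact: measurableI.
have negE (A : set T) : measurable A ->
    jordan_neg PN A = (\int[mu]_(x in A) (- (g x * \1_N x))%:E)%E.
  move=> mA; rewrite jordan_negE cjordan_negE /crestr0 mem_set//= /crestr.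
  rewrite nuE//; last exact: measurableI.
  rewrite -IgAE// -integralN; first by apply: eq_integral => x _; rewrite EFinN.
  apply: integrable_add_def => //.
  by apply: integrableS (IgA _ mN).
have INg : mu.-integrable setT (EFin \o (fun x => - (g x * \1_N x))).
  by have := integrableN (IgA _ mN).
have [M hM] := bphi.
have Iphi A : measurable A -> mu.-integrable setT
    (EFin \o (fun x => phi x * (g x * \1_A x))).
  move=> mA; apply: (@le_integrableR mu _ _ (fun x => M * (g x * \1_A x))) => //.
  - by apply: measurable_funM => //; exact: measurable_funM.
  - move=> x _ /=; rewrite !normrM ler_wpM2r ?mulr_ge0//.
    by rewrite (le_trans (hM x))// ler_norm.
  - by have := integrableZl measurableT M (IgA _ mA).
rewrite (integral_density (IgA _ mP) posE)//; last exact: bounded_integrable.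
rewrite (integral_density INg negE)//; last exact: bounded_integrable.
have -> : (\int[mu]_x (phi x * - (g x * \1_N x))%:E =
    - \int[mu]_x (phi x * (g x * \1_N x))%:E)%E.
  rewrite -integralN; last by apply: integrable_add_def => //; exact: Iphi.
  by apply: eq_integral => x _; rewrite mulrN EFinN.
rewrite oppeK -integralD//; [|exact: Iphi|exact: Iphi].
apply: eq_integral => x _ /=; rewrite -EFinD -mulrDr -mulrDr !indicE.
have : (P `|` N) x by rewrite PNT.
have [xP|xP] := boolP (x \in P); have [xN|xN] := boolP (x \in N).
- have : (P `&` N) x by split; exact: set_mem.
  by rewrite PN0.
- by rewrite addr0 mulr1.
- by rewrite add0r mulr1.
- by case=> /mem_set; rewrite ?(negPf xP) ?(negPf xN).
Qed.

End jordan_integral_density.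

Lemma charge_integral_density {R : realType}
    (mu : {sigma_finite_measure set (measurableTypeR R) -> \bar R})
    (nu : {charge set (measurableTypeR R) -> \bar R}) (g : R -> R) (phi : R -> R) :
  mu.-integrable setT (EFin \o g) ->
  (forall A : set (measurableTypeR R), measurable A ->
    nu A = (\int[mu]_(x in A) (g x)%:E)%E) ->
  measurable_fun (setT : set (measurableTypeR R)) phi ->
  (exists M, forall x, `|phi x| <= M) ->
  charge_integral nu phi = (\int[mu]_x (phi x * g x)%:E)%E.
Proof. by move=> Ig nuE mphi bphi; exact: jordan_integral_density. Qed.

(** * Cell averages along grids *)

Section L1_induction.
Context {R : realType} {disp : measure_display} {T : measurableType disp}.
Variable m : {finite_measure set T -> \bar R}.
Import HBSimple.

Lemma integrable_indicR (A : set T) : measurable A ->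
  m.-integrable setT (EFin \o (\1_A : T -> R)).
Proof.
by move=> mA; apply: bounded_integrable => //; exists 1 => x;
  rewrite indicE ger0_norm// lern1 leq_b1.
Qed.

(** Simple functions are linear combinations of indicators and are dense in [L^1]; the last
    hypothesis absorbs the approximation. It reduces [osc_small] to indicators. *)
Lemma L1_induction (H : (T -> R) -> Prop) :
  (forall A, measurable A -> H \1_A) ->
  (forall (a : R) f, m.-integrable setT (EFin \o f) -> H f -> H (fun x => a * f x)) ->
  (forall f g, m.-integrable setT (EFin \o f) -> m.-integrable setT (EFin \o g) ->
    H f -> H g -> H (fun x => f x + g x)) ->
  (forall f, m.-integrable setT (EFin \o f) -> (forall e, 0 < e -> exists g,
    [/\ m.-integrable setT (EFin \o g), H g & \int[m]_x `|f x - g x| <= e]) -> H f) ->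
  forall f, m.-integrable setT (EFin \o f) -> H f.
Proof.
move=> H1 HZ HD Hcl f If; apply: Hcl => // e e0.
have Hsfun (g : {sfun T >-> R}) : H g.
  have -> : (g : T -> R) = fun x =>
      \sum_(y <- finmap.enum_fset (fset_set (range g))) (y * \1_(g @^-1` [set y]) x).
    by apply/funext => x; rewrite fimfunE fsbig_finite.
  have mG y : measurable (g @^-1` [set y]) by exact: measurable_funPTI.
  have IG y : m.-integrable setT (EFin \o (fun x => y * \1_(g @^-1` [set y]) x)).
    by have := integrableZl measurableT y (integrable_indicR (mG y)).
  suff gen (s : seq R) : H (fun x => \sum_(y <- s) (y * \1_(g @^-1` [set y]) x)).
    exact: gen.
  elim: s => [|y s IH].
    rewrite (_ : (fun x => _) = fun x => 0 * \1_setT x).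
      by apply: HZ; [exact: integrable_indicR|exact: H1].
    by apply/funext => x; rewrite big_nil mul0r.
  rewrite (_ : (fun x => _) = fun x => y * \1_(g @^-1` [set y]) x +
      \sum_(y <- s) (y * \1_(g @^-1` [set y]) x)); last first.
    by apply/funext => x; rewrite big_cons.
  apply: HD => //; last by apply: HZ; [exact: integrable_indicR|exact: H1].
  rewrite (_ : _ \o _ = fun x => (\sum_(y <- s) (y * \1_(g @^-1` [set y]) x)%:E)%E).
    by apply: integrable_sum => // z _; exact: IG.
  by apply/funext => x /=; rewrite sumEFin.
have [g [Ig _ /fine_cvgP[_ /cvgr0_norm_le /(_ _ e0)]]] :=
  approximation_sfun_integrable measurableT If.
move=> [n _ /(_ n (leqnn _))] /= hn; exists (g n); split => //.
rewrite /Rintegral.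
have -> : (\int[m]_x `|f x - g n x|%:E = \int[m]_x `|(EFin \o f) x - (g n x)%:E|)%E.
  by [].
exact: le_trans (ler_norm _) hn.
Qed.

End L1_induction.

Section finite_measures_on_the_line.
Context {R : realType}.
Local Notation mR := (measurableTypeR R).
Variable m : {finite_measure set mR -> \bar R}.

Lemma measure_decreasing_small (B : (set mR)^nat) (e : R) :
  (forall n, measurable (B n)) -> (forall i j, (i <= j)%N -> B j `<=` B i) ->
  \bigcap_n B n = set0 -> 0 < e ->
  exists n0, forall n, (n0 <= n)%N -> fine (m (B n)) <= e.
Proof.
move=> mB dB B0 e0; have : m \o B @ \oo --> m (\bigcap_n B n).
  apply: nonincreasing_cvg_mu => //.
  - by rewrite -ge0_fin_numE// fin_num_measure.
  - exact: bigcapT_measurable.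
  - by move=> i j ij; apply/subsetPset; exact: dB.
rewrite B0 measure0 => /fine_cvgP[_] /cvgr0_norm_le /(_ e e0) [n0 _ hn0].
by exists n0 => n /hn0; rewrite /= ger0_norm ?fine_ge0.
Qed.

Let inv_small (x y : R) : x < y -> exists n : nat, x + 2 / n.+1%:R < y.
Proof.
move=> xy; have [n hn] := ltr_add_invr xy; exists (2 * n.+1)%N.
rewrite (le_lt_trans _ hn)// lerD2l.
rewrite ler_pdivrMr// mulrC ler_pdivlMr// -natrM ler_nat.
by rewrite mulnC leqnSn.
Qed.

Let inv_dec i j : (i <= j)%N -> 2 / j.+1%:R <= 2 / i.+1%:R :> R.
Proof. by move=> ij; rewrite ler_wpM2l// lef_pV2 ?posrE// ler_nat. Qed.

(** The width [2 / (n + 1)] is the mesh of the [n]-th grid: in a cell that contains [y], the points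
    to the left of [y] lie in this window, which shrinks to the empty set. *)
Lemma measure_left_small (y e : R) : 0 < e -> exists n0, forall n, (n0 <= n)%N ->
  fine (m [set` `[y - 2 / n.+1%:R, y[]) <= e.
Proof.
apply: measure_decreasing_small => [n|i j ij x /=|].
- exact: measurable_itv.
- by rewrite !in_itv/= => /andP[h ->]; rewrite (le_trans _ h)// lerD2l lerN2 inv_dec.
- apply/seteqP; split => // x h.
  have xy : x < y by have := h 0%N I; rewrite /= in_itv/= => /andP[].
  have [n hn] := inv_small xy.
  have := h n I; rewrite /= in_itv/= => /andP[+ _].
  by apply/negP; rewrite -ltNge ltrBrDr.
Qed.

Lemma measure_right_small (y e : R) : 0 < e -> exists n0, forall n, (n0 <= n)%N ->
  fine (m [set` `]y, y + 2 / n.+1%:R]]) <= e.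
Proof.
apply: measure_decreasing_small => [n|i j ij x /=|].
- exact: measurable_itv.
- by rewrite !in_itv/= => /andP[-> h]; rewrite (le_trans h)// lerD2l inv_dec.
- apply/seteqP; split => // x h.
  have xy : y < x by have := h 0%N I; rewrite /= in_itv/= => /andP[].
  have [n hn] := inv_small xy.
  have := h n I; rewrite /= in_itv/= => /andP[_].
  by apply/negP; rewrite -ltNge.
Qed.

(** At most [(k + 1) m(R)] points have mass at least [1 / (k + 1)], and the atoms are the union over
    [k] of these finite sets. *)
Lemma countable_atoms : countable [set t : mR | m [set t] != 0%E].
Proof.
pose A k := [set t : R | k.+1%:R^-1 <= fine (m [set t])].
have fA k : finite_set (A k).
  apply: contrapT => iA.
  have h0 : 0 <= k.+1%:R * fine (m setT) by rewrite mulr_ge0// fine_ge0.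
  have := Num.Theory.archi_boundP h0; set n := Num.Def.archi_bound _.
  have [B BA nB] := infinite_set_fset n iA; apply/negP; rewrite -leNgt.
  have mB : measurable (\big[setU/set0]_(i <- finmap.enum_fset B) ([set i] : set mR)).
    by apply: bigsetU_measurable => i _; exact: measurable_set1.
  have : (m (\big[setU/set0]_(i <- finmap.enum_fset B) ([set i] : set mR)) <= m setT)%E.
    by rewrite le_measure// inE.
  rewrite measure_fbigsetU; last 2 first.
  - by move=> i _; exact: measurable_set1.
  - by move=> i j _ _ [x [-> ->]].
  rewrite big_seq => hs.
  have : (\sum_(i <- finmap.enum_fset B | i \in finmap.enum_fset B) (k.+1%:R^-1)%:E <=
      m setT)%E.
    apply: le_trans hs; apply: lee_sum => i iB.
    have : A k i by exact: BA.
    by rewrite /A/= -lee_fin fineK ?fin_num_measure.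
  rewrite -big_seq sumEFin => hs2.
  have : \sum_(i <- finmap.enum_fset B) k.+1%:R^-1 <= fine (m setT).
    by rewrite -lee_fin fineK// fin_num_measure.
  rewrite big_const_seq count_predT iter_addr_0 -[_ *+ size _]mulr_natl ler_pdivrMr//.
  by rewrite mulrC => /(le_trans _); apply; rewrite ler_nat.
apply: (@sub_countable _ _ _ (\bigcup_k A k)).
  apply: subset_card_le => t /= t0.
  have {}t0 : 0 < fine (m [set t]).
    rewrite lt_def fine_ge0// andbT; apply: contra t0 => /eqP t0.
    by rewrite -[m _]fineK ?fin_num_measure// t0.
  have [k hk] := ltr_add_invr t0; exists k => //.
  by move/ltW: hk; rewrite add0r.
by apply: bigcup_countable => // k _; exact: finite_set_countable.
Qed.

Lemma exists_nonatom (a b : R) : a < b -> exists2 t, a < t < b & m [set t] = 0%E.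
Proof.
move=> ab; apply: contrapT => hn.
have : lebesgue_measure (`]a, b[%classic : set R) = 0%E.
  apply: countable_lebesgue_measure0; apply: sub_countable countable_atoms.
  apply: subset_card_le => t; rewrite /= in_itv/= => tab.
  by apply/eqP => t0; apply: hn; exists t.
rewrite lebesgue_measure_itv/= lte_fin ab -EFinB => -[] /eqP.
by rewrite subr_eq0 gt_eqF.
Qed.

End finite_measures_on_the_line.

(** Half-open, so that it is tiled exactly by half-open cells; the derivative of a curve lives on
    the open interval and puts no mass at 1. *)
Definition oc01 {R : realType} : set (measurableTypeR R) := [set` `]0, 1]].

Lemma measurable_oc01 {R : realType} : measurable (@oc01 R).
Proof. exact: measurable_itv. Qed.
#[global] Hint Resolve measurable_oc01 : core.

Section oscillation.
Context {R : realType}.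
Local Notation mR := (measurableTypeR R).
Variable m : {finite_measure set mR -> \bar R}.
Implicit Types (f g : R -> R) (A : set mR) (t : nat -> R).

Definition avg A f : R := (\int[m]_(x in A) f x) / fine (m A).

Definition dev A f : R := \int[m]_(x in A) `|f x - avg A f|.

Lemma integrable_cst_m (A : set mR) (c : R) : measurable A ->
  m.-integrable A (EFin \o (fun=> c) : mR -> \bar R).
Proof. by move=> mA; exact: finite_measure_integrable_cst. Qed.

Lemma integrable_subc A f (c : R) : measurable A -> m.-integrable A (EFin \o f) ->
  m.-integrable A (EFin \o (fun x => f x - c)).
Proof.
by move=> mA If; have := integrableB mA If (integrable_cst_m c mA).
Qed.

Lemma integrable_absc A f (c : R) : measurable A -> m.-integrable A (EFin \o f) ->
  m.-integrable A (EFin \o (fun x => `|f x - c|)).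
Proof. by move=> mA If; have := integrable_norm (integrable_subc c mA If). Qed.

(** When [m A = 0], the average is 0 by the convention on division, but the integral vanishes as
    well. *)
Lemma avgM A f : measurable A -> m.-integrable A (EFin \o f) ->
  avg A f * fine (m A) = \int[m]_(x in A) f x.
Proof.
move=> mA If; have [m0|m0] := eqVneq (fine (m A)) 0; last by rewrite divfK.
have mA0 : m A = 0%E by rewrite -[m A]fineK ?fin_num_measure// m0.
by rewrite m0 mulr0 /Rintegral null_set_integral//; exact: measurable_int If.
Qed.

Lemma Rintegral_subc A f (c : R) : measurable A -> m.-integrable A (EFin \o f) ->
  \int[m]_(x in A) (f x - c) = \int[m]_(x in A) f x - c * fine (m A).
Proof.
move=> mA If; rewrite RintegralB ?Rintegral_cst//; exact: (integrable_cst_m c mA).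
Qed.

(** Up to a factor 2 the average is the best constant in [L^1]; comparing with a convenient [c]
    avoids the computation of averages. *)
Lemma dev_le A f (c : R) : measurable A -> m.-integrable A (EFin \o f) ->
  dev A f <= 2 * \int[m]_(x in A) `|f x - c|.
Proof.
move=> mA If.
have h : `|avg A f - c| * fine (m A) <= \int[m]_(x in A) `|f x - c|.
  rewrite -[fine _]ger0_norm ?fine_ge0// -normrM mulrBl avgM// -Rintegral_subc//.
  by apply: le_normr_Rintegral => //; exact: integrable_subc.
rewrite mulr_natl mulr2n; apply: le_trans (lerD (lexx _) h).
rewrite -Rintegral_cst// -RintegralD//; last 2 first.
- exact: integrable_absc.
- exact: (integrable_cst_m _ mA).
apply: le_Rintegral => //.
- exact: integrable_absc.
- have := integrableD mA (integrable_absc c mA If) (integrable_cst_m `|avg A f - c| mA).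
  by [].
- move=> x _; rewrite (distrC (avg A f)).
  by rewrite -(subrKA c (f x)) (le_trans (ler_normD _ _)).
Qed.

Lemma devD A f g : measurable A -> m.-integrable A (EFin \o f) ->
  m.-integrable A (EFin \o g) -> dev A (fun x => f x + g x) <= dev A f + dev A g.
Proof.
move=> mA If Ig; have Ifg : m.-integrable A (EFin \o (fun x => f x + g x)).
  by have := integrableD mA If Ig.
have e : avg A (fun x => f x + g x) = avg A f + avg A g.
  by rewrite /avg RintegralD// mulrDl.
rewrite /dev e -RintegralD//; [|exact: integrable_absc|exact: integrable_absc].
apply: le_Rintegral => //.
- exact: integrable_absc.
- by have := integrableD mA (integrable_absc (avg A f) mA If)
    (integrable_absc (avg A g) mA Ig).
- by move=> x _; rewrite opprD addrACA ler_normD.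
Qed.

Lemma devZ A f (a : R) : measurable A -> m.-integrable A (EFin \o f) ->
  dev A (fun x => a * f x) = `|a| * dev A f.
Proof.
move=> mA If; have e : avg A (fun x => a * f x) = a * avg A f.
  by rewrite /avg RintegralZl// mulrA.
rewrite /dev e -RintegralZl//; last exact: integrable_absc.
by apply: eq_Rintegral => x _; rewrite -mulrBr normrM.
Qed.

Lemma dev_ge0 A f : 0 <= dev A f.
Proof. by apply: Rintegral_ge0. Qed.

Definition cell t j : set mR := [set` `]t j, t j.+1]].

Definition osc N t f : R := \sum_(j < N) dev (cell t j) f.

Definition grid (N : nat) t (e : R) :=
  [/\ t 0%N = 0, t N = 1, forall j, (j < N)%N -> t j < t j.+1 &
      forall j, (j < N)%N -> t j.+1 - t j <= e].

Lemma measurable_cell t j : measurable (cell t j).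
Proof. exact: measurable_itv. Qed.
Hint Resolve measurable_cell : core.

Lemma grid_le N t e i j : grid N t e -> (i <= j <= N)%N -> t i <= t j.
Proof.
case=> _ _ h _ /andP[+ jN]; elim: j jN => [_|j IH jN]; first by rewrite leqn0 => /eqP->.
rewrite leq_eqVlt => /predU1P[->//|ij].
by rewrite (le_trans (IH (ltnW jN) ij))// ltW// h.
Qed.

Lemma grid_itv N t e j : grid N t e -> (j <= N)%N -> 0 <= t j <= 1.
Proof.
move=> g jN; have [t0 tN _ _] := g.
by rewrite -{1}t0 -{1}tN (grid_le g) ?(grid_le g)// ?jN ?leqnn.
Qed.

Lemma integral_cells N t e (f : mR -> \bar R) (mu : {measure set mR -> \bar R}) :
  grid N t e -> measurable_fun oc01 f -> (forall x, 0 <= f x)%E ->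
  (\int[mu]_(x in oc01) f x = \sum_(j < N) \int[mu]_(x in cell t j) f x)%E.
Proof.
move=> g mf f0; have [t0 tN _ _] := g.
suff : forall n, (n <= N)%N -> (\int[mu]_(x in ([set` `]0%R, t n]] : set mR)) f x =
    \sum_(j < n) \int[mu]_(x in cell t j) f x)%E.
  by move=> /(_ N (leqnn _)); rewrite tN /oc01.
elim=> [_|n IH nN]; first by rewrite t0 set_itvoc0 integral_set0 big_ord0.
rewrite big_ord_recr/= -IH 1?ltnW//.
have /andP[tn0 tn1] := grid_itv g (ltnW nN).
have /andP[tm0 tm1] := grid_itv g nN.
have tnm : t n <= t n.+1 by apply: (grid_le g); rewrite leqnSn.
rewrite (@itv_bndbnd_setU _ _ _ (BRight (t n))) ?bnd_simp//.
rewrite ge0_integral_setU//.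
  apply: measurable_funS mf => // x /=; rewrite /oc01/= !in_itv/=.
  move=> [/andP[-> /le_trans->//]|/andP[/(le_lt_trans tn0)-> /le_trans->//]].
apply/disj_setPS => x [/=]; rewrite !in_itv/= => /andP[_ h1] /andP[h2 _].
by move: (lt_le_trans h2 h1); rewrite ltxx.
Qed.

Lemma Rintegral_cells N t e f (mu : {measure set mR -> \bar R}) : grid N t e ->
  mu.-integrable oc01 (EFin \o f) ->
  \int[mu]_(x in oc01) f x = \sum_(j < N) \int[mu]_(x in cell t j) f x.
Proof.
move=> g If; have [t0 tN _ _] := g.
suff : forall n, (n <= N)%N -> \int[mu]_(x in ([set` `]0%R, t n]] : set mR)) f x =
    \sum_(j < n) \int[mu]_(x in cell t j) f x.
  by move=> /(_ N (leqnn _)); rewrite tN /oc01.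
elim=> [_|n IH nN]; first by rewrite t0 set_itvoc0 Rintegral_set0 big_ord0.
rewrite big_ord_recr/= -IH 1?ltnW//.
have /andP[tn0 tn1] := grid_itv g (ltnW nN).
have /andP[tm0 tm1] := grid_itv g nN.
have tnm : t n <= t n.+1 by apply: (grid_le g); rewrite leqnSn.
rewrite (@itv_bndbnd_setU _ _ _ (BRight (t n))) ?bnd_simp//.
rewrite Rintegral_setU//.
  apply: integrableS If => //.
    by apply: measurableU => //; exact: measurable_itv.
  move=> x /=; rewrite /oc01/= !in_itv/=.
  move=> [/andP[-> /le_trans->//]|/andP[/(le_lt_trans tn0)-> /le_trans->//]].
apply/disj_setPS => x [/=]; rewrite !in_itv/= => /andP[_ h1] /andP[h2 _].
by move: (lt_le_trans h2 h1); rewrite ltxx.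
Qed.

Section sequence_of_grids.
Variables (N : nat -> nat) (t : nat -> nat -> R).

(** The mesh [2 / (n + 1)] leaves room to move each point of the uniform grid of step [1 / (n + 1)]
    within one step, which is how atoms are avoided in [exists_grids]. *)
Definition grids := forall n, grid (N n) (t n) (2 / n.+1%:R).

Hypothesis gr : grids.

Let o n f := osc (N n) (t n) f.

Let osc_to0 f := forall e, 0 < e -> exists n0, forall n, (n0 <= n)%N -> o n f <= e.

Let IS A f : measurable A -> m.-integrable setT (EFin \o f) -> m.-integrable A (EFin \o f).
Proof. by move=> mA; exact: integrableS. Qed.

Let osc_le n f (g : R -> R) : m.-integrable setT (EFin \o f) ->
  m.-integrable setT (EFin \o g) ->
  o n f <= o n g + 2 * \int[m]_x `|f x - g x|.
Proof.
move=> If Ig; have Ifg : m.-integrable setT (EFin \o (fun x => f x - g x)).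
  by have := integrableB measurableT If Ig.
have If' : m.-integrable setT (EFin \o (fun x => `|f x - g x|)).
  by have := integrable_norm Ifg.
apply: (@le_trans _ _ (o n g + 2 * \int[m]_(x in oc01) `|f x - g x|)).
  rewrite (Rintegral_cells (gr n)); last exact: IS.
  rewrite mulr_sumr -big_split/=; apply: ler_sum => j _.
  have {1}-> : f = fun x => g x + (f x - g x).
    by apply/funext => x; rewrite addrC subrK.
  rewrite (le_trans (devD _ _ _))//; [exact: IS|exact: IS|].
  rewrite lerD2l (le_trans (dev_le 0 _ _))//; first exact: IS.
  rewrite ler_wpM2l//; apply: le_Rintegral => //.
  - rewrite (_ : _ \o _ = EFin \o (fun x => `|f x - g x|)); first exact: IS.
    by apply/funext => x /=; rewrite subr0.
  - exact: IS.
  - by move=> x _; rewrite subr0.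
rewrite lerD2l ler_wpM2l//.
rewrite -lee_fin /Rintegral !fineK; last 2 first.
- exact: integrable_fin_num.
- by apply: integrable_fin_num => //; exact: IS.
apply: ge0_subset_integral => //.
by apply: (measurable_int m If').
Qed.

(** The indicator of a ray is constant on every cell, except possibly one that contains [y]. There
    it is compared with 1, and the error lives on the points less than [y] of that cell, hence in
    the window of [measure_left_small]. *)
Let osc_rays y : osc_to0 \1_([set` `[y, +oo[] : set mR).
Proof.
move=> e e0.
pose B n : set mR := [set` `[y - 2 / n.+1%:R, y[].
have mB n : measurable (B n) by exact: measurable_itv.
have mray : measurable ([set` `[y, +oo[] : set mR) by exact: measurable_itv.
have [n0 hn0] := measure_left_small m y (divr_gt0 e0 (ltr0n R 2)).
exists n0 => n /hn0 hn.
apply: (@le_trans _ _ (2 * fine (m (B n)))); last first.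
  by rewrite mulrC -ler_pdivlMr.
have IB A C : measurable A -> measurable C -> m.-integrable A (EFin \o (\1_C : mR -> R)).
  by move=> mA mC; apply: IS => //; exact: integrable_indicR.
have -> : fine (m (B n)) = \int[m]_x \1_(B n) x.
  by rewrite /Rintegral integral_indic// setIT.
apply: (@le_trans _ _ (2 * \int[m]_(x in oc01) \1_(B n) x)); last first.
  rewrite ler_wpM2l// -lee_fin /Rintegral !fineK.
  - by apply: ge0_subset_integral => //; exact: measurable_int (IB _ _ _ _).
  - by apply: integrable_fin_num => //; exact: IB.
  - by apply: integrable_fin_num => //; exact: IB.
rewrite (Rintegral_cells (gr n)); last exact: IB.
rewrite mulr_sumr; apply: ler_sum => j _.
have Ir := IB _ _ (measurable_cell (t n) j) mray.
pose c : R := if y <= t n j.+1 then 1 else 0.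
apply: (le_trans (dev_le c _ Ir)) => //; rewrite ler_wpM2l//.
apply: le_Rintegral => //; [exact: integrable_absc|exact: IB|].
move=> x; rewrite /cell/= in_itv/= => /andP[tx xt].
rewrite /c !indicE; case: ifPn => [yt|].
- have [yx|xy] := leP y x.
    by rewrite mem_set ?subrr ?normr0//= in_itv/= yx.
  rewrite (mem_set (_ : B n x)); last first.
    rewrite /B/= in_itv/= xy andbT.
    have [_ _ _ /(_ j (ltn_ord j))] := gr n.
    rewrite lerBlDr => h; rewrite lerBlDr (le_trans yt)// (le_trans h)// addrC.
    by rewrite lerD2r ltW.
  rewrite memNset ?sub0r ?normrN ?normr1//= in_itv/= andbT.
  by apply/negP; rewrite -ltNge.
- rewrite -ltNge => ty; rewrite memNset ?subr0 ?normr0//= in_itv/= andbT.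
  by apply/negP; rewrite -ltNge (le_lt_trans xt).
Qed.

Let osc_to0Z a f : m.-integrable setT (EFin \o f) -> osc_to0 f -> osc_to0 (fun x => a * f x).
Proof.
move=> If h e e0; have a1 : 0 < `|a| + 1 by rewrite ltr_wpDl.
have [n0 hn] := h (e / (`|a| + 1)) (divr_gt0 e0 a1); exists n0 => n /hn.
rewrite ler_pdivlMr// mulrC => /(le_trans _); apply.
rewrite /o /osc (eq_bigr (fun j : 'I_(N n) => `|a| * dev (cell (t n) j) f)); last first.
  by move=> j _; rewrite devZ//; exact: IS.
rewrite -mulr_sumr.
by rewrite ler_wpM2r ?lerDl// sumr_ge0// => j _; exact: dev_ge0.
Qed.

Let osc_to0D f g : m.-integrable setT (EFin \o f) -> m.-integrable setT (EFin \o g) ->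
  osc_to0 f -> osc_to0 g -> osc_to0 (fun x => f x + g x).
Proof.
move=> If Ig hf hg e e0; have e2 : 0 < e / 2 by rewrite divr_gt0.
have [n1 h1] := hf _ e2; have [n2 h2] := hg _ e2; exists (maxn n1 n2) => n.
rewrite geq_max => /andP[/h1 k1 /h2 k2]; rewrite [e]splitr (le_trans _ (lerD k1 k2))//.
by rewrite /o /osc -big_split/=; apply: ler_sum => j _; rewrite devD//; exact: IS.
Qed.

Let osc_to0_closed f : m.-integrable setT (EFin \o f) -> (forall e, 0 < e -> exists g,
    [/\ m.-integrable setT (EFin \o g), osc_to0 g & \int[m]_x `|f x - g x| <= e]) ->
  osc_to0 f.
Proof.
move=> If h e e0; have e2 : 0 < e / 2 by rewrite divr_gt0.
have e4 : 0 < e / 4 by rewrite divr_gt0.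
have [g [Ig og fg]] := h _ e4; have [n0 hn0] := og _ e2; exists n0 => n /hn0 hn.
rewrite (le_trans (osc_le _ If Ig))// (le_trans (lerD hn (lexx _)))//; lra.
Qed.

Let osc_to0_cst (c : R) : osc_to0 (fun=> c).
Proof.
move=> e e0; exists 0%N => n _; rewrite /o /osc big1 ?ltW// => j _.
apply/eqP; rewrite eq_le dev_ge0 andbT (le_trans (dev_le c _ _))//.
  by apply: integrable_cst_m.
under eq_Rintegral do rewrite subrr normr0.
by rewrite Rintegral_cst// mul0r mulr0.
Qed.

(** Dynkin's theorem: the rays are stable under intersection and generate the Borel sets. A
    countable disjoint union is approximated in measure by its finite subunions, so that
    [osc_to0_closed] applies. *)
Let osc_to0_indic (A : set mR) : measurable A -> osc_to0 \1_A.
Proof.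
move=> mA.
suff : forall S, <<s @RGenCInfty.G R >> S -> osc_to0 \1_S.
  apply; suff : (@RGenCInfty.G R).-sigma.-measurable A by [].
  by rewrite -RGenCInfty.measurableE.
apply: (@dynkin_induction _ mR (@RGenCInfty.G R) (fun A => osc_to0 \1_A)).
- exact: RGenCInfty.measurableE.
- move=> _ _ [x ->] [y ->]; exists (Num.max x y).
  apply/seteqP; split => z /=; rewrite !in_itv/= !andbT ge_max.
    by move=> [-> ->].
  by move=> /andP[-> ->].
- by rewrite (_ : \1_setT = fun=> 1) ?indicT.
- by move=> _ [y ->].
- move=> S mS hS; rewrite (_ : \1_(~` S) = fun x => 1 + (-1) * \1_S x); last first.
    apply/funext => x; rewrite !indicE in_setC mulN1r.
    by case: (_ \in _); rewrite /= ?subrr ?subr0.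
  have IS1 := integrable_indicR m mS.
  apply: osc_to0D => //; first exact: integrable_cst_m.
  - by have := integrableZl measurableT (-1) IS1.
  - exact: osc_to0Z.
- move=> F mF tF hF.
  have mU : measurable (\bigcup_k F k) by exact: bigcupT_measurable.
  apply: osc_to0_closed; first exact: integrable_indicR.
  move=> e e0; pose G n := \big[setU/set0]_(k < n) F k.
  have mG n : measurable (G n) by exact: bigsetU_measurable.
  have sG n : G n `<=` \bigcup_k F k by exact: bigsetU_bigcup.
  have GF : \bigcup_n G n = \bigcup_k F k.
    apply/seteqP; split => [x [n _ /sG//]|x [n _ Fx]].
    by exists n.+1 => //; rewrite /G big_ord_recr/=; right.
  have : m \o G @ \oo --> m (\bigcup_n G n).
    apply: nondecreasing_cvg_mu => //; first by rewrite GF.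
    by move=> i j ij; apply/subsetPset; exact: subset_bigsetU.
  rewrite GF -[m (\bigcup_k F k)]fineK ?fin_num_measure// => /fine_cvgP[_].
  move=> /cvgrPdist_le /(_ e e0) [n _ /(_ n (leqnn _))] /= hn; exists \1_(G n); split.
  + exact: integrable_indicR.
  + elim: n {hn} => [|n IH].
      by rewrite /G big_ord0 indic0; exact: osc_to0_cst.
    rewrite (_ : \1_(G n.+1) = fun x => \1_(G n) x + \1_(F n) x); last first.
      apply/funext => x; rewrite /G big_ord_recr/= !indicE in_setU.
      have [xF|] := boolP (x \in F n); last by rewrite orbF addr0.
      rewrite memNset ?add0r// -bigcup_mkord => -[k /= kn Fk].
      have /tF : F k `&` F n !=set0 by exists x; split => //; exact: set_mem.
      by move=> /(_ I I) kE; rewrite kE ltnn in kn.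
    by apply: osc_to0D => //; exact: integrable_indicR.
  + have -> : \int[m]_x `|\1_(\bigcup_k F k) x - \1_(G n) x| =
        fine (m (\bigcup_k F k `\` G n)).
      rewrite -[in RHS](setIT (_ `\` _)) -integral_indic//; last exact: measurableD.
      apply: eq_Rintegral => x _; rewrite !indicE in_setD.
      have [xG|xG] := boolP (x \in G n); last by rewrite subr0 andbT ger0_norm.
      by rewrite (mem_set (sG n x (set_mem xG))) subrr normr0.
    rewrite measureD//; last by rewrite -ge0_fin_numE// fin_num_measure.
    rewrite setIidr// fineB ?fin_num_measure//.
    by rewrite (le_trans (ler_norm _)).
Qed.

Lemma osc_small f e : m.-integrable setT (EFin \o f) -> 0 < e ->
  exists n0, forall n, (n0 <= n)%N -> osc (N n) (t n) f <= e.
Proof.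
move=> If e0; exact: (@L1_induction R _ mR m osc_to0 osc_to0_indic osc_to0Z osc_to0D
  osc_to0_closed f If e e0).
Qed.

End sequence_of_grids.

Lemma exists_grids : exists N (t : nat -> nat -> R), grids N t /\
  forall n j, (0 < j < N n)%N -> m [set t n j] = 0%E.
Proof.
have h n j : {t : R | j%:R / n.+1%:R < t < j.+1%:R / n.+1%:R & m [set t] = 0%E}.
  by apply: cid2; apply: exists_nonatom; rewrite ltr_pM2r// ltr_nat.
(* An interior point of index [j] is drawn from the [j]-th window of length [1 / (n + 1)], so
   consecutive points are ordered and at most two steps apart. The ends 0 and 1 are imposed. *)
pose t n j : R := if j == 0%N then 0 else if (n < j)%N then 1 else s2val (h n j).
have tl n j : (j <= n.+1)%N -> j%:R / n.+1%:R <= t n j.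
  rewrite /t; case: eqP => [->|_] jn; first by rewrite mul0r.
  case: ifPn => nj; first by rewrite ler_pdivrMr// mul1r ler_nat.
  by have /andP[/ltW] := s2valP (h n j).
have tu n j : (j < n.+1)%N -> t n j < j.+1%:R / n.+1%:R.
  rewrite /t; case: eqP => [->|_] jn; first by rewrite mul1r invr_gt0.
  by rewrite ltnNge -ltnS jn/=; have /andP[] := s2valP (h n j).
have tu' n j : t n j <= j.+1%:R / n.+1%:R.
  have [jn|nj] := ltnP j n.+1; first exact/ltW/tu.
  rewrite /t nj (gtn_eqF (leq_ltn_trans _ nj))// ler_pdivlMr// mul1r ler_nat.
  exact: ltnW.
exists S, t; split => [n|n j /andP[j0 jn]]; last first.
  by rewrite /t gtn_eqF// ltnNge -ltnS jn/=; exact: s2valP' (h n j).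
split => [||j jn|j jn].
- by rewrite /t eqxx.
- by rewrite /t /= ltnSn.
- exact: lt_le_trans (tu _ _ jn) (tl _ _ jn).
- rewrite lerBlDr (le_trans (tu' _ _))// (le_trans _ (lerD (lexx _) (tl _ _ (ltnW jn))))//.
  by rewrite -mulrDl -natrD.
Qed.

End oscillation.

(** * Test functions *)

Section smooth_bumps.
Context {R : realType}.
Implicit Types (f g phi : R -> R) (a b e x y : R).

(** The derivatives of [exp (- e / y)], extended by 0, are combinations of these functions, with [k]
    counting the powers of [1 / y]. The parameter [e] serves to let [flat e 0] tend to 1 on the
    positive half-line. *)
Definition flat e (k : nat) y : R := if 0 < y then y ^- k * expR (- (e / y)) else 0.

Lemma flat_ge0 e k y : 0 <= flat e k y.
Proof.
rewrite /flat; case: ifPn => // y0.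
by rewrite mulr_ge0 ?expR_ge0// invr_ge0 exprn_ge0// ltW.
Qed.

(** From [exp x >= (x / n)^n] with [n = k + 2]: beyond the [k] powers that cancel [y^(-k)], two
    powers of [y] remain, which makes the derivative at 0 exist and vanish. *)
Lemma flat_le e k y : 0 < e ->
  flat e k y <= (k.+2%:R / e) ^+ k.+2 * y ^+ 2.
Proof.
move=> e0; rewrite /flat; case: ifPn => y0; last first.
  by rewrite mulr_ge0 ?sqr_ge0// exprn_ge0// divr_ge0// ltW.
have n0 : 0 < k.+2%:R :> R by rewrite ltr0n.
have h : (e / (k.+2%:R * y)) ^+ k.+2 <= expR (e / y).
  have -> : e / y = k.+2%:R * (e / (k.+2%:R * y)).
    by field; rewrite !gt_eqF.
  rewrite expRM_natl lerXn2r ?nnegrE ?expR_ge0//.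
    by rewrite divr_ge0// ltW// mulr_gt0.
  by rewrite (le_trans _ (expR_ge1Dx _))// lerDr.
have p0 : 0 < (e / (k.+2%:R * y)) ^+ k.+2.
  by rewrite exprn_gt0// divr_gt0// mulr_gt0.
rewrite expRN (@le_trans _ _ (y ^- k * ((e / (k.+2%:R * y)) ^+ k.+2)^-1))//.
  rewrite ler_pM2l ?invr_gt0 ?exprn_gt0// lef_pV2 ?posrE ?expR_gt0//.
rewrite -(exprVn (e / _)) invf_div (mulrAC _ y) exprMn mulrCA.
by rewrite -(addn2 k) (exprD y) mulKf// gt_eqF// exprn_gt0.
Qed.

Lemma is_derive_quadratic f (C : R) : (forall y, `|f y| <= C * y ^+ 2) ->
  is_derive (0 : R) 1 f 0.
Proof.
move=> hf; have f0 : f 0 = 0.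
  by apply/eqP; rewrite -normr_le0 (le_trans (hf 0))// expr0n mulr0.
have h : h^-1 *: (f (h *: 1 + 0) - f 0) @[h --> (0:R)^'] --> (0:R).
  apply/cvgr0Pnorm_le => e e0.
  have C1 : 0 < `|C| + 1 by rewrite ltr_wpDl.
  have de : 0 < e / (`|C| + 1) by rewrite divr_gt0.
  near=> h.
  have hn0 : h != 0 by near: h; exact: nbhs_dnbhs_neq.
  have hs : `|h| <= e / (`|C| + 1).
    near: h; apply: dnbhs0_le => //.
  rewrite f0 subr0 addr0 /GRing.scale/= mulr1 normrM normfV.
  rewrite ler_pdivrMl ?normr_gt0// (le_trans (hf h))//.
  rewrite -real_normK ?num_real// expr2 mulrA mulrC ler_wpM2l//.
  move: hs; rewrite ler_pdivlMr// mulrC => /(le_trans _); apply.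
  by rewrite ler_wpM2r// (le_trans (ler_norm _))// lerDl.
apply: DeriveDef; first by apply/cvg_ex; exists 0.
exact/cvg_lim.
Unshelve. all: by end_near. Qed.

Lemma is_derive_near f g y (l : R) : (\forall z \near y, f z = g z) ->
  is_derive y 1 g l -> is_derive y 1 f l.
Proof.
move=> fg [dg gl]; have gf : \forall z \near y, g z = f z by apply: filterS fg.
apply: DeriveDef; first exact: near_eq_derivable gf dg.
by rewrite (near_eq_derive _ fg).
Qed.

Lemma is_derive_ext f g x (l l' : R) : f =1 g -> l = l' ->
  is_derive x 1 f l -> is_derive x 1 g l'.
Proof. by move=> /funext -> ->. Qed.

Lemma is_derive_flat e k y : 0 < e ->
  is_derive y 1 (flat e k) (- k%:R * flat e k.+1 y + e * flat e k.+2 y).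
Proof.
move=> e0; have [y0|y0|->] := ltrgt0P y.
- have yn0 : y != 0 by rewrite gt_eqF.
  apply: (@is_derive_near _ (fun z => z^-1 ^+ k * expR (- (e * z^-1)))).
    near=> z; rewrite /flat exprVn ifT//; near: z; exact: lt_nbhsr.
  have d1 : is_derive y 1 (fun z : R => z^-1) (- y ^- 2).
    by have := is_deriveV yn0 (is_derive_id y (1:R)); rewrite /GRing.scale/= mulr1.
  have d2 : is_derive y 1 (fun z : R => z^-1 ^+ k) (- (k%:R * y^-1 ^+ k.+1)).
    elim: k => [|k IH]; first by rewrite mul0r oppr0; exact: is_derive_cst.
    have := is_deriveM d1 IH; rewrite /GRing.scale/=.
    apply: is_derive_ext => [z /=|]; first by rewrite exprS.
    rewrite -(exprVn y 2) -natr1 !exprS expr0; ring.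
  have d3 : is_derive y 1 (fun z : R => expR (- (e * z^-1)))
      (expR (- (e * y^-1)) * (e * y^-1 ^+ 2)).
    have d4 : is_derive y 1 (fun z : R => - (e * z^-1)) (e * y^-1 ^+ 2).
      have := is_deriveN (is_deriveM (is_derive_cst e y (1:R)) d1).
      rewrite /GRing.scale/=; apply: is_derive_ext => //.
      by rewrite mulr0 addr0 mulrN opprK exprVn.
    have := @is_derive1_comp _ expR _ y _ _ (is_derive_expR _) d4.
    exact.
  have := is_deriveM d2 d3; rewrite /GRing.scale/=.
  apply: is_derive_ext => //; rewrite /flat y0 -!exprVn !exprS; ring.
- have z0 k' : flat e k' y = 0 by rewrite /flat ltNge ltW.
  rewrite !z0 !mulr0 addr0; apply: (@is_derive_near _ (cst 0)).
    by near=> z; rewrite /flat ltNge ltW//; near: z; exact: lt_nbhsl.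
- rewrite {2 3}/flat ltxx !mulr0 addr0.
  apply: (@is_derive_quadratic _ ((k.+2%:R / e) ^+ k.+2)) => z.
  by rewrite ger0_norm ?flat_ge0// flat_le.
Unshelve. all: by end_near. Qed.

(* Contains [bump] and is closed under differentiation, hence consists of smooth
   functions. *)
Inductive smooth_class e : (R -> R) -> Prop :=
| sc_left k a : smooth_class e (fun x => flat e k (x - a))
| sc_right k b : smooth_class e (fun x => flat e k (b - x))
| sc_cst c : smooth_class e (fun=> c)
| sc_add f g : smooth_class e f -> smooth_class e g -> smooth_class e (fun x => f x + g x)
| sc_mul f g : smooth_class e f -> smooth_class e g -> smooth_class e (fun x => f x * g x).

Lemma smooth_class_derive e f : 0 < e -> smooth_class e f ->
  exists2 g, smooth_class e g & forall x, is_derive x 1 f (g x).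
Proof.
move=> e0; elim=> [k a|k b|c|{}f g sf [f' sf' df] sg [g' sg' dg]|
    {}f g sf [f' sf' df] sg [g' sg' dg]].
- exists (fun x => - k%:R * flat e k.+1 (x - a) + e * flat e k.+2 (x - a)).
    by do !constructor.
  move=> x; have d1 : is_derive x 1 (fun x => x - a) (1 : R).
    by apply: is_derive_eq; rewrite oppr0 addr0.
  have := @is_derive1_comp _ (flat e k) _ x _ _ (is_derive_flat k (x - a) e0) d1.
  by rewrite mulr1.
- exists (fun x => (-1) * (- k%:R * flat e k.+1 (b - x) + e * flat e k.+2 (b - x))).
    by do !constructor.
  move=> x; have d1 : is_derive x 1 (fun x => b - x) (-1 : R).
    have := is_deriveB (is_derive_cst b x (1:R)) (is_derive_id x (1:R)).
    by apply: is_derive_ext => //; rewrite sub0r.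
  have := @is_derive1_comp _ (flat e k) _ x _ _ (is_derive_flat k (b - x) e0) d1.
  by rewrite mulrC.
- by exists (fun=> 0); [constructor|move=> x; exact: is_derive_cst].
- exists (fun x => f' x + g' x); first by constructor.
  by move=> x; apply: is_deriveD.
- exists (fun x => f x * g' x + g x * f' x); first by do !constructor.
  by move=> x; apply: is_deriveM.
Qed.

Lemma smooth_class_derivable e f n x : 0 < e -> smooth_class e f ->
  derivable (derive1n n f) x 1.
Proof.
move=> e0; elim: n f => [|n IH] f sf; have [g sg dg] := smooth_class_derive e0 sf.
  by case: (dg x).
rewrite derive1Sn (_ : derive1 f = g); first exact: IH.
by apply/funext => y; rewrite derive1E; case: (dg y).
Qed.

Definition bump a b e x := flat e 0 (x - a) * flat e 0 (b - x).

Lemma flat0_le1 e y : 0 < e -> flat e 0 y <= 1.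
Proof.
move=> e0; rewrite /flat; case: ifPn => // y0.
by rewrite expr0 invr1 mul1r -expR0 ler_expR oppr_le0 divr_ge0// ltW.
Qed.

Lemma bump_itv a b e x : 0 < e -> 0 <= bump a b e x <= 1.
Proof.
move=> e0; rewrite mulr_ge0 ?flat_ge0//= -[leRHS]mulr1.
by rewrite ler_pM ?flat_ge0 ?flat0_le1.
Qed.

Lemma bump_out a b e x : ~ (a < x < b) -> bump a b e x = 0.
Proof.
move=> h; rewrite /bump /flat !subr_gt0.
case: ifPn => ax; last by rewrite mul0r.
case: ifPn => xb; last by rewrite mulr0.
by case: h; rewrite ax xb.
Qed.

Lemma bump_test a b e : 0 < e -> 0 < a -> b < 1 -> test_function (bump a b e).
Proof.
move=> e0 a0 b1.
have sc : smooth_class e (bump a b e) by exact: sc_mul (sc_left e 0 a) (sc_right e 0 b).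
split; first by move=> n x; exact: (@smooth_class_derivable e _ n x e0 sc).
exists a, b; split => // x h; apply: bump_out.
by apply: contra_not h => /andP[/ltW-> /ltW->].
Qed.

Lemma bump_sequence a b : 0 <= a -> b <= 1 -> exists phi : nat -> R -> R,
  [/\ forall n, test_function (phi n), forall n x, 0 <= phi n x <= 1,
      forall n x, ~ (a < x < b) -> phi n x = 0 &
      forall x, a < x < b -> phi n x @[n --> \oo] --> (1:R)].
Proof.
(* Shrinking the interval by [1 / (n + 1)] on each side keeps the support compactly inside []0, 1[]
   even for [a = 0] or [b = 1]; the same number as third parameter drives the values to 1 on []a,
   b[]. *)
move=> a0 b1; exists (fun n => bump (a + n.+1%:R^-1) (b - n.+1%:R^-1) n.+1%:R^-1).
split => [n|n x|n x h|x /andP[ax xb]].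
- apply: bump_test => //; first by rewrite ltr_wpDl.
  by rewrite ltrBlDr (le_lt_trans b1)// ltrDl.
- exact: bump_itv.
- apply: bump_out; apply: contra_not h => /andP[h1 h2].
  by rewrite (lt_trans _ h1) ?ltrDl// (lt_trans h2)// ltrBlDr ltrDl.
- have hh : n.+1%:R^-1 @[n --> \oo] --> (0:R) by exact: cvg_harmonic.
  have key (u : nat -> R) (l : R) : 0 < l -> u @ \oo --> l ->
      flat n.+1%:R^-1 0 (u n) @[n --> \oo] --> (1:R).
    move=> l0 ul; apply: (@cvg_trans _ (expR (- (n.+1%:R^-1 * (u n)^-1)) @[n --> \oo])).
      apply: near_eq_cvg; near=> n; rewrite /flat ifT ?expr0 ?invr1 ?mul1r//.
      by near: n; exact: (cvgr_gt _ ul).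
    have : expR (- (n.+1%:R^-1 * (u n)^-1)) @[n --> \oo] --> expR (- (0 * l^-1)).
      apply: continuous_cvg; first exact: continuous_expR.
      by apply: cvgN; apply: cvgM => //; apply: cvgV => //; rewrite gt_eqF.
    by rewrite mul0r oppr0 expR0.
  rewrite /bump -[X in _ --> X]mulr1.
  apply: cvgM; [apply: (key _ (x - a))|apply: (key _ (b - x))]; rewrite ?subr_gt0//.
    rewrite -[x - a]subr0 (_ : (fun n => _) = fun n => x - a - n.+1%:R^-1); last first.
      by apply/funext => n; rewrite opprD addrA.
    by apply: cvgB => //; exact: cvg_cst.
  rewrite -[b - x]subr0 (_ : (fun n => _) = fun n => b - x - n.+1%:R^-1); last first.
    by apply/funext => n; rewrite addrAC.
  by apply: cvgB => //; exact: cvg_cst.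
Unshelve. all: by end_near. Qed.

End smooth_bumps.

(** * Distributional derivatives on the line *)

Section test_functions.
Context {R : realType}.
Local Notation mR := (measurableTypeR R).
Local Notation leb := (@lebesgue_measure R).
Implicit Types phi f : R -> R.

Lemma test_derivable phi x : test_function phi -> derivable phi x 1.
Proof. by move=> [h _]; exact: (h 0%N). Qed.

Lemma test_continuous phi : test_function phi -> continuous phi.
Proof.
by move=> h x; apply/differentiable_continuous/derivable1_diffP/test_derivable.
Qed.

Lemma test_derive_continuous phi : test_function phi -> continuous (derive1 phi).
Proof.
move=> [h _] x; apply/differentiable_continuous/derivable1_diffP.
exact: (h 1%N).
Qed.

Lemma test_out phi x : test_function phi -> ~ (0 < x < 1) -> phi x = 0.
Proof.
move=> [_ [a [b [a0 b1 h]]]] x01; apply: h; apply: contra_not x01 => /andP[ax xb].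
by rewrite (lt_le_trans a0)// (le_lt_trans xb).
Qed.

Lemma continuous_measurableR f : continuous f -> measurable_fun (setT : set mR) f.
Proof. exact: continuous_measurable_fun. Qed.

Lemma compact_support_bounded f (a b : R) : continuous f ->
  (forall x, ~ (a <= x <= b) -> f x = 0) -> exists M, forall x, `|f x| <= M.
Proof.
move=> cf f0; have [ab|ba] := leP a b; last first.
  exists 0 => x; rewrite f0 ?normr0// => /andP[h1 h2].
  by move: (le_trans h1 h2); rewrite leNgt ba.
have cnf : {within `[a, b], continuous (fun x => `|f x|)}.
  apply: continuous_subspaceT => x; apply: continuous_comp (cf x) _.
  exact: norm_continuous.
have [c _ hc] := EVT_max ab cnf; exists `|f c| => x.
have [h|h] := pselect (a <= x <= b); first by apply: hc; rewrite in_itv.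
by rewrite f0// normr0.
Qed.

Lemma test_bounded phi : test_function phi -> exists M, forall x, `|phi x| <= M.
Proof.
move=> h; have [_ [a [b [_ _ h0]]]] := h.
exact: compact_support_bounded (test_continuous h) h0.
Qed.

Lemma test_derive_out phi : test_function phi -> exists a b : R,
  [/\ 0 < a, b < 1 & forall x, ~ (a <= x <= b) -> derive1 phi x = 0].
Proof.
move=> h; have [_ [a [b [a0 b1 h0]]]] := h; exists a, b; split => // x xab.
rewrite derive1E -(@near_eq_derive _ _ _ (cst 0) phi).
  by have [_ ->] := is_derive_cst (0:R) x (1:R).
have [ax|xa] := ltP x a.
  near=> y; rewrite h0// => /andP[+ _]; apply/negP; rewrite -ltNge.
  by near: y; exact: lt_nbhsl.
have bx : b < x by rewrite ltNge; apply/negP => xb; apply: xab; rewrite xa xb.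
near=> y; rewrite h0// => /andP[_]; apply/negP; rewrite -ltNge.
by near: y; exact: lt_nbhsr.
Unshelve. all: by end_near. Qed.

Lemma test_derive_bounded phi : test_function phi ->
  exists M, forall x, `|derive1 phi x| <= M.
Proof.
move=> h; have [a [b [_ _ h0]]] := test_derive_out h.
exact: compact_support_bounded (test_derive_continuous h) h0.
Qed.

Lemma integral_test_derive phi (y : R) : test_function phi -> 0 <= y <= 1 ->
  (\int[leb]_(x in (`[y, 1%R]%classic : set R)) (derive1 phi x)%:E = (- phi y)%:E)%E.
Proof.
move=> h /andP[y0]; rewrite le_eqVlt => /predU1P[->|y1].
  by rewrite set_itv1 integral_set1 (@test_out _ 1 h) ?oppr0//; rewrite ltxx andbF.
rewrite (@continuous_FTC2 _ _ phi)//.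
- by rewrite (@test_out _ 1 h) ?ltxx ?andbF// sub0e.
- by apply: continuous_subspaceT; exact: test_derive_continuous.
- split=> [x _||]; first exact: test_derivable.
    by apply: cvg_at_right_filter; exact: test_continuous.
  by apply: cvg_at_left_filter; exact: test_continuous.
Qed.

Lemma integral_cst_test_derive phi (C : R) : test_function phi ->
  (\int[leb]_(x in unit_itv) (C * derive1 phi x)%:E = 0)%E.
Proof.
move=> h; under eq_integral do rewrite EFinM.
rewrite integralZl//.
  by rewrite integral_test_derive ?lexx ?ler01// (@test_out _ 0)// ?ltxx// oppr0 mule0.
  exact: measurable_itv.
apply: continuous_compact_integrable; first exact: segment_compact.
by apply: continuous_subspaceT; exact: test_derive_continuous.
Qed.

Lemma lebesgue_unit_itv : leb unit_itv = 1%E.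
Proof.
rewrite -[LHS]/(lebesgue_measure (`[0%R, 1%R]%classic : set R)) lebesgue_measure_itv/=.
by rewrite lte_fin ltr01 -EFinB subr0.
Qed.

End test_functions.

(** * Distribution functions and integration by parts *)

Section fubini_test_functions.
Context {R : realType}.
Local Notation mR := (measurableTypeR R).
Local Notation leb := (@lebesgue_measure R).

Definition ray (x : R) : set mR := [set` `]-oo, x]].

Lemma measurable_ray x : measurable (ray x).
Proof. exact: measurable_itv. Qed.

Definition oo01 : set mR := [set` `]0%R, 1%R[].

Lemma measurable_oo01 : measurable oo01.
Proof. exact: measurable_itv. Qed.

Variable m : {finite_measure set mR -> \bar R}.
Hypothesis m01 : forall A : set mR, measurable A -> m A = m (A `&` oo01).

Let m_out : m (~` oo01) = 0%E.
Proof. by rewrite m01 ?setICl//; apply: measurableC; exact: measurable_oo01. Qed.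

Lemma integral_conc (f : mR -> \bar R) :
  (\int[m]_x f x = \int[m]_(x in oo01) f x)%E.
Proof.
rewrite [RHS]integral_mkcond.
apply: (@eq_integral_off_null _ _ _ _ (~` oo01)) => //.
  by apply: measurableC; exact: measurable_oo01.
by move=> x _ /contrapT h; rewrite patchE mem_set.
Qed.

(** Both sides are the double integral of [phi'(x)] over [y <= x]. Integrating first in [y] gives
    the distribution function; integrating first in [x] gives [phi 1 - phi y = - phi y], for [y] in
    the open interval, where [m] is concentrated. *)
Lemma fubini_test_function phi : test_function phi ->
  (\int[leb]_(x in unit_itv) (fine (m (ray x)) * derive1 phi x)%:E =
   - \int[m]_x (phi x)%:E)%E.
Proof.
move=> h; have [M hM] := test_derive_bounded h.
have mdphi : measurable_fun (setT : set mR) (derive1 phi).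
  by apply: continuous_measurableR; exact: test_derive_continuous.
have mI : measurable (unit_itv : set mR) by exact: measurable_itv.
pose B : set (mR * mR) := [set p | p.2 <= p.1].
have mB : measurable B.
  by rewrite -[B]setTI; apply: measurable_fun_le.
pose f (p : mR * mR) := ((\1_(unit_itv : set mR) p.1 * derive1 phi p.1) * \1_B p)%R.
have mf : measurable_fun setT f.
  apply: measurable_funM => //; apply: measurable_funM.
    by apply: measurableT_comp => //; exact: measurable_indic.
  exact: measurableT_comp.
have If : (leb \x m)%E.-integrable setT (EFin \o f).
  apply/integrable12ltyP; first exact/measurable_EFinP.
  apply: (@le_lt_trans _ _ (\int[leb]_x \int[m]_y (`|M| * \1_(unit_itv : set mR) x)%:E))%E.
    apply: ge0_le_integral => //.
    - by move=> x _; exact: integral_ge0.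
    - apply: (@measurable_fun_fubini_tonelli_F _ _ _ _ _ m (abse \o EFin \o f)) => //; last first.
        by move=> p; exact: abse_ge0.
      by apply: measurableT_comp => //; exact/measurable_EFinP.
    - under eq_fun do rewrite integral_cst//.
      apply: emeasurable_funM => //; apply/measurable_EFinP; apply: measurable_funM => //.
    - move=> x _; apply: ge0_le_integral => //.
      + apply: measurableT_comp => //; apply/measurable_EFinP.
        exact: measurableT_comp mf (pair1_measurable x).
      + move=> y _; rewrite lee_fin /f !normrM.
        rewrite [`|\1_B _|]ger0_norm// [`|\1_unit_itv _|]ger0_norm//.
        rewrite [leRHS]mulrC -mulrA ler_wpM2l//.
        rewrite (@le_trans _ _ (`|derive1 phi x| * 1))//.
          by rewrite ler_wpM2l// indicE lern1 leq_b1.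
        by rewrite mulr1 (le_trans (hM x))// ler_norm.
  have intc c : (\int[m]__ c%:E = (c * fine (m setT))%:E)%E.
    rewrite (_ : (fun=> c%:E) = cst c%:E)// integral_cst// EFinM fineK//.
    exact: fin_num_measure.
  under eq_integral do rewrite intc.
  apply: integrable_lty => //.
  have := integrableZl measurableT (`|M| * fine (m setT))
    (@integrable_indic_itv R 0 1 true false).
  apply: eq_integrable => // x _ /=; rewrite -EFinM; congr EFin; ring.
have intx x : (\int[m]_y (f (x, y))%:E =
    (\1_(unit_itv : set mR) x * (fine (m (ray x)) * derive1 phi x))%:E)%E.
  have -> : (fun y => (f (x, y))%:E) = (fun y =>
      (\1_(unit_itv : set mR) x * derive1 phi x)%:E * (\1_(ray x) y)%:E)%E.
    apply/funext => y; rewrite -EFinM /f/= (_ : \1_B (x, y) = \1_(ray x) y)//.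
  rewrite integralZl//; last exact: integrable_indic (measurable_ray x).
  rewrite integral_indic ?setIT//; last exact: measurable_ray.
  rewrite (mulrC (fine _)) mulrA [RHS]EFinM fineK//.
  exact: fin_num_measure m _ (measurable_ray x).
have inty y : oo01 y -> (\int[leb]_x (f (x, y))%:E = (- phi y)%:E)%E.
  rewrite /oo01/= in_itv/= => /andP[y0 y1].
  rewrite -integral_test_derive ?(ltW y0) ?(ltW y1)// [RHS]integral_mkcond.
  apply: eq_integral => x _; rewrite /f/= patchE !indicE.
  have [yx|xy] := leP y x.
    rewrite (mem_set (_ : B (x, y)))// mulr1.
    have [x1|x1] := leP x 1.
      have xI : (unit_itv : set R) x by rewrite /unit_itv/= in_itv/= x1 (le_trans (ltW y0)).
      have xy : `[y, 1%R]%classic x by rewrite /= in_itv/= yx.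
      by rewrite (mem_set xI) (mem_set xy) mul1r.
    have xI : ~ (unit_itv : set R) x.
      by rewrite /unit_itv/= in_itv/= (leNgt x 1) x1 andbF.
    have xy : ~ `[y, 1%R]%classic x by rewrite /= in_itv/= (leNgt x 1) x1 andbF.
    by rewrite (memNset xI) (memNset xy) mul0r.
  rewrite (memNset (_ : ~ B (x, y))) ?mulr0; last first.
    by rewrite /B/=; apply/negP; rewrite -ltNge.
  have nxy : ~ `[y, 1%R]%classic x by rewrite /= in_itv/= (leNgt y) xy.
  by rewrite (memNset nxy).
have := Fubini If.
under eq_integral do rewrite intx.
rewrite [RHS]integral_conc => E1; transitivity (\int[m]_(y in oo01) (- phi y)%:E)%E; last first.
  under eq_integral do rewrite EFinN.
  rewrite [in RHS]integral_conc -integralN//.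
  apply: integrable_add_def; first exact: measurable_oo01.
  apply: bounded_integrable; first exact: measurable_oo01.
    by apply: measurable_funTS; apply: continuous_measurableR; exact: test_continuous.
  exact: test_bounded.
transitivity (\int[m]_(y in oo01) \int[leb]_x (f (x, y))%:E)%E; last first.
  by apply: eq_integral => y /set_mem yI; exact: inty.
rewrite -[RHS]E1 [LHS]integral_mkcond; apply: eq_integral => x _.
by rewrite patchE indicE; case: (_ \in _); rewrite ?mul1r// mul0r.
Qed.

End fubini_test_functions.

Section charge_distribution.
Context {R : realType}.
Local Notation mR := (measurableTypeR R).
Local Notation leb := (@lebesgue_measure R).
Variable nu : {charge set mR -> \bar R}.
Hypothesis nu01 : forall A : set mR, measurable A -> nu A = nu (A `&` oo01).

(** The distribution function of the charge; by [distr_derivative_sdf] it is a primitive of [nu] in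
    the sense of distributions. *)
Definition sdf (nu : {charge set mR -> \bar R}) (x : R) : R := fine (nu (ray x)).

Let jordan_conc P N (PN : hahn_decomposition nu P N) (A : set mR) : measurable A ->
  jordan_pos PN A = jordan_pos PN (A `&` oo01) /\
  jordan_neg PN A = jordan_neg PN (A `&` oo01).
Proof.
move=> mA; have [[mP _] [mN _] _ _] := PN.
have mA' : measurable (A `&` oo01) by apply: measurableI => //; exact: measurable_oo01.
rewrite !jordan_posE !cjordan_posE !jordan_negE !cjordan_negE /crestr0 !mem_set//= /crestr.
by rewrite nu01 ?(nu01 (measurableI _ _ mA mN)) ?[A `&` oo01 `&` _]setIAC//; exact: measurableI.
Qed.

Let measurable_fine_ray (m : {finite_measure set mR -> \bar R}) :
  measurable_fun (setT : set mR) (fun x => fine (m (ray x))).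
Proof.
apply: nondecreasing_measurable => // x y xy.
rewrite fine_le ?fin_num_measure//; [exact: measurable_ray|exact: measurable_ray|].
rewrite le_measure ?inE//; [exact: measurable_ray|exact: measurable_ray|].
by move=> z; rewrite /ray/= !in_itv/= => /le_trans; exact.
Qed.

Lemma sdf_jordan P N (PN : hahn_decomposition nu P N) x :
  sdf nu x = fine (jordan_pos PN (ray x)) - fine (jordan_neg PN (ray x)).
Proof.
rewrite /sdf (jordan_decomp PN (measurable_ray x)) /cadd/= cscaleN1 fineB//;
by rewrite fin_num_measure//; exact: measurable_ray.
Qed.

Lemma measurable_sdf : measurable_fun (setT : set mR) (sdf nu).
Proof.
have [P [N PN]] := Hahn_decomposition nu.
rewrite (_ : sdf nu = fun x => fine (jordan_pos PN (ray x)) - fine (jordan_neg PN (ray x))).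
  by apply: measurable_funB; exact: measurable_fine_ray.
by apply/funext => x; exact: sdf_jordan.
Qed.

Lemma sdf_bounded : exists M, forall x, `|sdf nu x| <= M.
Proof.
have [P [N PN]] := Hahn_decomposition nu.
exists (fine (jordan_pos PN setT) + fine (jordan_neg PN setT)) => x.
rewrite (sdf_jordan PN) (le_trans (ler_normB _ _))// lerD// ger0_norm ?fine_ge0//.
  rewrite fine_le ?fin_num_measure//; [exact: measurable_ray|].
  by rewrite le_measure ?inE//; exact: measurable_ray.
rewrite fine_le ?fin_num_measure//; [exact: measurable_ray|].
by rewrite le_measure ?inE//; exact: measurable_ray.
Qed.

Let bdd_integrable_unit (f : R -> R) : measurable_fun (setT : set mR) f ->
  (exists M, forall x, `|f x| <= M) -> leb.-integrable unit_itv (EFin \o f).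
Proof.
move=> mf [M hM]; apply: measurable_bounded_integrable => //.
- exact: measurable_itv.
- by rewrite (_ : _ unit_itv = 1%E) ?ltry//; exact: lebesgue_unit_itv.
- exact: measurable_funTS.
- exists M; split; first exact: num_real.
  by move=> y My x _ /=; rewrite (le_trans (hM x))// ltW.
Qed.

Lemma integrable_sdf : leb.-integrable unit_itv (EFin \o sdf nu).
Proof. by apply: bdd_integrable_unit; [exact: measurable_sdf|exact: sdf_bounded]. Qed.

Lemma distr_derivative_sdf phi : test_function phi ->
  (\int[leb]_(x in unit_itv) (sdf nu x * derive1 phi x)%:E =
   - charge_integral nu phi)%E.
Proof.
move=> h.
suff key P N (PN : hahn_decomposition nu P N) :
    (\int[leb]_(x in unit_itv) (sdf nu x * derive1 phi x)%:E =
     - (\int[jordan_pos PN]_x (phi x)%:E - \int[jordan_neg PN]_x (phi x)%:E))%E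
  by exact: key.
have mdphi : measurable_fun (setT : set mR) (derive1 phi).
  by apply: continuous_measurableR; exact: test_derive_continuous.
have [M hM] := test_derive_bounded h.
have If (m : {finite_measure set mR -> \bar R}) :
    leb.-integrable unit_itv (EFin \o (fun x => fine (m (ray x)) * derive1 phi x)).
  apply: bdd_integrable_unit; first by apply: measurable_funM.
  exists (fine (m setT) * `|M|) => x; rewrite normrM ler_pM//.
    rewrite ger0_norm ?fine_ge0// fine_le ?fin_num_measure//; [exact: measurable_ray|].
    by rewrite le_measure ?inE//; exact: measurable_ray.
  by rewrite (le_trans (hM x))// ler_norm.
under eq_integral do rewrite (sdf_jordan PN) mulrBl EFinB.
have mI : measurable (unit_itv : set mR) by exact: measurable_itv.
rewrite integralB_EFin//.
rewrite (@fubini_test_function _ (jordan_pos PN)) => [|A mA|//]; last first.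
  by have [] := jordan_conc PN mA.
rewrite (@fubini_test_function _ (jordan_neg PN)) => [|A mA|//]; last first.
  by have [] := jordan_conc PN mA.
rewrite oppeK fin_num_oppeB ?oppeK//.
apply: integrable_fin_num => //; apply: bounded_integrable => //.
- by apply: continuous_measurableR; exact: test_continuous.
- exact: test_bounded.
Qed.

End charge_distribution.

Lemma ae_imp {disp} {T : measurableType disp} {R : realType} (mu : set T -> \bar R)
    (P Q : T -> Prop) :
  {ae mu, forall x, P x} -> (forall x, P x -> Q x) -> {ae mu, forall x, Q x}.
Proof.
move=> [A [mA A0 PA]] PQ; exists A; split => // x Qx.
by apply: PA => /PQ.
Qed.

Lemma ae_forall_ord {R : realType} {d : nat} (P : 'I_d -> measurableTypeR R -> Prop) :
  (forall i, {ae @lebesgue_measure R, forall x, P i x}) ->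
  {ae @lebesgue_measure R, forall x, forall i, P i x}.
Proof.
move=> h.
have : {ae @lebesgue_measure R, forall x, forall n : nat, forall i : 'I_d, n = i :> nat -> P i x}.
  apply: ae_foralln => n; have [nd|nd] := ltnP n d; last first.
    by apply: aeW => x i ni; move: nd; rewrite ni leqNgt ltn_ord.
  apply: ae_imp (h (Ordinal nd)) _ => x hx i ni.
  by rewrite (_ : i = Ordinal nd)//; apply: val_inj.
by move=> /ae_imp; apply => x hx i; exact: hx erefl.
Qed.

(** * The lemma of du Bois-Reymond and the representation of BV curves *)

Section du_bois_reymond.
Context {R : realType}.
Local Notation mR := (measurableTypeR R).
Local Notation leb := (@lebesgue_measure R).
Implicit Types phi psi f w : R -> R.

Lemma measurable_test phi : test_function phi -> measurable_fun (setT : set mR) phi.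
Proof. by move=> h; apply: continuous_measurableR; exact: test_continuous. Qed.

Lemma integrable_testM (mu : {measure set mR -> \bar R}) phi w : test_function phi ->
  mu.-integrable setT (EFin \o w) -> mu.-integrable setT (EFin \o (fun x => phi x * w x)).
Proof.
move=> h Iw; have [M hM] := test_bounded h.
apply: (@le_integrableR _ _ _ mu _ _ (fun x => M * w x)) => //.
- apply: measurable_funM; first exact: measurable_test.
  by apply/measurable_EFinP; exact: measurable_int Iw.
- by move=> x _; rewrite !normrM ler_wpM2r// (le_trans (hM x))// ler_norm.
- by have := integrableZl measurableT M Iw.
Qed.

Lemma bump_sequence_cvg (mu : {measure set mR -> \bar R}) (a b : R)
    (phi : nat -> R -> R) w :
  (forall n, test_function (phi n)) -> (forall n x, 0 <= phi n x <= 1) ->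
  (forall n x, ~ (a < x < b) -> phi n x = 0) ->
  (forall x, a < x < b -> phi n x @[n --> \oo] --> (1:R)) ->
  mu.-integrable setT (EFin \o w) ->
  \int[mu]_x (phi n x * w x) @[n --> \oo] -->
    \int[mu]_(x in ([set` `]a, b[] : set mR)) w x.
Proof.
move=> tphi phi01 phi0 phi1 Iw.
have mab : measurable ([set` `]a, b[] : set mR) by exact: measurable_itv.
have mw := measurable_int mu Iw.
have [] := @dominated_convergence _ mR R mu setT measurableT
  (fun n x => (phi n x * w x)%:E) (EFin \o (w \_ ([set` `]a, b[] : set mR)))
  (fun x => `|w x|%:E).
- by move=> n; exact: measurable_int (integrable_testM (tphi n) Iw).
- rewrite -restrict_EFin; apply/(measurable_restrictT _ mab) => //.
  exact: measurable_funTS.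
- apply: aeW => x _ /=; apply: cvg_EFin; first exact: nearW.
  rewrite patchE; case: ifPn => [/set_mem|/negP xab].
    rewrite /= in_itv/= => xab; rewrite -[X in _ --> X]mul1r.
    by apply: cvgM; [exact: phi1|exact: cvg_cst].
  rewrite (_ : _ \o _ = cst 0); first exact: cvg_cst.
  apply/funext => n /=; rewrite phi0 ?mul0r//; apply: contra_not xab => xab.
  by apply/mem_set; rewrite /= in_itv.
- by have := integrable_norm Iw.
- apply: aeW => x n _ /=; rewrite lee_fin normrM ler_piMl//.
  by have /andP[h0 h1] := phi01 n x; rewrite ger0_norm.
- move=> I1 _ h; rewrite Rintegral_mkcond /Rintegral.
  move: h; rewrite -[X in _ --> X]fineK; last exact: integrable_fin_num.
  by move=> /fine_cvgP[_].
Qed.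

Lemma integrable_mul_test_derive w phi : test_function phi ->
  leb.-integrable unit_itv (EFin \o w) ->
  leb.-integrable unit_itv (EFin \o (fun x => w x * derive1 phi x)).
Proof.
move=> tphi Iw; have [M hM] := test_derive_bounded tphi.
have mI : measurable (unit_itv : set mR) by exact: measurable_itv.
have mdphi : measurable_fun (setT : set mR) (derive1 phi).
  by apply: continuous_measurableR; exact: test_derive_continuous.
apply: (@le_integrableR _ _ _ leb _ _ (fun x => M * w x)) => //.
- apply: measurable_funM; last exact: measurable_funTS.
  by apply/measurable_EFinP; exact: measurable_int Iw.
- by move=> x _; rewrite !normrM mulrC ler_wpM2r// (le_trans (hM x))// ler_norm.
- by have := integrableZl mI M Iw.
Qed.

Lemma derive1n_lin (n : nat) f g (k : R) :
  (forall n x, derivable (derive1n n f) x 1) ->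
  (forall n x, derivable (derive1n n g) x 1) ->
  derive1n n (fun x => f x - k * g x) = fun x => derive1n n f x - k * derive1n n g x.
Proof.
move=> sf sg; elim: n => [//|n IH]; rewrite !derive1nS IH; apply/funext => x.
have Df := derivableP (sf n x); have Dg := derivableP (sg n x).
have h := is_deriveB Df (is_deriveZ k Dg).
by rewrite !derive1E; have [_ <-] := h.
Qed.

Lemma smooth_lin f g (k : R) :
  (forall n x, derivable (derive1n n f) x 1) ->
  (forall n x, derivable (derive1n n g) x 1) ->
  forall n x, derivable (derive1n n (fun x => f x - k * g x)) x 1.
Proof.
move=> sf sg n x; rewrite derive1n_lin//.
have Df := derivableP (sf n x); have Dg := derivableP (sg n x).
by have [] := is_deriveB Df (is_deriveZ k Dg).
Qed.

Lemma integrable_supported f (a b : R) : continuous f ->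
  (forall x, ~ (a <= x <= b) -> f x = 0) -> leb.-integrable setT (EFin \o f).
Proof.
move=> cf f0; have mab : measurable ([set` `[a, b]] : set mR) by exact: measurable_itv.
have : leb.-integrable ([set` `[a, b]] : set mR) (EFin \o f).
  apply: continuous_compact_integrable; first exact: segment_compact.
  exact: continuous_subspaceT.
move=> /(integrable_mkcond _ mab); apply: eq_integrable => // x _.
rewrite patchE; case: ifPn => // /negP h; rewrite /= f0//.
by apply: contra_not h => h; apply/mem_set; rewrite /= in_itv.
Qed.

(** The primitive of [psi] vanishes to the left of the support, and to the right of it because the
    total integral is 0. *)
Lemma test_antiderivative psi (a b : R) : 0 < a -> b < 1 ->
  (forall n x, derivable (derive1n n psi) x 1) ->
  (forall x, ~ (a <= x <= b) -> psi x = 0) ->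
  \int[leb]_x psi x = 0 ->
  exists2 phi, test_function phi & derive1 phi = psi.
Proof.
move=> a0 b1 spsi psi0 Ipsi0.
have cpsi : continuous psi.
  by move=> x; apply/differentiable_continuous/derivable1_diffP; exact: (spsi 0%N).
have Ipsi := integrable_supported cpsi psi0.
pose phi x := \int[leb]_(y in [set` `]-oo, x]]) psi y.
have dphi x : derivable phi x 1 /\ derive1 phi x = psi x.
  apply: (@FTC1_lebesgue_pt _ psi -oo%O x (x + 1)) => //.
  - by rewrite ltrDl.
  - apply: integrableS Ipsi => //; exact: measurable_itv.
  - by rewrite ltNyr.
  - apply: (@continuous_lebesgue_pt _ _ _ setT) => //; first exact: open_nbhsT.
      exact: continuous_measurableR.
    exact: cpsi.
have dphiE : derive1 phi = psi by apply/funext => x; exact: (dphi x).2.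
exists phi => //; split.
  by move=> [|n] x; [exact: (dphi x).1|rewrite derive1Sn dphiE].
exists a, b; split => // x xab.
have [ax|xa] := ltP x a.
  rewrite /phi (@eq_Rintegral _ _ _ _ _ (cst 0)) ?Rintegral_cst ?mul0r//.
  move=> y /set_mem; rewrite /= in_itv/= => yx; apply: psi0.
  by move=> /andP[/le_trans /(_ yx)]; rewrite leNgt ax.
have bx : b < x by rewrite ltNge; apply/negP => xb; apply: xab; rewrite xa xb.
rewrite -Ipsi0 /phi Rintegral_mkcond; apply: eq_Rintegral => y _.
rewrite patchE; case: ifPn => // /negP h; rewrite psi0// => /andP[_ yb].
by apply: h; apply/mem_set; rewrite /= in_itv/= (le_trans yb)// ltW.
Qed.

(** By Lebesgue differentiation [W] is almost everywhere the derivative of its primitive, which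
    vanishes near every point of []0, 1[]. *)
Lemma integral_zero_itv W : leb.-integrable setT (EFin \o W) ->
  (forall x, 0 < x < 1 -> \int[leb]_(y in [set` `]-oo, x]]) W y = 0) ->
  {ae leb, forall x, 0 < x < 1 -> W x = 0}.
Proof.
move=> IW h.
have := @FTC1Ny R W.
have IWy y : leb.-integrable `]-oo, y] (EFin \o W).
  by apply: integrableS IW => //; exact: measurable_itv.
move=> /(_ IWy (open_integrable_locally openT IW)).
move=> /ae_imp; apply => x [_ <-] /andP[x0 x1].
rewrite derive1E -(@near_eq_derive _ _ _ (cst 0)).
  by have [_ ->] := is_derive_cst (0:R) x (1:R).
near=> y; rewrite h//; apply/andP; split; near: y.
  exact: lt_nbhsr.
exact: lt_nbhsl.
Unshelve. all: by end_near. Qed.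

(** A test function with integral 0 is the derivative of a test function. Subtracting from [psi] a
    multiple of a fixed [chi] makes its integral 0, so [w - C] is orthogonal to every [psi], where
    [C] is the mean of [w] weighted by [chi]. Letting [psi] tend to the indicator of []0, x[] gives
    a zero primitive. *)
Lemma du_bois_reymond w : leb.-integrable unit_itv (EFin \o w) ->
  (forall phi, test_function phi ->
    \int[leb]_(x in unit_itv) (w x * derive1 phi x) = 0) ->
  exists C, {ae leb, forall x, 0 < x < 1 -> w x = C}.
Proof.
move=> Iw h.
have mI : measurable (unit_itv : set mR) by exact: measurable_itv.
pose w1 := w \_ unit_itv.
have Iw1 : leb.-integrable setT (EFin \o w1).
  by rewrite -restrict_EFin; apply/(integrable_mkcond _ mI).
have I1 : leb.-integrable setT (EFin \o (\1_(unit_itv : set mR) : R -> R)).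
  exact: integrable_indic_itv.
have E1 phi : test_function phi ->
    \int[leb]_x (phi x * \1_(unit_itv : set mR) x) = \int[leb]_x phi x.
  move=> tphi; apply: eq_Rintegral => x _; rewrite indicE.
  have [|/negP xI] := boolP (_ \in _); first by rewrite mulr1.
  rewrite (test_out tphi) ?mul0r// => /andP[x0 x1]; apply: xI; apply/mem_set.
  by rewrite /unit_itv/= in_itv/= !ltW.
have [ph0 [tph0 ph001 ph0o ph01]] := bump_sequence (lexx (0:R)) (lexx (1:R)).
have cvc := bump_sequence_cvg tph0 ph001 ph0o ph01 I1.
have vol (x : R) : 0 <= x <= 1 ->
    \int[leb]_(y in ([set` `]0%R, x[] : set mR)) \1_(unit_itv : set mR) y = x.
  move=> /andP[x0 x1]; rewrite (@eq_Rintegral _ _ _ _ _ (cst 1)).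
    rewrite Rintegral_cst; last exact: measurable_itv.
    suff : fine (lebesgue_measure (`]0%R, x[%classic : set R)) = x by rewrite mul1r.
    rewrite lebesgue_measure_itv/= lte_fin; have [->|x0'] := eqVneq x 0.
      by rewrite ltxx.
    by rewrite lt_def x0' x0 -EFinB subr0.
  move=> y /set_mem; rewrite /= in_itv/= => /andP[y0 yx].
  by rewrite indicE mem_set// /unit_itv/= in_itv/= ltW//= (le_trans (ltW yx)).
(* Not all the integrals of the functions [ph0 n] vanish, since they tend to 1. *)
have [chi tchi K0] : exists2 chi, test_function chi & \int[leb]_x chi x != 0.
  apply: contrapT => hn.
  have : \int[leb]_x (ph0 n x * \1_(unit_itv : set mR) x) @[n --> \oo] --> (0:R).
    rewrite (_ : (fun n => _) = cst 0); first exact: cvg_cst.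
    apply/funext => n; rewrite E1//=; apply/eqP/negPn/negP => h0.
    by apply: hn; exists (ph0 n).
  move=> /cvg_unique /(_ cvc); rewrite vol ?ler01//=.
  by move=> /(_ (@Rhausdorff _)) /eqP; rewrite eq_sym oner_eq0.
set K := \int[leb]_x chi x in K0.
pose C := (\int[leb]_x (chi x * w1 x)) / K; exists C.
have Itest phi : test_function phi -> leb.-integrable setT (EFin \o phi).
  move=> tphi; have [_ [a [b [_ _ h0]]]] := tphi.
  exact: integrable_supported (test_continuous tphi) h0.
have key psi : test_function psi ->
    \int[leb]_x (psi x * w1 x) = C * \int[leb]_x psi x.
  move=> tpsi; pose k := (\int[leb]_x psi x) / K.
  have [spsi [a1 [b1 [a10 b11 h1]]]] := tpsi.
  have [schi [a2 [b2 [a20 b21 h2]]]] := tchi.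
  have Ikchi : leb.-integrable setT (EFin \o (fun x => k * chi x)).
    by have := integrableZl measurableT k (Itest _ tchi).
  have [|||||phi tphi phiE] := @test_antiderivative (fun x => psi x - k * chi x)
    (Num.min a1 a2) (Num.max b1 b2).
  - by rewrite lt_min a10.
  - by rewrite gt_max b11.
  - exact: smooth_lin.
  - move=> x hx; rewrite h1 ?h2 ?mulr0 ?subr0// => /andP[ha hb]; apply: hx;
      by rewrite ge_min le_max ha hb ?orbT.
  - rewrite RintegralB//; [|exact: Itest].
    by rewrite RintegralZl//; [rewrite -/K divfK// subrr|exact: Itest].
  have := h _ tphi; rewrite Rintegral_mkcond phiE.
  rewrite (@eq_Rintegral _ mR _ _ _ (fun x : mR => psi x * w1 x - k * (chi x * w1 x))); last first.
    move=> x _; rewrite /w1 !patchE; case: ifPn => _; last by rewrite !mulr0 subr0.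
    ring.
  have I2 := integrable_testM tpsi Iw1; have I3 := integrable_testM tchi Iw1.
  rewrite RintegralB//; last by have := integrableZl measurableT k I3.
  rewrite RintegralZl// => /eqP; rewrite subr_eq0 => /eqP->.
  rewrite /C /k; ring.
pose W x := w1 x - C * \1_(unit_itv : set mR) x.
have IC1 : leb.-integrable setT (EFin \o (fun x => C * \1_(unit_itv : set mR) x)).
  by have := integrableZl measurableT C I1.
have IW : leb.-integrable setT (EFin \o W) by have := integrableB measurableT Iw1 IC1.
have W0 x : 0 < x < 1 -> \int[leb]_(y in [set` `]-oo, x]]) W y = 0.
  move=> /andP[x0 x1].
  have -> : \int[leb]_(y in [set` `]-oo, x]]) W y =
      \int[leb]_(y in ([set` `]0%R, x[] : set mR)) W y.
    rewrite /Rintegral; congr fine.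
    rewrite -integral_itv_bndo_bndc.
      rewrite [LHS]integral_mkcond [RHS]integral_mkcond.
      apply: (@eq_integral_off_null R _ mR leb ([set 0%R] : set mR) setT) => //.
        exact: lebesgue_measure_set1.
      move=> y _ y0; rewrite !patchE.
      have [y1|y1] := ltP 0 y.
        congr (if _ then _ else _); apply/idP/idP => /set_mem hy; apply/mem_set;
          by move: hy; rewrite /= !in_itv/= y1.
      have yI : ~ (unit_itv : set mR) y.
        by rewrite /unit_itv/= in_itv/= => /andP[h0 _]; apply: y0; apply/eqP; rewrite eq_le y1 h0.
      have -> : W y = 0 by rewrite /W /w1 patchE indicE (memNset yI) mulr0 subr0.
      by case: ifP; case: ifP.
    by apply: measurable_funTS; exact: measurable_int IW.
  have [phi [tphi phi01 phio phi1]] := bump_sequence (lexx (0:R)) (ltW x1).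
  have h1 := bump_sequence_cvg tphi phi01 phio phi1 IW.
  apply: (cvg_unique (@Rhausdorff R) h1).
  rewrite (_ : (fun n => _) = cst 0); first exact: cvg_cst.
  apply/funext => n /=.
  rewrite (@eq_Rintegral _ mR _ _ _ (fun x : mR => phi n x * w1 x -
      C * (phi n x * \1_(unit_itv : set mR) x))); last by move=> y _; rewrite /W; ring.
  have J1 := integrable_testM (tphi n) Iw1; have J2 := integrable_testM (tphi n) I1.
  rewrite RintegralB//; last by have := integrableZl measurableT C J2.
  by rewrite RintegralZl// key// E1// subrr.
apply: ae_imp (integral_zero_itv IW W0) _ => x /= hx x01.
have := hx x01; have xI : (unit_itv : set mR) x.
  by rewrite /unit_itv/= in_itv/=; case/andP: x01 => /ltW-> /ltW->.
rewrite /W /w1 patchE indicE (mem_set xI) mulr1 => /eqP.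
by rewrite subr_eq0 => /eqP.
Qed.

End du_bois_reymond.

Section BV_representation.
Context {R : realType} {d : nat}.
Local Notation mR := (measurableTypeR R).
Local Notation leb := (@lebesgue_measure R).
Variable c : R -> 'rV[R]_d.
Hypothesis hc : BV c.

Lemma Dcurve_distr : is_distr_derivative c (Dcurve c).
Proof.
have [_ h] := hc; rewrite /Dcurve; case: pselect => // h'.
by case: (cid h').
Qed.

Lemma Dcurve_conc i (A : set mR) : measurable A -> Dcurve c i A = Dcurve c i (A `&` oo01).
Proof. by move=> mA; have [+ _] := Dcurve_distr; exact. Qed.

(** Each coordinate of [c] and the distribution function of [Dcurve c i] have the same
    distributional derivative, so they differ by a constant. *)
Lemma BV_representation : exists C : 'rV[R]_d,
  {ae leb, forall x, 0 < x < 1 -> forall i, c x 0 i = C 0 i + sdf (Dcurve c i) x}.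
Proof.
have [Ic _] := hc; have [_ dd] := Dcurve_distr.
have mI : measurable (unit_itv : set mR) by exact: measurable_itv.
have h i : exists C, {ae leb, forall x, 0 < x < 1 -> c x 0 i - sdf (Dcurve c i) x = C}.
  have nu01 := Dcurve_conc i.
  have Is := integrable_sdf (Dcurve c i).
  apply: du_bois_reymond; first by have := integrableB mI (Ic i) Is.
  move=> phi tphi.
  under eq_Rintegral do rewrite mulrBl.
  rewrite RintegralB//; 
    [|exact: (integrable_mul_test_derive tphi (Ic i))|exact: (integrable_mul_test_derive tphi Is)].
  apply/eqP; rewrite subr_eq0; apply/eqP; rewrite /Rintegral; congr fine.
  by rewrite distr_derivative_sdf// -dd.
exists (\row_i sval (cid (h i))).
apply: ae_imp (ae_forall_ord (fun i => svalP (cid (h i)))) _ => x hx x01 i.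
rewrite mxE -(hx i x01).
by rewrite subrK.
Qed.

End BV_representation.

(** * Absolutely continuous curves *)

Section vector_charges.
Context {R : realType} {disp : measure_display} {T : measurableType disp} {d : nat}.
Variable nu : 'I_d -> {charge set T -> \bar R}.
Implicit Types A B : set T.

Lemma enorm_vmeas_le A : measurable A -> enorm (vmeas nu A) <= fine (tvar nu A).
Proof.
move=> mA; rewrite -lee_fin fineK ?tvar_fin//.
rewrite -edot_direction (le_trans (edot_vmeas_le_tvar _ _ mA))//.
rewrite -[leRHS]mul1e lee_wpmul2r ?tvar_ge0// lee_fin.
exact: enorm_direction_le.
Qed.

Lemma vmeasU A B : measurable A -> measurable B -> A `&` B = set0 ->
  vmeas nu (A `|` B) = vmeas nu A + vmeas nu B.
Proof.
move=> mA mB AB; apply/rowP => i; rewrite !mxE chargeU//.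
by rewrite fineD// fin_num_measure.
Qed.

Lemma vmeasD A B : measurable A -> measurable B -> B `<=` A ->
  vmeas nu (A `\` B) = vmeas nu A - vmeas nu B.
Proof.
move=> mA mB BA; have {2}-> : A = (A `\` B) `|` B by rewrite setUC setDUK.
rewrite vmeasU ?addrK//; first exact: measurableD.
by rewrite setIC setDIK.
Qed.

Lemma tvar_eq0 A : measurable A ->
  (forall B, measurable B -> B `<=` A -> vmeas nu B = 0) -> tvar nu A = 0%E.
Proof.
move=> mA h; apply/eqP; rewrite eq_le tvar_ge0 andbT.
apply: ge_ereal_sup => _ [->//|[F [mF tF FA] <-]].
rewrite eseries0// => n _ _; rewrite h ?enorm0//.
by rewrite -FA; exact: bigcup_sup.
Qed.

End vector_charges.

Section concentrated_charges.
Context {R : realType} {d : nat}.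
Local Notation mR := (measurableTypeR R).
Local Notation leb := (@lebesgue_measure R).
Variable nu : 'I_d -> {charge set mR -> \bar R}.
Hypothesis nu01 : forall i (A : set mR), measurable A -> nu i A = nu i (A `&` oo01).

Lemma vmeas_conc A : measurable A -> vmeas nu A = vmeas nu (A `&` oo01).
Proof. by move=> mA; apply/rowP => i; rewrite !mxE nu01. Qed.

Lemma tvar_conc (A : set mR) : measurable A -> tvar nu A = tvar nu (A `&` oo01).
Proof.
move=> mA; have mo := @measurable_oo01 R.
rewrite -[in LHS](setUIDK A oo01) measureU//; last 3 first.
- exact: measurableI.
- exact: measurableD.
- by rewrite setIC setDE -setIA [_ `&` (A `&` _)]setICA setICl !setI0.
rewrite [X in (_ + X)%E]tvar_eq0 ?adde0//; first exact: measurableD.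
move=> B mB BA; rewrite vmeas_conc// (_ : B `&` oo01 = set0) ?vmeas0//.
by apply/seteqP; split => // x [/BA[]].
Qed.

Lemma vmeas_ray_sub (x y : R) : x <= y ->
  vmeas nu (ray y) - vmeas nu (ray x) = vmeas nu [set` `]x, y]].
Proof.
move=> xy; rewrite -vmeasD; [|exact: measurable_ray|exact: measurable_ray|].
  congr vmeas; apply/seteqP; split => z; rewrite /ray/= !in_itv/=.
    by move=> [-> /negP]; rewrite -ltNge => ->.
  by move=> /andP[xz ->]; split => //; apply/negP; rewrite -ltNge.
by move=> z; rewrite /ray/= !in_itv/= => /le_trans; apply.
Qed.

Lemma vmeas_cells N t e B : grid N t e -> measurable B -> B `<=` oc01 ->
  vmeas nu B = \sum_(j < N) vmeas nu (B `&` cell t j).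
Proof.
move=> g mB B01; have [t0 tN _ _] := g.
suff : forall n, (n <= N)%N -> vmeas nu (B `&` [set` `]0, t n]]) =
    \sum_(j < n) vmeas nu (B `&` cell t j).
  by move=> /(_ N (leqnn _)) <-; rewrite tN -/oc01 (setIidl B01).
elim=> [_|n IH nN]; first by rewrite t0 set_itvoc0 setI0 vmeas0 big_ord0.
rewrite big_ord_recr/= -IH 1?ltnW//.
have /andP[tn0 tn1] := grid_itv g (ltnW nN).
have tnm : t n <= t n.+1 by apply: (grid_le g); rewrite leqnSn.
rewrite (@itv_bndbnd_setU _ _ _ (BRight (t n))) ?bnd_simp// setIUr.
rewrite vmeasU//.
- by apply: measurableI => //; exact: measurable_itv.
- by apply: measurableI => //; exact: measurable_itv.
- apply/seteqP; split => // x [[_ /=]]; rewrite !in_itv/= => /andP[_ h1] [_ /andP[h2 _]].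
  by move: (lt_le_trans h2 h1); rewrite ltxx.
Qed.

Lemma ae_dense (P : R -> Prop) (x y : R) : {ae leb, forall z, P z} -> x < y ->
  exists2 z, x < z < y & P z.
Proof.
move=> [A [mA A0 PA]] xy; apply: contrapT => hn.
have : (leb (`]x, y[%classic : set R) <= leb A)%E.
  apply: le_measure; rewrite ?inE//.
  move=> z; rewrite /= in_itv/= => xzy; apply: PA => Pz; apply: hn.
  by exists z.
rewrite A0 lebesgue_measure_itv/= lte_fin xy -EFinB lee_fin subr_le0.
by rewrite leNgt xy.
Qed.

Lemma vmeas_ray_right (x e : R) : 0 < e -> exists2 delta, 0 < delta &
  forall y, x <= y <= x + delta -> enorm (vmeas nu (ray y) - vmeas nu (ray x)) <= e.
Proof.
move=> e0; have [n hn] := measure_right_small (tvar nu) x e0.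
exists (2 / n.+1%:R) => [|y /andP[xy yx]]; first by rewrite divr_gt0.
rewrite vmeas_ray_sub//; apply: (le_trans (enorm_vmeas_le _ _)).
  exact: measurable_itv.
apply: le_trans (hn n (leqnn _)).
rewrite fine_le ?tvar_fin//.
apply: le_measure; rewrite ?inE//.
by move=> z; rewrite /= !in_itv/= => /andP[-> /le_trans->].
Qed.

(** Rays contain their end point, so the left limit at [x] of the distribution function misses
    exactly the mass of [x]; this is what identifies jumps with atoms. *)
Lemma vmeas_ray_left (x e : R) : 0 < e -> exists2 delta, 0 < delta &
  forall y, x - delta <= y < x ->
  enorm (vmeas nu (ray x) - vmeas nu [set x] - vmeas nu (ray y)) <= e.
Proof.
move=> e0; have [n hn] := measure_left_small (tvar nu) x e0.
exists (2 / n.+1%:R) => [|y /andP[xy yx]]; first by rewrite divr_gt0.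
have -> : vmeas nu (ray x) - vmeas nu [set x] - vmeas nu (ray y) =
    vmeas nu [set` `]y, x[].
  rewrite addrAC vmeas_ray_sub 1?ltW//.
  rewrite (_ : [set` `]y, x]] = [set` `]y, x[] `|` [set x]); last first.
    by rewrite (@setUitv1 _ _ (BRight y))// bnd_simp.
  rewrite vmeasU ?addrK//.
  by apply/seteqP; split => // z [/= + zx]; rewrite in_itv/= zx ltxx andbF.
apply: (le_trans (enorm_vmeas_le _ _)); first exact: measurable_itv.
apply: le_trans (hn n (leqnn _)).
rewrite fine_le ?tvar_fin//.
apply: le_measure; rewrite ?inE//.
by move=> z; rewrite /= !in_itv/= => /andP[/ltW/(le_trans xy)-> ->].
Qed.

End concentrated_charges.

Section absolutely_continuous_curves.
Context {R : realType} {d : nat}.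
Local Notation mR := (measurableTypeR R).
Local Notation leb := (@lebesgue_measure R).
Variable c : R -> 'rV[R]_d.
Hypotheses (hc : BV c) (ac : abs_continuous c).

Let nu := Dcurve c.
Let nu01 i (A : set mR) : measurable A -> nu i A = nu i (A `&` oo01).
Proof. exact: Dcurve_conc. Qed.

Lemma abs_continuous_continuous (e : R) : 0 < e -> exists2 delta, 0 < delta &
  forall x y, 0 <= x -> x <= y -> y <= 1 -> y - x < delta -> enorm (c y - c x) < e.
Proof.
move=> e0; have [delta d0 h] := ac e0; exists delta => // x y x0 xy y1 yx.
have := h 1%N (fun=> x) (fun=> y); rewrite !big_ord1; apply => //.
by move=> i j _ _ _; rewrite !ord1.
Qed.

(** The almost everywhere representation extends to every point by continuity of [c]: from the right
    when [x < 1], where the distribution function is right-continuous, and from the left at 1, where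
    [nu] has no mass. *)
Lemma abs_continuous_repr : exists C : 'rV[R]_d,
  forall x, 0 <= x <= 1 -> c x = C + vmeas nu (ray x).
Proof.
have [C hC] := BV_representation hc; exists C.
have hC' : {ae leb, forall x, 0 < x < 1 -> c x = C + vmeas nu (ray x)}.
  apply: ae_imp hC _ => x hx x01; apply/rowP => i.
  by rewrite hx// !mxE.
move=> x /andP[x0]; rewrite le_eqVlt => /orP x1.
apply/eqP; rewrite -subr_eq0 -enorm_eq0 eq_le enorm_ge0 andbT.
apply/ler_addgt0Pr => e e0; rewrite add0r.
have e2 : 0 < e / 2 by rewrite divr_gt0.
have [d1 d10 h1] := abs_continuous_continuous e2.
case: x1 => [/eqP x1|x1].
  have [d2 d20 h2] := vmeas_ray_left nu x e2.
  have hd : Num.max (x - d1) (Num.max (x - d2) 0) < x.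
    by rewrite !gt_max !ltrBlDr !ltrDl d10 d20 x1 ltr01.
  have [z /andP[]] := ae_dense hC' hd.
  rewrite !gt_max => /andP[xz1 /andP[xz2 z0]] zx hz.
  have {}hz := hz _; rewrite z0 -x1 zx in hz; have {}hz := hz isT.
  have v0 : vmeas nu [set x] = 0.
    rewrite (vmeas_conc nu01)//.
    rewrite (_ : _ `&` _ = set0) ?vmeas0//; apply/seteqP; split => // y [/= ->].
    by rewrite /oo01/= x1 in_itv/= ltxx andbF.
  have H1 : enorm (c x - c z) < e / 2.
    by apply: h1; rewrite ?(ltW z0) ?(ltW zx) ?x1//; rewrite -x1 ltrBlDr -ltrBlDl.
  have := h2 z; rewrite v0 subr0 ltW//= zx => /(_ isT) H2.
  rewrite (_ : c x - _ = (c x - c z) - (vmeas nu (ray x) - vmeas nu (ray z))).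
    by rewrite (le_trans (enormB _ _))// (splitr e) lerD// ltW.
  rewrite hz !opprD !opprK !addrA -[c x - C - _ - _ + _]addrA [- _ + _]addrC addrA.
  by rewrite subrK.
have [d2 d20 h2] := vmeas_ray_right nu x e2.
have hd : x < Num.min (x + d1) (Num.min (x + d2) 1).
  by rewrite !lt_min !ltrDl d10 d20 x1.
have [z /andP[xz]] := ae_dense hC' hd.
rewrite !lt_min => /andP[zx1 /andP[zx2 z1]] hz.
have {}hz := hz _; rewrite z1 (le_lt_trans x0 xz) in hz; have {}hz := hz isT.
have H1 : enorm (c z - c x) < e / 2.
  by apply: h1; rewrite ?(ltW xz) ?(ltW z1)// ltrBlDl.
have := h2 z; rewrite ltW//= ltW// => /(_ isT) H2.
rewrite enormBC in H1.
rewrite (_ : c x - _ = (c x - c z) + (vmeas nu (ray z) - vmeas nu (ray x))).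
  by rewrite (le_trans (enormD _ _))// (splitr e) lerD// ltW.
by rewrite hz; apply/rowP => i; rewrite !mxE; ring.
Qed.

(* A null set is approximated, for the measure [|nu| + Lebesgue], by the union of
   the cells of a grid that it mostly fills; that union has small length. *)
Lemma abs_continuous_null (B : set mR) : measurable B -> B `<=` oc01 -> leb B = 0%E ->
  vmeas nu B = 0.
Proof.
move=> mB B01 B0; have [C hC] := abs_continuous_repr.
have leb1 : (leb (oc01 : set mR) < +oo)%E.
  by rewrite lebesgue_measure_itv/= lte_fin ltr01 -EFinB ltry.
pose lb : {finite_measure set mR -> \bar R} := mfrestr (@measurable_oc01 R) leb1.
pose m := measure_add (tvar nu) lb.
have mE A : measurable A -> fine (m A) = fine (tvar nu A) + fine (lb A).
  by move=> mA; rewrite /m measure_addE fineD// fin_num_measure.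
apply/eqP; rewrite -enorm_eq0 eq_le enorm_ge0 andbT.
apply/ler_addgt0Pr => e e0; rewrite add0r.
have e2 : 0 < e / 2 by rewrite divr_gt0.
have [delta d0 hac] := ac e2.
have [N [t [gr _]]] := exists_grids m.
(* Twice the oscillation must be less than [delta], to bound the length of the selected cells, and
   at most [e / 2], to bound the error of replacing [B] by them. *)
have de : 0 < Num.min (delta / 4) (e / 8) by rewrite lt_min !divr_gt0.
have [n hn] := osc_small gr (integrable_indicR m mB) de.
have {}hn := hn n (leqnn _).
have g := gr n; move: hn g; set K := N n; set s := t n => hn g.
have IB j : m.-integrable (cell s j) (EFin \o (\1_B : mR -> R)).
  exact: (integrableS measurableT (measurable_cell s j) (@subsetT _ _)
    (integrable_indicR m mB)).
(* [E j] selects the cells that [B] fills at least by half, for [m]. On the part of a selected cell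
   outside [B], and on the part of any other cell inside [B], the indicator is at least 1/2 away
   from its average, so that part has measure at most [2 w j]. *)
pose E (j : nat) := 1 / 2 <= avg m (cell s j) \1_B.
pose w j := dev m (cell s j) \1_B.
have mc j : measurable (cell s j) by exact: measurable_cell.
have mD j : measurable (cell s j `\` B) by exact: measurableD.
have mI j : measurable (cell s j `&` B) by exact: measurableI.
have half (A : set mR) (j : nat) : measurable A -> A `<=` cell s j ->
    (forall x, A x -> 1 / 2 <= `|\1_B x - avg m (cell s j) \1_B|) ->
    fine (m A) <= 2 * w j.
  move=> mA Aj h; rewrite mulrC -ler_pdivrMr// mulrC -[2^-1]mul1r -Rintegral_cst//.
  apply: (@le_trans _ _ (\int[m]_(x in A) `|\1_B x - avg m (cell s j) \1_B|)).
    apply: le_Rintegral => //; first exact: integrable_cst_m.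
    apply: integrableS (integrable_absc _ (mc j) (IB j)) => //.
  rewrite -lee_fin /w /dev /Rintegral !fineK.
  - apply: ge0_subset_integral => //.
    exact: measurable_int (integrable_absc _ (mc j) (IB j)).
  - by apply: integrable_fin_num => //; exact: integrable_absc.
  - apply: integrable_fin_num => //.
    by apply: integrableS (integrable_absc _ (mc j) (IB j)).
have inE' j : E j -> fine (m (cell s j `\` B)) <= 2 * w j.
  move=> Ej; apply: half => // x [_ nB]; rewrite indicE memNset// sub0r normrN.
  by rewrite (le_trans Ej)// ler_norm.
have notE j : ~~ E j -> fine (m (cell s j `&` B)) <= 2 * w j.
  rewrite -ltNge => Ej; apply: half => // x [_ xB]; rewrite indicE mem_set//.
  by rewrite (le_trans _ (ler_norm _))//= mulr1n; lra.
have osce : \sum_(j < K) w j <= Num.min (delta / 4) (e / 8) by [].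
(* As [B] is Lebesgue null, the length of a selected cell is that of its part outside [B]. *)
have lE j : (j < K)%N -> E j -> s j.+1 - s j <= 2 * w j.
  move=> jK Ej; apply: le_trans (inE' j Ej).
  rewrite mE// -[leLHS]add0r lerD ?fine_ge0//.
  have [_ _ /(_ j jK) sj _] := g.
  have /andP[s0 _] := grid_itv g (ltnW jK); have /andP[_ s1] := grid_itv g jK.
  have -> : lb (cell s j `\` B) = leb (cell s j : set mR).
    rewrite /lb/= /mfrestr /mrestr.
    rewrite (_ : (cell s j `\` B) `&` oc01 = cell s j `\` B); last first.
      apply/setIidl => x [+ _]; rewrite /cell /oc01/= !in_itv/= => /andP[h1 h2].
      by rewrite (le_lt_trans s0 h1) (le_trans h2).
    rewrite [leb (cell s j)](_ : _ = leb ((cell s j `\` B) `|` (cell s j `&` B))).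
      rewrite measureU//; last by rewrite setDE -setIA [_ `&` (cell s j `&` _)]setICA setICl !setI0.
      rewrite [X in (_ + X)%E](_ : _ = 0%E) ?adde0//.
      apply/eqP; rewrite eq_le measure_ge0 andbT -B0 le_measure ?inE//.
    by rewrite setUC setUIDK.
  by rewrite /cell lebesgue_measure_itv/= lte_fin sj.
(* The other cells enter as degenerate intervals, so that the family is indexed by all the cells. *)
have := hac K (fun j => s j) (fun j => if E j then s j.+1 else s j).
have h1 (j : 'I_K) : 0 <= s j /\ s j <= (if E j then s j.+1 else s j) /\
    (if E j then s j.+1 else s j) <= 1.
  have jK := ltn_ord j.
  have [_ _ /(_ j jK) /ltW sj _] := g.
  have /andP[s0 sj1] := grid_itv g (ltnW jK); have /andP[_ s1] := grid_itv g jK.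
  by split => //; case: ifP.
move=> /(_ h1) hac1.
have h2 : trivIset setT (fun j : 'I_K => `]s j, (if E j then s j.+1 else s j)[%classic).
  move=> i j _ _ [x [/= + +]].
  have key (k : 'I_K) : x \in `]s k, (if E k then s k.+1 else s k)[ -> s k < x < s k.+1.
    rewrite in_itv/=; case: ifP => // _ /andP[h h']; move: (lt_trans h h').
    by rewrite ltxx.
  move=> /key /andP[xi ix] /key /andP[xj jx]; apply: val_inj => /=.
  have [ij|ji|//] := ltngtP i j; exfalso.
    have := @grid_le _ _ _ _ i.+1 j g; rewrite ij ltnW// => /(_ isT) h.
    by move: (lt_trans xj (lt_le_trans ix h)); rewrite ltxx.
  have := @grid_le _ _ _ _ j.+1 i g; rewrite ji ltnW// => /(_ isT) h.
  by move: (lt_trans xi (lt_le_trans jx h)); rewrite ltxx.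
have h3 : \sum_(j < K) ((if E j then s j.+1 else s j) - s j) < delta.
  apply: (@le_lt_trans _ _ (\sum_(j < K) 2 * w j)).
    apply: ler_sum => j _; case: ifP => Ej; first exact: lE.
    by rewrite subrr mulr_ge0// dev_ge0.
  rewrite -mulr_sumr (@le_lt_trans _ _ (2 * (delta / 4)))//; last lra.
  by rewrite ler_wpM2l// (le_trans osce)// ge_min lexx.
have {}hac1 := hac1 h2 h3.
rewrite (vmeas_cells nu g mB B01).
apply: (@le_trans _ _ (\sum_(j < K) enorm (vmeas nu (B `&` cell s j)))).
  by have := enorm_sum K (fun j => vmeas nu (B `&` cell s j)); rewrite !big_mkord.
apply: (@le_trans _ _ (\sum_(j < K)
    (enorm (c (if E j then s j.+1 else s j) - c (s j)) + 2 * w j))).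
  apply: ler_sum => j _; have jK := ltn_ord j.
  have [_ _ /(_ j jK) /ltW sj _] := g.
  have si := grid_itv g (ltnW jK); have si1 := grid_itv g jK.
  case: ifPn => Ej.
    rewrite !hC// opprD addrACA subrr add0r vmeas_ray_sub//.
    rewrite -[X in enorm (vmeas _ X) + _]/(cell s j).
    have -> : B `&` cell s j = cell s j `\` (cell s j `\` B) by rewrite setDD setIC.
    rewrite vmeasD//.
    rewrite (le_trans (enormB _ _))// lerD2l (le_trans (enorm_vmeas_le _ _))//.
    by rewrite (le_trans _ (inE' j Ej))// mE// lerDl fine_ge0.
  rewrite subrr enorm0 add0r (le_trans (enorm_vmeas_le _ _))//; first by rewrite setIC.
  by rewrite setIC (le_trans _ (notE j Ej))// mE// lerDl fine_ge0.
rewrite big_split/= -mulr_sumr (splitr e) lerD//; first exact: ltW.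
rewrite (@le_trans _ _ (2 * (e / 8)))//; last lra.
by rewrite ler_wpM2l// (le_trans osce)// ge_min lexx orbT.
Qed.

Lemma abs_continuous_density : exists g, vdensity leb nu g.
Proof.
have dom i : nu i `<< leb.
  apply/null_content_dominatesP => B mB B0.
  have mB' : measurable (B `&` oo01) by apply: measurableI => //; exact: measurable_oo01.
  have : vmeas nu (B `&` oo01) = 0.
    apply: abs_continuous_null => //.
      by move=> x [_]; rewrite /oo01 /oc01/= !in_itv/= => /andP[-> /ltW].
    by apply/eqP; rewrite eq_le measure_ge0 andbT -B0 le_measure ?inE//.
  move=> /(congr1 (fun v : 'rV[R]_d => v 0 i)); rewrite !mxE nu01// => h.
  by rewrite -[LHS]fineK ?h// fin_num_measure.
exists (fun x => \row_i fine (Radon_Nikodym (nu i) leb x)).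
have fE i : EFin \o (fun x => (\row_i fine (Radon_Nikodym (nu i) leb x)) 0 i) =
    Radon_Nikodym (nu i) leb.
  by apply/funext => x /=; rewrite mxE fineK// Radon_Nikodym_fin_num.
split => [i|i A mA].
  by rewrite fE; exact: Radon_Nikodym_integrable.
rewrite (Radon_Nikodym_integral (dom i) mA) -fE.
by [].
Qed.

End absolutely_continuous_curves.

Lemma ae_null {R : realType} {disp} {T : measurableType disp} (mu : {measure set T -> \bar R})
    (P : T -> Prop) : {ae mu, forall x, P x} ->
  exists N : set T, [/\ measurable N, mu N = 0%E & forall x, ~ N x -> P x].
Proof.
move=> [A [mA A0 PA]]; exists A; split => // x nA; apply: contrapT => nP.
exact/nA/PA.
Qed.

(** * Primitives of integrable functions and classical derivatives *)

Section primitives.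
Context {R : realType} {d : nat}.
Local Notation mR := (measurableTypeR R).
Local Notation leb := (@lebesgue_measure R).
Implicit Types (u c : R -> 'rV[R]_d) (g : mR -> 'rV[R]_d).

Definition primitive g (x : R) : 'rV[R]_d := \row_i \int[leb]_(y in ray x) g y 0 i.

Lemma ae_derive_primitive u g (C : 'rV[R]_d) : vintegrable leb g ->
  (forall x, 0 < x < 1 -> u x = C + primitive g x) ->
  {ae leb, forall x, 0 < x < 1 -> curve_derivative u x = g x}.
Proof.
move=> Ig hu.
have h i : {ae leb, forall x, 0 < x < 1 -> derive1 (fun y => u y 0 i) x = g x 0 i}.
  have Igi := Ig i.
  have I1 y : leb.-integrable `]-oo, y] (EFin \o (fun x => g x 0 i)).
    by apply: integrableS Igi => //.
  have I2 : locally_integrable [set: R] (fun x => g x 0 i).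
    by apply: open_integrable_locally => //; exact: openT.
  have := FTC1Ny I1 I2; move=> /ae_imp; apply => x [dF eF] x01.
  have dFx : is_derive x (1 : R) (fun y => \int[leb]_(z in ray y) g z 0 i) (g x 0 i).
    by rewrite -eF derive1E; exact: derivableP.
  have dC : is_derive x (1 : R) (fun y => C 0 i + \int[leb]_(z in ray y) g z 0 i) (g x 0 i).
    rewrite -[g x 0 i]add0r; exact: is_deriveD.
  rewrite derive1E; apply: (@derive_val _ _ _ _ _ _ _ (is_derive_near _ dC)).
  have : \forall y \near x, y \in `]0, 1[ by apply: near_in_itvoo; rewrite in_itv.
  by apply: filterS => y; rewrite in_itv/= => /hu ->; rewrite !mxE.
apply: ae_imp (ae_forall_ord h) _ => x hx x01; apply/rowP => i.
by rewrite mxE hx.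
Qed.

Lemma vmeas_ray_density nu g x : vdensity leb nu g -> vmeas nu (ray x) = primitive g x.
Proof.
move=> [_ h]; apply/rowP => i; rewrite !mxE h//; exact: measurable_ray.
Qed.

Lemma abs_continuous_derivative c : BV c -> abs_continuous c -> exists2 g,
  vdensity leb (Dcurve c) g & {ae leb, forall x, 0 < x < 1 -> curve_derivative c x = g x}.
Proof.
move=> hc ac; have [g hg] := abs_continuous_density hc ac; exists g => //.
have [C hC] := abs_continuous_repr hc ac.
apply: (@ae_derive_primitive _ _ C); first by case: hg.
move=> x /andP[x0 x1]; rewrite hC ?(ltW x0) ?(ltW x1)//.
by rewrite (vmeas_ray_density _ hg).
Qed.

Lemma integral_unit_oo (f h : mR -> \bar R) :
  {ae leb, forall x, 0 < x < 1 -> f x = h x} ->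
  (\int[leb]_(x in unit_itv) f x = \int[leb]_(x in oo01) h x)%E.
Proof.
move=> /ae_null[N [mN N0 hN]].
rewrite [LHS]integral_mkcond [RHS]integral_mkcond.
apply: (@eq_integral_off_null _ _ _ leb (N `|` ([set 0] `|` [set 1]))).
- by apply: measurableU => //; apply: measurableU.
- rewrite measureU0//; first by apply: measurableU.
  apply/eqP; rewrite eq_le measure_ge0 andbT (le_trans (measureU2 _ _ _))//.
  have z (a : R) : leb ([set a] : set mR) = 0%E by exact: lebesgue_measure_set1.
  by rewrite [X in (X + _)%E](z 0) [X in (_ + X)%E](z 1) adde0.
- move=> x _ nx; have nN : ~ N x by move=> ?; apply: nx; left.
  have x0 : x != 0 by apply/eqP => x0; apply: nx; right; left.
  have x1 : x != 1 by apply/eqP => x1; apply: nx; right; right.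
  rewrite !patchE; case: ifPn => [/set_mem|/negP h1].
    rewrite /unit_itv/= in_itv/= => /andP[a b].
    have x01 : 0 < x < 1 by rewrite !lt_neqAle a b x1 eq_sym x0.
    by rewrite mem_set ?hN// /oo01/= in_itv.
  rewrite memNset//; rewrite /oo01/= in_itv/= => /andP[a b]; apply: h1.
  by rewrite mem_set// /unit_itv/= in_itv/= !ltW.
Qed.

End primitives.

Section length_similarity.
Context {R : realType} {d : nat}.
Local Notation mR := (measurableTypeR R).
Local Notation leb := (@lebesgue_measure R).

Lemma similarity_density (u1 u2 : R -> 'rV[R]_d) (g1 g2 : mR -> 'rV[R]_d) :
  {ae leb, forall x, 0 < x < 1 -> curve_derivative u1 x = g1 x} ->
  {ae leb, forall x, 0 < x < 1 -> curve_derivative u2 x = g2 x} ->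
  similarity u1 u2 = (\int[leb]_(x in oo01) (sim (g1 x) (g2 x))%:E)%E.
Proof.
move=> /ae_null[N1 [mN1 N10 h1]] /ae_null[N2 [mN2 N20 h2]].
apply: integral_unit_oo.
exists (N1 `|` N2); split; first exact: measurableU.
  by rewrite measureU0.
move=> x /= nx; apply: contrapT => nN; apply: nx => x01.
have -> : g1 x = curve_derivative u1 x by rewrite h1// => ?; apply: nN; left.
have -> : g2 x = curve_derivative u2 x by rewrite h2// => ?; apply: nN; right.
case: ifPn => [/orP[]/eqP->|_]; rewrite ?sim0l ?sim0r//.
by rewrite simE.
Qed.

Lemma len_density (u : R -> 'rV[R]_d) g : BV u -> vdensity leb (Dcurve u) g ->
  len u = (\int[leb]_(x in oo01) (enorm (g x))%:E)%E.
Proof.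
move=> hu hg; rewrite /len (@tvar_density _ _ _ _ leb _ _ _ _ hg).
  by apply: integral_unit_oo; exact: aeW.
exact: measurable_itv.
Qed.

End length_similarity.

(** * Similarity of increments *)

Section normalization.
Context {R : realType} {d : nat}.
Implicit Types u v x y : 'rV[R]_d.

(** The map [x -> x / sqrt |x|] is only Hoelder continuous of exponent 1/2, hence the roots on the
    right. The difference is [(x - y) / sqrt a + (1 / sqrt a - 1 / sqrt b) y]: as [|x - y| <= 2 a],
    the first term is at most [2 sqrt |x - y|], and as [|y| <= b], the second one is at most
    [sqrt a - sqrt b <= sqrt (a - b)]. *)
Let normalize_devW x y (a b : R) : enorm x <= a -> enorm y <= b -> b <= a ->
  enorm ((Num.sqrt a)^-1 *: x - (Num.sqrt b)^-1 *: y) <=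
  2 * (Num.sqrt (enorm (x - y)) + Num.sqrt (a - b)).
Proof.
move=> xa yb ba.
have b0 : 0 <= b := le_trans (enorm_ge0 y) yb.
have a0 : 0 <= a := le_trans b0 ba.
set e := Num.sqrt (enorm (x - y)); have e0 : 0 <= e by exact: sqrtr_ge0.
have ee : e * e = enorm (x - y) by rewrite -expr2 sqr_sqrtr ?enorm_ge0.
set p := Num.sqrt a; have p0 : 0 <= p by exact: sqrtr_ge0.
have pp : p * p = a by rewrite -expr2 sqr_sqrtr.
set q := Num.sqrt b; have q0 : 0 <= q by exact: sqrtr_ge0.
have qq : q * q = b by rewrite -expr2 sqr_sqrtr.
set h := Num.sqrt (a - b); have h0 : 0 <= h by exact: sqrtr_ge0.
have hh : h * h = a - b by rewrite -expr2 sqr_sqrtr ?subr_ge0.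
have [pe|pN0] := eqVneq p 0.
  have x0 : x = 0.
    by apply/eqP; rewrite -enorm_eq0 eq_le enorm_ge0 andbT (le_trans xa)// -pp pe mul0r.
  have y0 : y = 0.
    apply/eqP; rewrite -enorm_eq0 eq_le enorm_ge0 andbT (le_trans yb)//.
    by rewrite (le_trans ba)// -pp pe mul0r.
  by rewrite x0 y0 !scaler0 subrr enorm0 mulr_ge0// addr_ge0.
have pgt : 0 < p by rewrite lt_def pN0.
have xy2 : enorm (x - y) <= 2 * (p * p).
  by rewrite (le_trans (enormB _ _))// pp; lra.
have H1 : enorm (p^-1 *: (x - y)) <= 2 * e.
  rewrite enormZ gtr0_norm ?invr_gt0// mulrC ler_pdivrMr// -ee.
  have : e <= 2 * p by rewrite -ee in xy2; nra.
  by nra.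
have H2 : enorm ((p^-1 - q^-1) *: y) <= h.
  have qp : q <= p by rewrite ler_wsqrtr.
  have hpq : p - q <= h by nra.
  rewrite enormZ; have [qe|qN0] := eqVneq q 0.
    have y0 : enorm y <= 0 by rewrite (le_trans yb)// -qq qe mul0r.
    by rewrite (le_trans _ h0)// mulr_ge0_le0.
  have qgt : 0 < q by rewrite lt_def qN0.
  rewrite ler0_norm; last by rewrite subr_le0 lef_pV2.
  rewrite opprB (@le_trans _ _ ((q^-1 - p^-1) * (q * q)))//.
    by rewrite ler_wpM2l ?qq// subr_ge0 lef_pV2.
  have -> : (q^-1 - p^-1) * (q * q) = (p - q) * (q / p).
    by field; rewrite qN0 pN0.
  apply: le_trans hpq; rewrite -[leRHS]mulr1 ler_wpM2l ?subr_ge0//.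
  by rewrite ler_pdivrMr// mul1r.
have -> : p^-1 *: x - q^-1 *: y = p^-1 *: (x - y) + (p^-1 - q^-1) *: y.
  by rewrite scalerBr scalerBl addrA subrK.
rewrite (le_trans (enormD _ _))// mulrDr lerD//.
by rewrite (le_trans H2)//; lra.
Qed.

(** The normalization is by [r] and not by [|u|] because on a cell [u] is the average of a density
    and [r] the average of its norm, which may be larger. *)
Lemma normalize_dev u v (r : R) : enorm u <= r ->
  enorm ((Num.sqrt r)^-1 *: u - srv v) <=
  2 * (Num.sqrt (enorm (u - v)) + Num.sqrt `|r - enorm v|).
Proof.
move=> ur; rewrite /srv; have [h|h] := leP (enorm v) r.
  by rewrite ger0_norm ?subr_ge0// normalize_devW.
rewrite [leLHS]enormBC (enormBC u) distrC gtr0_norm ?subr_gt0//.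
by rewrite normalize_devW// ltW.
Qed.

End normalization.

Lemma Rintegral_sum_ord {R : realType} {disp} {T : measurableType disp}
    (mu : {measure set T -> \bar R}) (D : set T) (I : Type) (r : seq I) (f : I -> T -> R) :
  measurable D -> (forall i, mu.-integrable D (EFin \o f i)) ->
  mu.-integrable D (EFin \o (fun x => \sum_(i <- r) f i x)) /\
  \int[mu]_(x in D) (\sum_(i <- r) f i x) = \sum_(i <- r) \int[mu]_(x in D) f i x.
Proof.
move=> mD If; elim: r => [|i r [IH1 IH2]].
  split; last by rewrite big_nil; under eq_Rintegral do rewrite big_nil; rewrite Rintegral_cst ?mul0r.
  rewrite (_ : _ \o _ = cst 0%E); first exact: integrable0.
  by apply/funext => x /=; rewrite big_nil.
have e : (fun x => \sum_(j <- i :: r) f j x) = (fun x => f i x + \sum_(j <- r) f j x).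
  by apply/funext => x; rewrite big_cons.
split; first by rewrite e; have := integrableD mD (If i) IH1.
by rewrite e big_cons -IH2 RintegralD.
Qed.

Section cell_similarity.
Context {R : realType} {d : nat}.
Local Notation mR := (measurableTypeR R).
Variable m : {finite_measure set mR -> \bar R}.
Implicit Types (nu : 'I_d -> {charge set mR -> \bar R}) (f : mR -> 'rV[R]_d)
  (A : set mR).

Definition vavg A f : 'rV[R]_d := \row_i avg m A (fun x => f x 0 i).

(** Summed over coordinates, so that the scalar result on oscillations applies; it dominates the
    mean deviation in Euclidean norm by [vdev_ge]. *)
Definition vdev A f : R := \sum_(i < d) dev m A (fun x => f x 0 i).

Lemma vdensity_vavg nu f A : measurable A -> vdensity m nu f ->
  vmeas nu A = fine (m A) *: vavg A f.
Proof.
move=> mA [If h]; apply/rowP => i; rewrite !mxE mulrC avgM ?h//.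
exact: integrableS (If i).
Qed.

Lemma tvar_avg nu f A : measurable A -> vdensity m nu f ->
  fine (tvar nu A) = fine (m A) * avg m A (fun x => enorm (f x)).
Proof.
move=> mA hf; rewrite (tvar_density mA hf) mulrC avgM//.
exact: integrableS (integrable_enorm hf.1).
Qed.

Lemma enorm_vavg_le nu f A : measurable A -> vdensity m nu f ->
  enorm (vavg A f) <= avg m A (fun x => enorm (f x)).
Proof.
move=> mA hf; have := enorm_vmeas_le nu mA.
rewrite (vdensity_vavg mA hf) (tvar_avg mA hf) enormZ ger0_norm ?fine_ge0//.
have [m0 _|m0] := eqVneq (fine (m A)) 0; last by rewrite ler_pM2l// lt_def m0 fine_ge0.
rewrite /vavg/avg m0 invr0 mulr0 (_ : \row_i _ = 0) ?enorm0//.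
by apply/rowP => i; rewrite !mxE mulr0.
Qed.

Lemma vintegrable_sub f (v : 'rV[R]_d) : vintegrable m f -> vintegrable m (fun x => f x - v).
Proof.
move=> If i; have := integrable_subc (v 0 i) measurableT (If i).
by apply: eq_integrable => // x _ /=; rewrite !mxE.
Qed.

Lemma integrable_vdev f A (v : 'rV[R]_d) : measurable A -> vintegrable m f ->
  m.-integrable A (EFin \o (fun x => enorm (f x - v))).
Proof.
move=> mA If; exact: integrableS (integrable_enorm (vintegrable_sub v If)).
Qed.

Lemma vdev_ge f A : measurable A -> vintegrable m f ->
  \int[m]_(x in A) enorm (f x - vavg A f) <= vdev A f.
Proof.
move=> mA If.
have Ii i : m.-integrable A (EFin \o (fun x => `|f x 0 i - avg m A (fun x => f x 0 i)|)).
  by apply: integrable_absc => //; exact: integrableS (If i).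
have [Is Es] := Rintegral_sum_ord (index_enum 'I_d) mA Ii.
rewrite /vdev /dev -Es; apply: le_Rintegral => //; first exact: integrable_vdev.
move=> x _; rewrite (le_trans (enorm_le_sum _))// le_eqVlt; apply/orP; left.
by apply/eqP; apply: eq_bigr => i _; rewrite !mxE.
Qed.

Lemma psim_bounded {T : Type} (f1 f2 : T -> 'rV[R]_d) :
  (forall x, enorm (f1 x) <= 1) -> (forall x, enorm (f2 x) <= 1) ->
  exists M, forall x, `|psim (f1 x) (f2 x)| <= M.
Proof.
move=> b1 b2; exists 1 => x; rewrite ger0_norm ?psim_ge0// (le_trans (psim_le _ _))//.
by rewrite mulr_ile1 ?sqrtr_ge0// -sqrtr1 ler_wsqrtr.
Qed.

Lemma integrable_psim f1 f2 A : measurable A -> vintegrable m f1 -> vintegrable m f2 ->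
  (forall x, enorm (f1 x) <= 1) -> (forall x, enorm (f2 x) <= 1) ->
  m.-integrable A (EFin \o (fun x => psim (f1 x) (f2 x))).
Proof.
move=> mA I1 I2 b1 b2; apply: bounded_integrable => //; last exact: psim_bounded.
by apply: measurable_funTS; apply: measurable_psim; exact: vintegrable_measurable.
Qed.

(** The normalization is by [|D c_i|(A)], which is what the upper bound leaves; it makes the value
    at most [psim] of the increments, as the lower bound needs. *)
Definition cell_sim nu1 nu2 A : R := Num.max
  (edot ((Num.sqrt (fine (tvar nu1 A)))^-1 *: vmeas nu1 A)
        ((Num.sqrt (fine (tvar nu2 A)))^-1 *: vmeas nu2 A)) 0.

(** With [M = m A], [F] the norm of the average of [f] and [r] the average of its norm, the defect
    is [M (r^2 - F^2) / r <= 2 M (r - F)] because [F <= r], and [M (r - F)] is at most the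
    integrated deviation of [f]. *)
Lemma cell_defect nu f A : measurable A -> vdensity m nu f ->
  fine (tvar nu A) - edot ((fine (tvar nu A))^-1 *: vmeas nu A) (vmeas nu A) <= 2 * vdev A f.
Proof.
move=> mA hf.
have M0 : 0 <= fine (m A) by rewrite fine_ge0.
have Fr := enorm_vavg_le mA hf.
have Ie : m.-integrable A (EFin \o (fun x => enorm (f x))).
  exact: integrableS (integrable_enorm hf.1).
apply: (@le_trans _ _ (2 * (fine (tvar nu A) - fine (m A) * enorm (vavg A f)))).
  rewrite edotZl (vdensity_vavg mA hf) (tvar_avg mA hf) -sqr_enorm enormZ ger0_norm//.
  move: M0 Fr; set M := fine _; set F := enorm _; set r := avg _ _ _ => M0 Fr.
  have F0 : 0 <= F by exact: enorm_ge0.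
  have [->|M'] := eqVneq M 0; first by rewrite !mul0r expr0n !mulr0 subrr mulr0.
  have [r0|r'] := eqVneq r 0.
    have F0' : F = 0 by apply/eqP; rewrite eq_le F0 -r0 Fr.
    by rewrite F0' r0 !mulr0 expr0n !mulr0 subrr mulr0.
  have -> : M * r - (M * r)^-1 * (M * F) ^+ 2 = M * (r - F) * ((r + F) / r).
    by field; rewrite M' r'.
  rewrite -mulrBr mulrC; have rgt : 0 < r by rewrite lt_def r' (le_trans F0).
  rewrite ler_wpM2r ?mulr_ge0 ?subr_ge0// ler_pdivrMr//; lra.
rewrite ler_pM2l// (tvar_avg mA hf) mulrC avgM//.
rewrite mulrC -Rintegral_cst// -RintegralB//; last exact: integrable_cst_m.
apply: le_trans (vdev_ge mA hf.1); apply: le_Rintegral => //.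
- by have := integrableB mA Ie (integrable_cst_m m (enorm (vavg A f)) mA).
- exact: integrable_vdev hf.1.
- by move=> x _; rewrite (le_trans (ler_norm _))// enorm_triB.
Qed.

(** By homogeneity [cell_sim] is [m A] times a constant [X] built from the normalized averages, and
    [X] is compared pointwise with the integrand. Each density contributes, through [normalize_dev],
    twice two square roots of deviations; [sqrt_le_lin] with parameter [e] linearizes them, hence
    [8 e] and the factor [2 / e]. *)
Lemma cell_sim_dev nu1 nu2 f1 f2 A (e : R) : measurable A -> 0 < e ->
  vdensity m nu1 f1 -> vdensity m nu2 f2 ->
  (forall x, enorm (f1 x) <= 1) -> (forall x, enorm (f2 x) <= 1) ->
  `|cell_sim nu1 nu2 A - \int[m]_(x in A) psim (f1 x) (f2 x)| <=
  8 * e * fine (m A) + 2 / e * (vdev A f1 + dev m A (fun x => enorm (f1 x)) +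
                                (vdev A f2 + dev m A (fun x => enorm (f2 x)))).
Proof.
move=> mA e0 h1 h2 b1 b2.
pose rho (f : mR -> 'rV[R]_d) := avg m A (fun x => enorm (f x)).
pose P f := (Num.sqrt (rho f))^-1 *: vavg A f.
have M0 : 0 <= fine (m A) by rewrite fine_ge0.
have rho1 f : (forall x, enorm (f x) <= 1) -> vintegrable m f -> 0 <= rho f <= 1.
  move=> b If; have Ie : m.-integrable A (EFin \o (fun x => enorm (f x))).
    exact: integrableS (integrable_enorm If).
  apply/andP; split.
    by rewrite divr_ge0//; apply: Rintegral_ge0 => x _; exact: enorm_ge0.
  rewrite /rho /avg; have [->|M'] := eqVneq (fine (m A)) 0; first by rewrite invr0 mulr0.
  rewrite ler_pdivrMr ?lt_def ?M'// -Rintegral_cst//.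
  by apply: le_Rintegral => //; exact: integrable_cst_m.
have PE nu f : vdensity m nu f ->
    (Num.sqrt (fine (tvar nu A)))^-1 *: vmeas nu A = Num.sqrt (fine (m A)) *: P f.
  move=> hf; rewrite (vdensity_vavg mA hf) (tvar_avg mA hf) sqrtrM// /P !scalerA.
  congr (_ *: _); rewrite -/(rho f); move: (Num.sqrt (rho f)) => r.
  rewrite -{2}(sqr_sqrtr M0); set p := Num.sqrt _.
  have [->|p0] := eqVneq p 0; first by rewrite expr0n mulr0 mul0r.
  by rewrite invfM expr2 mulrAC mulKf.
have P1 nu f : vdensity m nu f -> (forall x, enorm (f x) <= 1) -> enorm (P f) <= 1.
  move=> hf b; have /andP[r0 r1] := rho1 _ b hf.1.
  rewrite /P enormZ ger0_norm ?invr_ge0 ?sqrtr_ge0//.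
  have [->|p0] := eqVneq (Num.sqrt (rho f)) 0; first by rewrite invr0 mul0r.
  rewrite mulrC ler_pdivrMr ?lt_def ?p0 ?sqrtr_ge0// mul1r.
  rewrite (le_trans (enorm_vavg_le mA hf))// -/(rho f).
  rewrite -{1}(sqr_sqrtr r0) expr2 ler_piMl ?sqrtr_ge0//.
  by rewrite -sqrtr1 ler_wsqrtr.
pose X := Num.max (edot (P f1) (P f2)) 0.
have -> : cell_sim nu1 nu2 A = X * fine (m A).
  rewrite /cell_sim (PE _ _ h1) (PE _ _ h2) edotZl edotZr mulrA -expr2 sqr_sqrtr//.
  by rewrite /X maxr_pMl// mul0r mulrC.
have srv1 f x : (forall x, enorm (f x) <= 1) -> enorm (srv (f x) : 'rV[R]_d) <= 1.
  by move=> b; rewrite enorm_srv -sqrtr1 ler_wsqrtr.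
have Ip := integrable_psim mA h1.1 h2.1 b1 b2.
rewrite -Rintegral_cst// -RintegralB//; last exact: integrable_cst_m.
have Id f c : vintegrable m f -> m.-integrable A (EFin \o (fun x => `|enorm (f x) - c|)).
  move=> If; apply: integrable_absc => //; exact: integrableS (integrable_enorm If).
pose g f x := enorm (f x - vavg A f) + `|enorm (f x) - rho f|.
have Ig f : vintegrable m f -> m.-integrable A (EFin \o g f).
  by move=> If; have := integrableD mA (integrable_vdev (vavg A f) mA If) (Id f (rho f) If).
have Igg : m.-integrable A (EFin \o (fun x => 8 * e + 2 / e * (g f1 x + g f2 x))).
  have := integrableD mA (integrable_cst_m m (8 * e) mA)
    (integrableZl mA (2 / e) (integrableD mA (Ig _ h1.1) (Ig _ h2.1))).
  by [].
have Igg' : m.-integrable A (EFin \o (fun x => g f1 x + g f2 x)).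
  by have := integrableD mA (Ig _ h1.1) (Ig _ h2.1).
have Igz : m.-integrable A (EFin \o (fun x => 2 / e * (g f1 x + g f2 x))).
  by have := integrableZl mA (2 / e) Igg'.
apply: (@le_trans _ _ (\int[m]_(x in A) (8 * e + 2 / e * (g f1 x + g f2 x)))); last first.
  rewrite RintegralD//; last exact: integrable_cst_m.
  rewrite Rintegral_cst// lerD2l RintegralZl// ler_wpM2l ?divr_ge0 ?(ltW e0)//.
  rewrite RintegralD; [|by []|exact: Ig h1.1|exact: Ig h2.1].
  rewrite lerD// RintegralD//.
  - by rewrite lerD2r vdev_ge//; exact: h1.1.
  - exact: integrable_vdev h1.1.
  - exact: Id h1.1.
  - by rewrite lerD2r vdev_ge//; exact: h2.1.
  - exact: integrable_vdev h2.1.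
  - exact: Id h2.1.
have Iq : m.-integrable A (EFin \o (fun x => X - psim (f1 x) (f2 x))).
  by have := integrableB mA (integrable_cst_m m X mA) Ip.
apply: (le_trans (le_normr_Rintegral _ _)) => //.
apply: le_Rintegral => //; first by have := integrable_norm Iq.
move=> x _.
have key nu f : vdensity m nu f -> enorm (P f - srv (f x)) <= 4 * e + 2 / e * g f x.
  move=> hf; rewrite (le_trans (normalize_dev (f x) (enorm_vavg_le mA hf)))//.
  rewrite (_ : 4 * e + _ = 2 * ((e + enorm (vavg A f - f x) / e) +
    (e + `|rho f - enorm (f x)| / e))); last first.
    by rewrite /g enormBC distrC; field; rewrite gt_eqF.
  by rewrite ler_pM2l// lerD// sqrt_le_lin// enorm_ge0.
apply: (le_trans (@normB_psim _ _ _ _ _ _ (P1 _ _ h2 b2) (srv1 f1 x b1))).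
apply: (le_trans (lerD (key _ _ h1) (key _ _ h2))).
by rewrite le_eqVlt; apply/orP; left; apply/eqP; ring.
Qed.

End cell_similarity.

Section grid_limits.
Context {R : realType} {d : nat}.
Local Notation mR := (measurableTypeR R).
Variables (m : {finite_measure set mR -> \bar R}) (N : nat -> nat) (t : nat -> nat -> R).
Hypothesis gr : grids N t.

Lemma osc_near (f : R -> R) e : m.-integrable setT (EFin \o f) -> 0 < e ->
  \forall n \near \oo, osc m (N n) (t n) f <= e.
Proof.
by move=> If e0; have [n0 h] := osc_small gr If e0; exists n0.
Qed.

Lemma vosc_near (f : mR -> 'rV[R]_d) e : vintegrable m f -> 0 < e ->
  \forall n \near \oo, \sum_(j < N n) vdev m (cell (t n) j) f <= e.
Proof.
move=> If e0; have de : 0 < e / d.+1%:R by rewrite divr_gt0.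
have : \forall n \near \oo, forall i : 'I_d, osc m (N n) (t n) (fun x => f x 0 i) <= e / d.+1%:R.
  by apply: filter_forall => i; exact: osc_near.
apply: filterS => n h; rewrite exchange_big/=.
apply: (@le_trans _ _ (\sum_(i < d) e / d.+1%:R)); first by apply: ler_sum => i _; exact: h.
rewrite sumr_const card_ord -[leLHS]mulr_natr mulrAC -mulrA ler_piMr// ?(ltW e0)//.
by rewrite ler_pdivrMr// mul1r ler_nat.
Qed.

Lemma defect_near nu (f : mR -> 'rV[R]_d) e : vdensity m nu f -> 0 < e ->
  \forall n \near \oo, \sum_(j < N n) (fine (tvar nu (cell (t n) j)) -
    edot ((fine (tvar nu (cell (t n) j)))^-1 *: vmeas nu (cell (t n) j))
         (vmeas nu (cell (t n) j))) <= e.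
Proof.
move=> hf e0; have e2 : 0 < e / 2 by rewrite divr_gt0.
apply: filterS (vosc_near hf.1 e2) => n h.
apply: (@le_trans _ _ (\sum_(j < N n) 2 * vdev m (cell (t n) j) f)).
  by apply: ler_sum => j _; apply: cell_defect => //; exact: measurable_cell.
by rewrite -mulr_sumr mulrC -ler_pdivlMr.
Qed.

Let sum_lin K (a b : R) (M v1 d1 v2 d2 : nat -> R) :
  \sum_(j < K) (a * M j + b * (v1 j + d1 j + (v2 j + d2 j))) =
  a * (\sum_(j < K) M j) + b * (\sum_(j < K) v1 j + \sum_(j < K) d1 j +
    (\sum_(j < K) v2 j + \sum_(j < K) d2 j)).
Proof. by rewrite big_split/= -!mulr_sumr !big_split. Qed.

Lemma cell_sim_cvg nu1 nu2 (f1 f2 : mR -> 'rV[R]_d) :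
  vdensity m nu1 f1 -> vdensity m nu2 f2 ->
  (forall x, enorm (f1 x) <= 1) -> (forall x, enorm (f2 x) <= 1) ->
  (fun n => \sum_(j < N n) cell_sim nu1 nu2 (cell (t n) j)) @ \oo -->
  \int[m]_(x in oc01) psim (f1 x) (f2 x).
Proof.
move=> h1 h2 b1 b2; apply/cvgrPdist_le => /= eps eps0.
set M := fine (m oc01); have M0 : 0 <= M by rewrite fine_ge0.
(* The term that does not depend on the grid is [8 e M <= eps / 2]; the four oscillations, each at
   most [k], have weight [2 / e] and give the other [eps / 2]. *)
pose e := eps / (16 * (M + 1)).
have e0 : 0 < e by rewrite divr_gt0// mulr_gt0// ltr_wpDl.
pose k := e * eps / 16; have k0 : 0 < k by rewrite divr_gt0// mulr_gt0.
have Ip := integrable_psim (@measurable_oc01 R) h1.1 h2.1 b1 b2.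
have H1 := vosc_near h1.1 k0; have H2 := vosc_near h2.1 k0.
have H3 := osc_near (integrable_enorm h1.1) k0.
have H4 := osc_near (integrable_enorm h2.1) k0.
apply: filterS (filterI (filterI H1 H3) (filterI H2 H4)) => n [[H1n H3n] [H2n H4n]].
rewrite (Rintegral_cells (gr n) Ip) distrC -sumrB.
rewrite (le_trans (ler_norm_sum _ _ _))//.
apply: (@le_trans _ _ (\sum_(j < N n) (8 * e * fine (m (cell (t n) j)) + 2 / e *
    (vdev m (cell (t n) j) f1 + dev m (cell (t n) j) (fun x => enorm (f1 x)) +
    (vdev m (cell (t n) j) f2 + dev m (cell (t n) j) (fun x => enorm (f2 x))))))).
  by apply: ler_sum => j _; apply: cell_sim_dev => //; exact: measurable_cell.
have := sum_lin (N n) (8 * e) (2 / e) (fun j => fine (m (cell (t n) j)))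
  (fun j => vdev m (cell (t n) j) f1) (fun j => dev m (cell (t n) j) (fun x => enorm (f1 x)))
  (fun j => vdev m (cell (t n) j) f2) (fun j => dev m (cell (t n) j) (fun x => enorm (f2 x))).
cbv beta => ->.
have -> : \sum_(i < N n) fine (m (cell (t n) i)) = M.
  have I1 : m.-integrable oc01 (EFin \o cst 1) by exact: integrable_cst_m.
  have := Rintegral_cells (gr n) I1; rewrite Rintegral_cst// mul1r -/M => ->.
  by apply: eq_bigr => j _; rewrite Rintegral_cst ?mul1r//; exact: measurable_cell.
have b : 8 * e * M <= eps / 2.
  rewrite /e (_ : 8 * _ * M = eps / 2 * (M / (M + 1))); last first.
    by field; rewrite gt_eqF// ltr_wpDl.
  by rewrite ler_piMr ?divr_ge0 ?(ltW eps0)// ler_pdivrMr ?ltr_wpDl// mul1r lerDl.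
have c : 2 / e * (k + k + (k + k)) = eps / 2 by rewrite /k; field; rewrite gt_eqF.
rewrite (splitr eps) lerD// -c; apply: ler_wpM2l; first by rewrite divr_ge0//; exact: ltW.
exact: lerD (lerD H1n H3n) (lerD H2n H4n).
Qed.

End grid_limits.

(** * The upper bound *)

Section young.
Context {R : realType} {d : nat}.
Implicit Types u v : 'rV[R]_d.

Lemma young (p q l : R) : 0 < l -> p * q <= l * p ^+ 2 / 2 + q ^+ 2 / (2 * l).
Proof.
move=> l0; rewrite -subr_ge0 (_ : _ - _ = (l * p - q) ^+ 2 / (2 * l)).
  by rewrite divr_ge0 ?sqr_ge0// mulr_ge0// ltW.
by field; rewrite gt_eqF.
Qed.

(** Apart from the product of roots, the right-hand side is linear in [|u|], [|v|], [phi <a, u>] and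
    [phi <b, v>]: after integration it involves lengths and pairings with a test function, which
    strict convergence controls. *)
Lemma sim_young u v (a b : 'rV[R]_d) (phi l : R) : 0 < l -> 0 <= phi <= 1 ->
  enorm a <= 1 -> enorm b <= 1 ->
  sim u v <= Num.max (edot a b) 0 * (Num.sqrt (enorm u) * Num.sqrt (enorm v)) +
    ((enorm u - phi * edot a u) / l + l * enorm v / 2) +
    ((enorm v - phi * edot b v) / l + l * enorm u / 2).
Proof.
move=> l0 /andP[phi0 phi1] a1 b1.
(* [phi |u|^(1/2) a] approximates [srv u]; the squared error is controlled by the
   defect [|u| - phi <a, u>]. *)
have gap w c : enorm c <= 1 ->
    enorm (srv w - (phi * Num.sqrt (enorm w)) *: c) ^+ 2 <= 2 * (enorm w - phi * edot c w).
  move=> c1; have ww := sqr_sqrtr (enorm_ge0 w).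
  have s0 := sqrtr_ge0 (enorm w); have cc := enorm_ge0 c.
  have ec : edot (srv w) c * Num.sqrt (enorm w) = edot c w.
    rewrite /srv edotZl edotC mulrAC; have [w0|w0] := eqVneq (enorm w) 0.
      move/eqP: w0; rewrite enorm_eq0 => /eqP ->.
      by rewrite edot0r mulr0.
    by rewrite mulVf ?mul1r// sqrtr_eq0 -ltNge lt_def w0 enorm_ge0.
  have es : edot (srv w) (srv w) = enorm w by rewrite -sqr_enorm enorm_srv ww.
  rewrite sqr_enorm; move: (srv w) es ec => z es ec.
  rewrite edotBl !edotBr edotZl !edotZr edotZl es -[edot c c]sqr_enorm.
  rewrite [edot c z]edotC.
  set s := Num.sqrt _ in ww s0 ec *.
  have -> : enorm w - phi * s * edot z c -
      (phi * s * edot z c - phi * s * (phi * s * enorm c ^+ 2)) =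
      enorm w - 2 * (phi * edot c w) + enorm w * (phi * enorm c) ^+ 2.
    by rewrite -ec -{3}ww; ring.
  have pc : (phi * enorm c) ^+ 2 <= 1 by rewrite expr_le1// ?mulr_ile1// mulr_ge0.
  have := ler_wpM2l (enorm_ge0 w) pc; rewrite mulr1.
  lra.
set x := srv u; set y := srv v.
set x' := (phi * Num.sqrt (enorm u)) *: a; set y' := (phi * Num.sqrt (enorm v)) *: b.
have xu : enorm x ^+ 2 = enorm u by rewrite enorm_srv sqr_sqrtr ?enorm_ge0.
have yv : enorm y ^+ 2 = enorm v by rewrite enorm_srv sqr_sqrtr ?enorm_ge0.
have x'x : enorm x' <= enorm x.
  rewrite enormZ enorm_srv ger0_norm ?mulr_ge0 ?sqrtr_ge0// mulrAC ler_piMl ?sqrtr_ge0//.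
  by rewrite mulr_ile1 ?enorm_ge0.
have -> : sim u v = edot (x - x') y + edot x' (y - y') + edot x' y'.
  by rewrite edotBl edotBr addrA subrK subrK.
have li0 : 0 < l^-1 by rewrite invr_gt0.
have yg (p q P Q : R) : p ^+ 2 <= 2 * P -> q ^+ 2 <= Q -> p * q <= P / l + l * Q / 2.
  move=> pP qQ; apply: (le_trans (young p q li0)); rewrite lerD//.
    by rewrite (mulrC P) -mulrA ler_wpM2l ?(ltW li0)// ler_pdivrMr// mulrC.
  have -> : l * Q / 2 = Q / (2 / l) by field; rewrite gt_eqF.
  by rewrite ler_wpM2r// invr_ge0 divr_ge0// ltW.
have H1 : edot (x - x') y <= (enorm u - phi * edot a u) / l + l * enorm v / 2.
  rewrite (le_trans (edot_le _ _))// yg//; first exact: gap.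
  by rewrite yv.
have H2 : edot x' (y - y') <= (enorm v - phi * edot b v) / l + l * enorm u / 2.
  rewrite (le_trans (edot_le _ _))// mulrC yg//; first exact: gap.
  by rewrite -xu ler_pXn2r// nnegrE enorm_ge0.
have H3 : edot x' y' <=
    Num.max (edot a b) 0 * (Num.sqrt (enorm u) * Num.sqrt (enorm v)).
  rewrite edotZl edotZr.
  have -> : phi * Num.sqrt (enorm u) * (phi * Num.sqrt (enorm v) * edot a b) =
    (phi * phi * edot a b) * (Num.sqrt (enorm u) * Num.sqrt (enorm v)) by ring.
  rewrite ler_wpM2r ?mulr_ge0 ?sqrtr_ge0// (@le_trans _ _ (phi * phi * Num.max (edot a b) 0))//.
    by rewrite ler_wpM2l ?mulr_ge0// le_max lexx.
  by rewrite ler_piMl ?le_max ?lexx ?orbT// mulr_ile1.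
lra.
Qed.

(** Here [N_i] will be the mass of an approximating curve on a cell and [n_i] that of the limit.
    Roots are subadditive, and Young's inequality splits the cross terms with [sqrt E_i]. *)
Lemma sqrt_perturb (N1 N2 n1 n2 E1 E2 l : R) : 0 < l ->
  0 <= N1 -> 0 <= N2 -> 0 <= n1 -> 0 <= n2 -> 0 <= E1 -> 0 <= E2 ->
  N1 <= n1 + E1 -> N2 <= n2 + E2 ->
  Num.sqrt N1 * Num.sqrt N2 <=
  Num.sqrt n1 * Num.sqrt n2 + (l * n1 / 2 + l * N2 / 2 + (E1 + E2) / (2 * l)).
Proof.
move=> l0 N10 N20 n10 n20 E10 E20 h1 h2.
have sub (a b c : R) : 0 <= a -> 0 <= b -> 0 <= c -> a <= b + c ->
    Num.sqrt a <= Num.sqrt b + Num.sqrt c.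
  move=> a0 b0 c0 abc; rewrite -(@ler_pXn2r _ 2)// ?nnegrE ?addr_ge0 ?sqrtr_ge0//.
  rewrite sqr_sqrtr// sqrrD !sqr_sqrtr// (le_trans abc)// lerD2r lerDl.
  by rewrite mulrn_wge0// mulr_ge0 ?sqrtr_ge0.
have {}h1 := sub _ _ _ N10 n10 E10 h1; have {}h2 := sub _ _ _ N20 n20 E20 h2.
have := young (Num.sqrt n1) (Num.sqrt E2) l0.
have := young (Num.sqrt N2) (Num.sqrt E1) l0.
rewrite !sqr_sqrtr// => y1 y2.
have a1 : Num.sqrt N1 * Num.sqrt N2 <= (Num.sqrt n1 + Num.sqrt E1) * Num.sqrt N2.
  by rewrite ler_wpM2r ?sqrtr_ge0.
have a2 : Num.sqrt n1 * Num.sqrt N2 <= Num.sqrt n1 * (Num.sqrt n2 + Num.sqrt E2).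
  by rewrite ler_wpM2l ?sqrtr_ge0.
have : (E1 + E2) / (2 * l) = E1 / (2 * l) + E2 / (2 * l) by rewrite mulrDl.
move: a1 a2 y1 y2; rewrite mulrDl mulrDr [Num.sqrt N2 * Num.sqrt E1]mulrC; lra.
Qed.

End young.

Section cell_upper_bound.
Context {R : realType} {disp : measure_display} {T : measurableType disp} {d : nat}.
Variable mu : {measure set T -> \bar R}.
Implicit Types (f g : T -> 'rV[R]_d) (A : set T).

Lemma integrable_sqrt g1 g2 : vintegrable mu g1 -> vintegrable mu g2 ->
  mu.-integrable setT (EFin \o (fun x => Num.sqrt (enorm (g1 x)) * Num.sqrt (enorm (g2 x)))).
Proof.
move=> I1 I2.
have ms g : vintegrable mu g -> measurable_fun setT (fun x => Num.sqrt (enorm (g x))).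
  move=> Ig; apply: measurableT_comp (continuous_measurable_fun (@sqrt_continuous R)) _.
  exact: measurable_enorm (vintegrable_measurable Ig).
apply: (@le_integrableR _ _ _ mu _ _ (fun x => enorm (g1 x) + enorm (g2 x))) => //.
- by apply: measurable_funM; exact: ms.
- move=> x _; rewrite !ger0_norm ?mulr_ge0 ?addr_ge0 ?sqrtr_ge0 ?enorm_ge0//.
  have := young (Num.sqrt (enorm (g1 x))) (Num.sqrt (enorm (g2 x))) (ltr01 : 0 < 1).
  rewrite !sqr_sqrtr ?enorm_ge0//.
  have := enorm_ge0 (g1 x); have := enorm_ge0 (g2 x); lra.
- by have := integrableD measurableT (integrable_enorm I1) (integrable_enorm I2).
Qed.

(** Obtained by integrating [young] and optimizing over [l]. The optimum [sqrt b / sqrt a] makes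
    sense if neither integral vanishes; otherwise a suitable [l] contradicts [0 < X]. *)
Lemma cauchy_schwarz_sqrt g1 g2 A : measurable A -> vintegrable mu g1 -> vintegrable mu g2 ->
  \int[mu]_(x in A) (Num.sqrt (enorm (g1 x)) * Num.sqrt (enorm (g2 x))) <=
  Num.sqrt (\int[mu]_(x in A) enorm (g1 x)) * Num.sqrt (\int[mu]_(x in A) enorm (g2 x)).
Proof.
move=> mA I1 I2.
have I1A : mu.-integrable A (EFin \o (fun x => enorm (g1 x))).
  exact: integrableS (integrable_enorm I1).
have I2A : mu.-integrable A (EFin \o (fun x => enorm (g2 x))).
  exact: integrableS (integrable_enorm I2).
have IsA : mu.-integrable A (EFin \o (fun x => Num.sqrt (enorm (g1 x)) * Num.sqrt (enorm (g2 x)))).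
  exact: integrableS (integrable_sqrt I1 I2).
set X := \int[mu]_(x in A) _.
set a := \int[mu]_(x in A) enorm (g1 x); set b := \int[mu]_(x in A) enorm (g2 x).
have a0 : 0 <= a by apply: Rintegral_ge0 => x _; exact: enorm_ge0.
have b0 : 0 <= b by apply: Rintegral_ge0 => x _; exact: enorm_ge0.
have key l : 0 < l -> X <= l * a / 2 + b / (2 * l).
  move=> l0; have -> : l * a / 2 + b / (2 * l) =
      \int[mu]_(x in A) (l / 2 * enorm (g1 x) + (2 * l)^-1 * enorm (g2 x)).
    rewrite RintegralD//; last 2 first.
    - by have := integrableZl mA (l / 2) I1A.
    - by have := integrableZl mA (2 * l)^-1 I2A.
    by rewrite !RintegralZl// -/a -/b mulrAC [b / _]mulrC.
  apply: le_Rintegral => //.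
    by have := integrableD mA (integrableZl mA (l / 2) I1A) (integrableZl mA (2 * l)^-1 I2A).
  move=> x _; rewrite (le_trans (young _ _ l0))// !sqr_sqrtr ?enorm_ge0//.
  by rewrite mulrAC [_^-1 * _]mulrC.
have [a00|aN0] := eqVneq a 0.
  rewrite a00 sqrtr0 mul0r leNgt; apply/negP => X0.
  have l0 : 0 < (b + 1) / X by rewrite divr_gt0// ltr_wpDl.
  have := key _ l0; rewrite a00 mulr0 mul0r add0r.
  have -> : b / (2 * ((b + 1) / X)) = X * (b / (2 * (b + 1))).
    by field; rewrite !gt_eqF// ltr_wpDl.
  rewrite ler_pMr// leNgt ltr_pdivrMr ?mulr_gt0 ?ltr_wpDl//.
  by apply/negP/negPn; lra.
have [b00|bN0] := eqVneq b 0.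
  rewrite b00 sqrtr0 mulr0 leNgt; apply/negP => X0.
  have l0 : 0 < X / (a + 1) by rewrite divr_gt0// ltr_wpDl.
  have := key _ l0; rewrite b00 mul0r addr0.
  have -> : X / (a + 1) * a / 2 = X * (a / (2 * (a + 1))).
    by field; rewrite !gt_eqF// ltr_wpDl.
  rewrite ler_pMr// leNgt ltr_pdivrMr ?mulr_gt0 ?ltr_wpDl//.
  by apply/negP/negPn; lra.
have ap : 0 < Num.sqrt a by rewrite sqrtr_gt0 lt_def aN0.
have bp : 0 < Num.sqrt b by rewrite sqrtr_gt0 lt_def bN0.
apply: (le_trans (key (Num.sqrt b / Num.sqrt a) (divr_gt0 bp ap))).
move: ap bp (sqr_sqrtr a0) (sqr_sqrtr b0); move: (Num.sqrt a) (Num.sqrt b) => p q p0 q0 <- <-.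
rewrite le_eqVlt; apply/orP; left; apply/eqP.
by field; rewrite !gt_eqF.
Qed.

Lemma integrable_sim g1 g2 A : measurable A -> vintegrable mu g1 -> vintegrable mu g2 ->
  mu.-integrable A (EFin \o (fun x => sim (g1 x) (g2 x))).
Proof.
move=> mA I1 I2; apply: (@integrableS _ _ _ _ setT) => //.
apply: (@le_integrableR _ _ _ mu _ _ (fun x => enorm (g1 x) + enorm (g2 x))) => //.
- by apply: measurable_sim; exact: vintegrable_measurable.
- move=> x _; rewrite (le_trans (normr_sim_le _ _))// ger0_norm ?addr_ge0 ?enorm_ge0//.
  have := enorm_ge0 (g1 x); have := enorm_ge0 (g2 x); lra.
- by have := integrableD measurableT (integrable_enorm I1) (integrable_enorm I2).
Qed.

(** The data [a], [b] and [n_i] come from the limit curves and [g_i] from the approximating ones.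
    [D_i] is the directional defect and [E_i] bounds the excess of mass over the limit. [sim_young]
    is integrated, then the product of roots goes through Cauchy-Schwarz and [sqrt_perturb]. *)
Lemma cell_upper_bound g1 g2 A (a b : 'rV[R]_d) (phi : T -> R) (l n1 n2 E1 E2 : R) :
  measurable A -> vintegrable mu g1 -> vintegrable mu g2 ->
  measurable_fun setT phi -> (forall x, 0 <= phi x <= 1) ->
  enorm a <= 1 -> enorm b <= 1 -> 0 < l ->
  let N1 := \int[mu]_(x in A) enorm (g1 x) in
  let N2 := \int[mu]_(x in A) enorm (g2 x) in
  let D1 := N1 - \int[mu]_(x in A) (phi x * edot a (g1 x)) in
  let D2 := N2 - \int[mu]_(x in A) (phi x * edot b (g2 x)) in
  0 <= n1 -> 0 <= n2 -> 0 <= E1 -> 0 <= E2 -> N1 <= n1 + E1 -> N2 <= n2 + E2 ->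
  \int[mu]_(x in A) sim (g1 x) (g2 x) <=
  Num.max (edot a b) 0 * (Num.sqrt n1 * Num.sqrt n2) +
  (l * n1 / 2 + l * N2 / 2 + (E1 + E2) / (2 * l)) +
  (D1 / l + l * N2 / 2 + (D2 / l + l * N1 / 2)).
Proof.
move=> mA I1 I2 mphi phi01 a1 b1 l0 N1 N2 D1 D2 n10 n20 E10 E20 NE1 NE2.
have I1A : mu.-integrable A (EFin \o (fun x => enorm (g1 x))).
  exact: integrableS (integrable_enorm I1).
have I2A : mu.-integrable A (EFin \o (fun x => enorm (g2 x))).
  exact: integrableS (integrable_enorm I2).
have IsA : mu.-integrable A (EFin \o (fun x => Num.sqrt (enorm (g1 x)) * Num.sqrt (enorm (g2 x)))).
  exact: integrableS (integrable_sqrt I1 I2).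
have Iphi g c : vintegrable mu g -> mu.-integrable A (EFin \o (fun x => phi x * edot c (g x))).
  move=> Ig; apply: (@integrableS _ _ _ _ setT) => //.
  apply: (@le_integrableR _ _ _ mu _ _ (fun x => edot c (g x))) => //.
  - apply: measurable_funM => //; apply: measurable_edot; first exact: vmeasurable_cst.
    exact: vintegrable_measurable.
  - by move=> x _; have /andP[p0 p1] := phi01 x; rewrite normrM ger0_norm// ler_piMl.
  - exact: integrable_edot.
set B := Num.max (edot a b) 0.
have B0 : 0 <= B by rewrite le_max lexx orbT.
have B1 : B <= 1.
  by rewrite ge_max ler01 andbT (le_trans (edot_le _ _))// mulr_ile1 ?enorm_ge0.
pose F1 x := B * (Num.sqrt (enorm (g1 x)) * Num.sqrt (enorm (g2 x))).
pose G (g g' : T -> 'rV[R]_d) c x := l^-1 * (enorm (g x) - phi x * edot c (g x)) + l / 2 * enorm (g' x).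
have IF : mu.-integrable A (EFin \o F1) by have := integrableZl mA B IsA.
have Isub g c : mu.-integrable A (EFin \o (fun x => enorm (g x))) -> vintegrable mu g ->
    mu.-integrable A (EFin \o (fun x => enorm (g x) - phi x * edot c (g x))).
  by move=> Ie Ig; have := integrableB mA Ie (Iphi g c Ig).
have IG g g' c : vintegrable mu g -> mu.-integrable A (EFin \o (fun x => enorm (g x))) ->
    mu.-integrable A (EFin \o (fun x => enorm (g' x))) -> mu.-integrable A (EFin \o G g g' c).
  move=> Ig Ie Ie'.
  by have := integrableD mA (integrableZl mA l^-1 (Isub g c Ie Ig)) (integrableZl mA (l / 2) Ie').
have EG g g' c : vintegrable mu g -> mu.-integrable A (EFin \o (fun x => enorm (g x))) ->
    mu.-integrable A (EFin \o (fun x => enorm (g' x))) -> \int[mu]_(x in A) G g g' c x =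
    (\int[mu]_(x in A) enorm (g x) - \int[mu]_(x in A) (phi x * edot c (g x))) / l +
    l * (\int[mu]_(x in A) enorm (g' x)) / 2.
  move=> Ig Ie Ie'; rewrite /G RintegralD//; last 2 first.
  - by have := integrableZl mA l^-1 (Isub g c Ie Ig).
  - by have := integrableZl mA (l / 2) Ie'.
  rewrite !RintegralZl//; last exact: Isub.
  rewrite RintegralB//; last exact: Iphi.
  by rewrite mulrC mulrAC.
apply: (@le_trans _ _ (\int[mu]_(x in A) (F1 x + (G g1 g2 a x + G g2 g1 b x)))).
  apply: le_Rintegral => //.
  - exact: integrable_sim.
  - by have := integrableD mA IF (integrableD mA (IG g1 g2 a I1 I1A I2A) (IG g2 g1 b I2 I2A I1A)).
  - move=> x _; rewrite (le_trans (sim_young _ _ l0 (phi01 x) a1 b1))// /F1 /G.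
    rewrite -/B le_eqVlt; apply/orP; left; apply/eqP.
    by field; rewrite gt_eqF.
rewrite RintegralD//; last first.
  by have := integrableD mA (IG g1 g2 a I1 I1A I2A) (IG g2 g1 b I2 I2A I1A).
rewrite RintegralD//; [|exact: IG|exact: IG].
rewrite !EG// lerD2r /F1 RintegralZl//.
have N10 : 0 <= N1 by apply: Rintegral_ge0 => x _; exact: enorm_ge0.
have N20 : 0 <= N2 by apply: Rintegral_ge0 => x _; exact: enorm_ge0.
apply: (@le_trans _ _ (B * (Num.sqrt N1 * Num.sqrt N2))).
  by rewrite ler_wpM2l// cauchy_schwarz_sqrt.
apply: (@le_trans _ _ (B * (Num.sqrt n1 * Num.sqrt n2 +
    (l * n1 / 2 + l * N2 / 2 + (E1 + E2) / (2 * l))))).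
  by rewrite ler_wpM2l// sqrt_perturb.
rewrite mulrDr lerD2l ler_piMl// !addr_ge0// ?divr_ge0 ?mulr_ge0 ?addr_ge0 ?(ltW l0)//.
Qed.

End cell_upper_bound.

Section weak_convergence.
Context {R : realType} {d : nat}.
Local Notation mR := (measurableTypeR R).
Local Notation leb := (@lebesgue_measure R).
Implicit Types (c : R -> 'rV[R]_d) (phi : R -> R).

Let mI : measurable (unit_itv : set mR). Proof. exact: measurable_itv. Qed.

Lemma test_pairing c (m : {sigma_finite_measure set mR -> \bar R}) (f : mR -> 'rV[R]_d) phi i :
  BV c -> vdensity m (Dcurve c) f -> test_function phi ->
  \int[m]_x (phi x * f x 0 i) = - \int[leb]_(x in unit_itv) (c x 0 i * derive1 phi x).
Proof.
move=> hc [If hf] tphi; have [_ /(_ i phi tphi) h] := Dcurve_distr hc.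
rewrite /Rintegral h (@charge_integral_density _ m _ (fun x => f x 0 i))//.
- by rewrite fineN opprK.
- exact: If.
- by move=> A mA; exact: hf.
- exact: measurable_test.
- exact: test_bounded.
Qed.

Lemma integrable_enorm_sub c u : BV c -> BV u ->
  leb.-integrable unit_itv (EFin \o (fun x => enorm (u x - c x))).
Proof.
move=> [Ic _] [Iu _].
have Ii i : leb.-integrable unit_itv (EFin \o (fun x => (u x - c x) 0 i)).
  have := integrableB mI (Iu i) (Ic i).
  by apply: eq_integrable => // x _ /=; rewrite !mxE.
have [Is _] := @Rintegral_sum_ord R _ mR leb _ _ (index_enum 'I_d)
  (fun i x => `|(u x - c x) 0 i|) mI (fun i => integrable_norm (Ii i)).
apply: le_integrableR Is => //.
  apply: measurableT_comp (continuous_measurable_fun (@sqrt_continuous R)) _.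
  have mi i : measurable_fun (unit_itv : set mR) (fun x => (u x - c x) 0 i).
    by apply/measurable_EFinP; exact: measurable_int (Ii i).
  by apply: measurable_sum => i; exact: measurable_funM.
move=> x _; rewrite ger0_norm ?enorm_ge0// ger0_norm ?enorm_le_sum//.
by apply: sumr_ge0.
Qed.

(** By the definition of the distributional derivative, the pairing is minus the integral of the
    curve against [phi'], which is bounded; convergence in [L^1] passes to the limit. *)
Lemma weak_cvg c (u : nat -> R -> 'rV[R]_d) (m : {sigma_finite_measure set mR -> \bar R})
    (f : mR -> 'rV[R]_d) (g : nat -> mR -> 'rV[R]_d) phi i :
  strict_cvg u c -> vdensity m (Dcurve c) f ->
  (forall k, vdensity leb (Dcurve (u k)) (g k)) -> test_function phi ->
  (fun k => \int[leb]_x (phi x * g k x 0 i)) @ \oo --> \int[m]_x (phi x * f x 0 i).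
Proof.
move=> [hu hc u1 _] hf hg tphi; have [M hM] := test_derive_bounded tphi.
have M0 : 0 <= M by exact: le_trans (normr_ge0 _) (hM 0).
have := u1; rewrite -[X in _ --> X]/(0%:E) => /fine_cvgP[_ u1'].
apply/cvgrPdist_le => /= e e0.
have e1 : 0 < e / (M + 1) by rewrite divr_gt0// ltr_wpDl.
move/cvgrPdist_le : u1' => /(_ _ e1) /=; apply: filterS => k.
rewrite sub0r normrN (test_pairing i hc hf tphi) (@test_pairing _ leb _ _ i (hu k) (hg k) tphi).
rewrite opprK [- _ + _]addrC => hk.
have Id w (hw : BV w) := integrable_mul_test_derive tphi (hw.1 i).
rewrite -RintegralB//; [|exact: Id|exact: Id].
set F := (F in \int[leb]_(x in unit_itv) F x).
have IF : leb.-integrable unit_itv (EFin \o F).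
  by have := integrableB mI (Id _ (hu k)) (Id _ hc).
rewrite (le_trans (le_normr_Rintegral mI IF))//.
have Ie := integrable_enorm_sub hc (hu k).
apply: (@le_trans _ _ (\int[leb]_(x in unit_itv) (M * enorm (u k x - c x)))).
  apply: le_Rintegral => //.
  - by have := integrable_norm IF.
  - by have := integrableZl mI M Ie.
  move=> x _; rewrite /F -mulrBl normrM mulrC ler_pM//.
  by have := enorm_coord (u k x - c x) i; rewrite !mxE.
rewrite RintegralZl// (le_trans (ler_wpM2l M0 (le_trans (ler_norm _) hk)))//.
by rewrite mulrCA ler_piMr ?(ltW e0)// ler_pdivrMr ?ltr_wpDl// mul1r lerDl.
Qed.

Lemma Rintegral_test_edot (m : {measure set mR -> \bar R}) (f : mR -> 'rV[R]_d) phi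
    (q : 'rV[R]_d) : vintegrable m f -> test_function phi ->
  \int[m]_x (phi x * edot q (f x)) = \sum_(i < d) q 0 i * \int[m]_x (phi x * f x 0 i).
Proof.
move=> If tphi.
have Ii i := integrable_testM tphi (If i).
have Ii' i : m.-integrable setT (EFin \o (fun x => q 0 i * (phi x * f x 0 i))).
  by have := integrableZl measurableT (q 0 i) (Ii i).
have [_ Es] := Rintegral_sum_ord (index_enum 'I_d) measurableT Ii'.
rewrite (eq_bigr (fun i => \int[m]_x (q 0 i * (phi x * f x 0 i)))).
  rewrite -Es; apply: eq_Rintegral => x _; rewrite /edot mulr_sumr.
  by apply: eq_bigr => i _; rewrite mulrCA.
by move=> i _; rewrite RintegralZl.
Qed.

Lemma weak_cvg_edot c (u : nat -> R -> 'rV[R]_d) (m : {sigma_finite_measure set mR -> \bar R})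
    (f : mR -> 'rV[R]_d) (g : nat -> mR -> 'rV[R]_d) phi q :
  strict_cvg u c -> vdensity m (Dcurve c) f ->
  (forall k, vdensity leb (Dcurve (u k)) (g k)) -> test_function phi ->
  (fun k => \int[leb]_x (phi x * edot q (g k x))) @ \oo --> \int[m]_x (phi x * edot q (f x)).
Proof.
move=> hu hf hg tphi; rewrite (Rintegral_test_edot q hf.1 tphi).
rewrite (_ : (fun k => _) =
    (fun k => \sum_(i < d) q 0 i * \int[leb]_x (phi x * g k x 0 i))); last first.
  by apply/funext => k; exact: Rintegral_test_edot (hg k).1 tphi.
apply: cvg_big => [|i _]; first exact: add_continuous.
apply: cvgM; first exact: cvg_cst.
exact: weak_cvg hu hf hg tphi.
Qed.

End weak_convergence.

Section grid_upper_bound.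
Context {R : realType} {d : nat}.
Local Notation mR := (measurableTypeR R).
Local Notation leb := (@lebesgue_measure R).
Implicit Types (c : R -> 'rV[R]_d).

(** The mean of the polar density over [A] with respect to [|nu|]: a vector of norm at most 1, and
    in general not a unit vector. *)
Definition polar_cell (nu : 'I_d -> {charge set mR -> \bar R}) A : 'rV[R]_d :=
  (fine (tvar nu A))^-1 *: vmeas nu A.

Lemma enorm_polar_cell nu (A : set mR) : measurable A -> enorm (polar_cell nu A) <= 1.
Proof.
move=> mA; rewrite /polar_cell enormZ ger0_norm ?invr_ge0 ?fine_ge0//.
have [->|n0] := eqVneq (fine (tvar nu A)) 0; first by rewrite invr0 mul0r.
by rewrite mulrC ler_pdivrMr ?lt_def ?n0 ?fine_ge0// mul1r enorm_vmeas_le.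
Qed.

Lemma cell_simE nu1 nu2 (A : set mR) :
  Num.max (edot (polar_cell nu1 A) (polar_cell nu2 A)) 0 *
  (Num.sqrt (fine (tvar nu1 A)) * Num.sqrt (fine (tvar nu2 A))) = cell_sim nu1 nu2 A.
Proof.
rewrite /cell_sim maxr_pMl ?mulr_ge0 ?sqrtr_ge0// mul0r; congr Num.max.
have h nu : Num.sqrt (fine (tvar nu A)) *: polar_cell nu A =
    (Num.sqrt (fine (tvar nu A)))^-1 *: vmeas nu A.
  rewrite /polar_cell scalerA; congr (_ *: _).
  have n0 : 0 <= fine (tvar nu A) by rewrite fine_ge0.
  rewrite -{2}(sqr_sqrtr n0); move: (Num.sqrt _) => s.
  have [->|s0] := eqVneq s 0; first by rewrite mul0r invr0.
  by rewrite expr2 invfM mulrA mulfV ?mul1r.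
rewrite -(h nu1) -(h nu2); move: (polar_cell nu1 A) (polar_cell nu2 A) => x y.
by rewrite edotZl edotZr mulrC mulrA.
Qed.

(** One function has to serve both curves, because [sim_young] uses a single [phi]; hence the two
    estimates at once. The bumps tend to the indicator of the open cell, and [b] carries no mass. *)
Lemma exists_cell_test (m : {finite_measure set mR -> \bar R}) (f1 f2 : mR -> 'rV[R]_d)
    (q1 q2 : 'rV[R]_d) (a b e : R) : vintegrable m f1 -> vintegrable m f2 ->
  0 <= a -> b <= 1 -> m [set b] = 0%E -> 0 < e ->
  exists phi, [/\ test_function phi, forall x, 0 <= phi x <= 1,
    forall x, ~ (a < x < b) -> phi x = 0,
    `|\int[m]_x (phi x * edot q1 (f1 x)) -
      \int[m]_(x in ([set` `]a, b]] : set mR)) edot q1 (f1 x)| <= e &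
    `|\int[m]_x (phi x * edot q2 (f2 x)) -
      \int[m]_(x in ([set` `]a, b]] : set mR)) edot q2 (f2 x)| <= e].
Proof.
move=> I1 I2 a0 b1 mb e0; have [phi [tphi phi01 phi0 phi1]] := bump_sequence a0 b1.
have key (f : mR -> 'rV[R]_d) (q : 'rV[R]_d) : vintegrable m f -> \forall n \near \oo,
    `|\int[m]_x (phi n x * edot q (f x)) -
      \int[m]_(x in ([set` `]a, b]] : set mR)) edot q (f x)| <= e.
  move=> If; have := bump_sequence_cvg tphi phi01 phi0 phi1 (integrable_edot q If).
  have -> : \int[m]_(x in ([set` `]a, b[] : set mR)) edot q (f x) =
      \int[m]_(x in ([set` `]a, b]] : set mR)) edot q (f x).
    rewrite [LHS]Rintegral_mkcond [RHS]Rintegral_mkcond /Rintegral; congr fine.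
    apply: (@eq_integral_off_null _ _ _ m [set b]) => // x _ xb.
    have {}xb : x != b by apply/eqP => xb'; apply: xb.
    congr EFin; rewrite !patchE; congr (if _ then _ else _).
    by apply/idP/idP;
      move=> /set_mem/=; rewrite in_itv/= => /andP[h1 h2]; apply/mem_set;
      rewrite /= in_itv/= h1 ?(ltW h2)// lt_neqAle xb.
  by move=> /cvgrPdist_le /(_ _ e0); apply: filterS => n; rewrite distrC.
have [n [h1 h2]] := filter_ex (filterI (key f1 q1 I1) (key f2 q2 I2)).
exists (phi n); split; [exact: tphi|exact: phi01| |exact: h1|exact: h2].
by move=> x; exact: phi0.
Qed.

Lemma integral_oc_oo (f : mR -> \bar R) :
  (\int[leb]_(x in oo01) f x = \int[leb]_(x in oc01) f x)%E.
Proof.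
rewrite [LHS]integral_mkcond [RHS]integral_mkcond.
apply: (@eq_integral_off_null _ _ _ leb [set 1]) => //.
  exact: lebesgue_measure_set1.
move=> x _ x1; have {}x1 : x != 1 by apply/eqP => x1'; apply: x1.
rewrite !patchE; congr (if _ then _ else _).
by apply/idP/idP; rewrite /oo01 /oc01 => /set_mem/=; rewrite in_itv/= => /andP[h1 h2];
  apply/mem_set; rewrite /= in_itv/= h1 ?(ltW h2)// lt_neqAle x1.
Qed.

Lemma len_oc c : BV c -> len c = tvar (Dcurve c) oc01.
Proof.
move=> hc; have mI : measurable (unit_itv : set mR) by exact: measurable_itv.
have conc := Dcurve_conc hc; rewrite /len (tvar_conc conc)//.
rewrite [RHS](tvar_conc conc)//; congr (tvar _ _); apply/seteqP; split => x [+ h]; split => //;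
  move: h; rewrite /oo01 /oc01 /unit_itv /= !in_itv/= => /andP[h1 h2].
  by rewrite h1 ltW.
by rewrite !ltW.
Qed.

Lemma len_fin c : BV c -> len c \is a fin_num.
Proof. by move=> hc; apply: tvar_fin; exact: measurable_itv. Qed.

Lemma len_cells c (m : {sigma_finite_measure set mR -> \bar R}) (f : mR -> 'rV[R]_d) N t e :
  BV c -> vdensity m (Dcurve c) f -> grid N t e ->
  \sum_(j < N) \int[m]_(x in cell t j) enorm (f x) = fine (len c).
Proof.
move=> hc hf g; rewrite -(Rintegral_cells g).
  by rewrite len_oc// (tvar_density _ hf).
exact: integrableS (integrable_enorm hf.1).
Qed.

Lemma strict_cvg_len (u : nat -> R -> 'rV[R]_d) c e : strict_cvg u c -> 0 < e ->
  \forall k \near \oo, fine (len (u k)) <= fine (len c) + e.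
Proof.
move=> [hu hc _]; rewrite -[X in _ --> X](fineK (len_fin hc)) => /fine_cvgP[_].
move=> /cvgrPdist_le h /h; apply: filterS => k /=.
by rewrite distrC => /(le_trans (ler_norm _)); rewrite lerBlDl.
Qed.

Let sum_bound K (l : R) (cs n1 N1 N2 E1 E2 : nat -> R) :
  \sum_(j < K) (cs j + (l / 2 * n1 j + l * N2 j + l / 2 * N1 j + 3 / (2 * l) * (E1 j + E2 j))) =
  \sum_(j < K) cs j + (l / 2 * (\sum_(j < K) n1 j) + l * (\sum_(j < K) N2 j) +
    l / 2 * (\sum_(j < K) N1 j) + 3 / (2 * l) * (\sum_(j < K) E1 j + \sum_(j < K) E2 j)).
Proof. by rewrite !big_split/= -!mulr_sumr big_split. Qed.

(* The loss of mass of the weak limit on a cell is a nonnegative defect, so that only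
   the total length has to converge. *)
Let sum_defect K (l L eta ek : R) (N P p al n : nat -> R) :
  \sum_(j < K) N j = l -> l <= L + eta -> \sum_(j < K) n j = L ->
  \sum_(j < K) (n j - al j) <= eta -> 0 <= eta -> ek = eta / K.+1%:R ->
  (forall j, (j < K)%N -> `|p j - al j| <= ek /\ `|p j - P j| <= ek) ->
  \sum_(j < K) (N j - P j + 2 * ek) <= 6 * eta.
Proof.
move=> Nl lL nL; rewrite sumrB nL => al_eta eta0 ekE h.
have hP : \sum_(j < K) al j <= \sum_(j < K) (P j + 2 * ek).
  apply: ler_sum => j _; have [] := h j (ltn_ord j).
  rewrite !ler_norml; lra.
have hk : \sum_(j < K) 2 * ek <= 2 * eta.
  rewrite sumr_const card_ord -[leLHS]mulr_natr -mulrA ler_pM2l// ekE.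
  by rewrite mulrAC -mulrA ler_piMr// ler_pdivrMr// mul1r ler_nat.
move: hP; rewrite !big_split/= sumrN Nl; lra.
Qed.

Let cell_mass (N P p al n ek : R) : `|p - al| <= ek -> `|p - P| <= ek -> al <= n ->
  N <= n + (N - P + 2 * ek).
Proof. by rewrite !ler_norml => /andP[? ?] /andP[? ?] ?; lra. Qed.

Let cell_arith (l cs n1 N1 N2 D1 D2 E1 E2 : R) : 0 < l -> D1 <= E1 -> D2 <= E2 ->
  cs + (l * n1 / 2 + l * N2 / 2 + (E1 + E2) / (2 * l)) +
    (D1 / l + l * N2 / 2 + (D2 / l + l * N1 / 2)) <=
  cs + (l / 2 * n1 + l * N2 + l / 2 * N1 + 3 / (2 * l) * (E1 + E2)).
Proof.
move=> l0 h1 h2.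
have -> : 3 / (2 * l) * (E1 + E2) = (E1 + E2) / (2 * l) + E1 / l + E2 / l.
  by field; rewrite gt_eqF.
have : D1 / l <= E1 / l by rewrite ler_pM2r ?invr_gt0.
have : D2 / l <= E2 / l by rewrite ler_pM2r ?invr_gt0.
lra.
Qed.

(** The budget: the terms with lengths are at most [l B = e / 4], where [eta <= 1] bounds the
    lengths of the approximating curves; the errors give at most [3 / (2 l) * 12 eta <= e / 4],
    which explains the 72; the grid takes another [e / 4]. *)
Let total_arith (e B l eta L1 L2 I T N1 N2 E1 E2 : R) : 0 < e -> 0 < B ->
  B = L1 + L2 + 2 -> l = e / (4 * B) -> eta = Num.min 1 (e * l / 72) ->
  E1 <= 6 * eta -> E2 <= 6 * eta -> N1 <= L1 + eta -> N2 <= L2 + eta ->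
  T <= I + e / 4 ->
  T + (l / 2 * L1 + l * N2 + l / 2 * N1 + 3 / (2 * l) * (E1 + E2)) <= I + e.
Proof.
move=> e0 B0 BE lE etaE hE1 hE2 hN1 hN2 hT.
have l0 : 0 < l by rewrite lE divr_gt0// mulr_gt0.
have eta1 : eta <= 1 by rewrite etaE ge_min lexx.
have etae : eta <= e * l / 72 by rewrite etaE ge_min lexx orbT.
have lB : l * B = e / 4 by rewrite lE; field; rewrite gt_eqF.
have HE : 3 / (2 * l) * (E1 + E2) <= e / 4.
  apply: (@le_trans _ _ (3 / (2 * l) * (12 * (e * l / 72)))).
    by rewrite ler_wpM2l ?divr_ge0 ?mulr_ge0 ?(ltW l0)//; lra.
  by rewrite le_eqVlt; apply/orP; left; apply/eqP; field; rewrite gt_eqF.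
have q1 : l / 2 * N1 <= l / 2 * (L1 + 1) by rewrite ler_wpM2l ?divr_ge0 ?(ltW l0)//; lra.
have q2 : l * N2 <= l * (L2 + 1) by rewrite ler_wpM2l ?(ltW l0)//; lra.
have : l / 2 * L1 + l * (L2 + 1) + l / 2 * (L1 + 1) = l * B - l / 2.
  by rewrite BE; field.
lra.
Qed.

(** Once the grid is fixed, finitely many cells and test functions remain, so all the weak
    convergences are eventually accurate to [ek] at the same time, and an error [ek] per cell sums
    to at most [eta]. *)
Lemma similarity_near c1 c2 (u1 u2 : nat -> R -> 'rV[R]_d)
    (m : {finite_measure set mR -> \bar R}) (f1 f2 : mR -> 'rV[R]_d) (e : R) :
  (forall k, abs_continuous (u1 k) /\ abs_continuous (u2 k)) ->
  strict_cvg u1 c1 -> strict_cvg u2 c2 -> m [set 1] = 0%E ->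
  vdensity m (Dcurve c1) f1 -> vdensity m (Dcurve c2) f2 ->
  (forall x, enorm (f1 x) <= 1) -> (forall x, enorm (f2 x) <= 1) -> 0 < e ->
  \forall k \near \oo, (similarity (u1 k) (u2 k) <=
    (\int[m]_(x in oc01) psim (f1 x) (f2 x) + e)%:E)%E.
Proof.
move=> ac s1 s2 m1 h1 h2 b1 b2 e0.
have [hu1 hc1 _ _] := s1; have [hu2 hc2 _ _] := s2.
have /choice[g1 hg1] k : exists g, vdensity leb (Dcurve (u1 k)) g /\
    {ae leb, forall x, 0 < x < 1 -> curve_derivative (u1 k) x = g x}.
  by have [g ? ?] := abs_continuous_derivative (hu1 k) (ac k).1; exists g.
have /choice[g2 hg2] k : exists g, vdensity leb (Dcurve (u2 k)) g /\
    {ae leb, forall x, 0 < x < 1 -> curve_derivative (u2 k) x = g x}.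
  by have [g ? ?] := abs_continuous_derivative (hu2 k) (ac k).2; exists g.
set I := \int[m]_(x in oc01) _.
set nu1 := Dcurve c1 in h1 *; set nu2 := Dcurve c2 in h2 *.
pose L1 := fine (len c1); pose L2 := fine (len c2).
have L10 : 0 <= L1 by rewrite fine_ge0 ?tvar_ge0.
have L20 : 0 <= L2 by rewrite fine_ge0 ?tvar_ge0.
pose B := L1 + L2 + 2; have B0 : 0 < B by rewrite /B; lra.
pose l := e / (4 * B); have l0 : 0 < l by rewrite divr_gt0// mulr_gt0.
pose eta := Num.min 1 (e * l / 72).
have eta0 : 0 < eta by rewrite lt_min ltr01 divr_gt0// mulr_gt0.
have [N [t [gr nul]]] := exists_grids m.
have e4 : 0 < e / 4 by rewrite divr_gt0.
have [n [[Tn D1n] D2n]] := filter_ex (filterI (filterI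
  ((@cvgrPdist_le _ _ _ _ _ _ _).1 (cell_sim_cvg gr h1 h2 b1 b2) _ e4)
  (defect_near gr h1 eta0)) (defect_near gr h2 eta0)).
have {nul} := nul n; have g := gr n.
move: (N n) (t n) g Tn D1n D2n => K s g Tn D1n D2n nul.
pose C j := cell s j.
have mC j : measurable (C j) by exact: measurable_cell.
pose a1 j := polar_cell nu1 (C j); pose a2 j := polar_cell nu2 (C j).
pose ek := eta / K.+1%:R; have ek0 : 0 < ek by rewrite divr_gt0.
have /choice[phi hphi] j : exists phi, (j < K)%N -> [/\ test_function phi,
    forall x, 0 <= phi x <= 1, forall x, ~ (s j < x < s j.+1) -> phi x = 0,
    `|\int[m]_x (phi x * edot (a1 j) (f1 x)) - edot (a1 j) (vmeas nu1 (C j))| <= ek &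
    `|\int[m]_x (phi x * edot (a2 j) (f2 x)) - edot (a2 j) (vmeas nu2 (C j))| <= ek].
  have [jK|jK] := ltnP j K; last by exists (cst 0).
  have /andP[s0 _] := grid_itv g (ltnW jK); have /andP[_ s1'] := grid_itv g jK.
  (* Interior grid points avoid the atoms; the last one is 1, which is not an atom by hypothesis. *)
  have ms : m [set s j.+1] = 0%E.
    have := jK; rewrite leq_eqVlt => /predU1P[jK'|jK']; last exact: nul.
    by have [_ sK _ _] := g; rewrite jK' sK.
  have [phi [p1 p2 p3 p4 p5]] := exists_cell_test (a1 j) (a2 j) h1.1 h2.1 s0 s1' ms ek0.
  exists phi => _; split => //.
    move: p4; congr (`|_ - _| <= _); apply: EFin_inj.
    rewrite (vdensity_edot _ (mC j) h1) /Rintegral fineK//.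
    by apply: integrable_fin_num => //; apply: integrableS (integrable_edot _ h1.1).
  move: p5; congr (`|_ - _| <= _); apply: EFin_inj.
  rewrite (vdensity_edot _ (mC j) h2) /Rintegral fineK//.
  by apply: integrable_fin_num => //; apply: integrableS (integrable_edot _ h2.1).
have near1 : \forall k \near \oo, forall j : 'I_K,
    `|\int[m]_x (phi j x * edot (a1 j) (f1 x)) -
      \int[leb]_x (phi j x * edot (a1 j) (g1 k x))| <= ek.
  apply: filter_forall => j; have [tphi _ _ _ _] := hphi j (ltn_ord j).
  have := weak_cvg_edot (q := a1 j) s1 h1 (fun k => (hg1 k).1) tphi.
  by move=> /cvgrPdist_le /(_ _ ek0).
have near2 : \forall k \near \oo, forall j : 'I_K,
    `|\int[m]_x (phi j x * edot (a2 j) (f2 x)) -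
      \int[leb]_x (phi j x * edot (a2 j) (g2 k x))| <= ek.
  apply: filter_forall => j; have [tphi _ _ _ _] := hphi j (ltn_ord j).
  have := weak_cvg_edot (q := a2 j) s2 h2 (fun k => (hg2 k).1) tphi.
  by move=> /cvgrPdist_le /(_ _ ek0).
apply: filterS (filterI (filterI near1 near2)
  (filterI (strict_cvg_len s1 eta0) (strict_cvg_len s2 eta0))) => k [[w1 w2] [l1 l2]].
have [d1 D1] := hg1 k; have [d2 D2] := hg2 k.
rewrite (similarity_density D1 D2) integral_oc_oo.
have Is : leb.-integrable oc01 (EFin \o (fun x => sim (g1 k x) (g2 k x))).
  by apply: integrable_sim => //; [exact: d1.1|exact: d2.1].
have -> : (\int[leb]_(x in oc01) (sim (g1 k x) (g2 k x))%:E)%E =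
    (\int[leb]_(x in oc01) sim (g1 k x) (g2 k x))%:E.
  by rewrite /Rintegral fineK//; apply: integrable_fin_num.
rewrite lee_fin (Rintegral_cells g Is).
pose n1 j := fine (tvar nu1 (C j)); pose n2 j := fine (tvar nu2 (C j)).
pose N1 j := \int[leb]_(x in C j) enorm (g1 k x).
pose N2 j := \int[leb]_(x in C j) enorm (g2 k x).
pose P1 j := \int[leb]_x (phi j x * edot (a1 j) (g1 k x)).
pose P2 j := \int[leb]_x (phi j x * edot (a2 j) (g2 k x)).
(* The term [2 * ek] pays for two replacements: the cell by the test function, and the limit by the
   curve of index [k]. *)
pose E1 j := N1 j - P1 j + 2 * ek; pose E2 j := N2 j - P2 j + 2 * ek.
have cellphi j (q : 'rV[R]_d) (gg : mR -> 'rV[R]_d) : (j < K)%N ->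
    \int[leb]_x (phi j x * edot q (gg x)) = \int[leb]_(x in C j) (phi j x * edot q (gg x)).
  move=> jK; have [_ _ phi0 _ _] := hphi j jK.
  rewrite [RHS]Rintegral_mkcond; apply: eq_Rintegral => x _; rewrite patchE.
  case: ifPn => // /negP xC; rewrite phi0 ?mul0r// => /andP[x1 x2]; apply: xC.
  by apply/mem_set; rewrite /C /cell/= in_itv/= x1 ltW.
have Dge j (q : 'rV[R]_d) (gg : mR -> 'rV[R]_d) : (j < K)%N -> enorm q <= 1 -> vintegrable leb gg ->
    \int[leb]_x (phi j x * edot q (gg x)) <= \int[leb]_(x in C j) enorm (gg x).
  move=> jK q1 Ig; have [tphi phi01 _ _ _] := hphi j jK.
  rewrite cellphi//; apply: le_Rintegral => //.
  - by apply: integrableS (integrable_testM tphi (integrable_edot q Ig)).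
  - by apply: integrableS (integrable_enorm Ig).
  - move=> x _; have /andP[p0 p1] := phi01 x.
    rewrite (le_trans (ler_norm _))// normrM ger0_norm// (le_trans (ler_piMl _ p1))//.
    by rewrite (le_trans (normr_edot_le _ _))// ler_piMl ?enorm_ge0.
have A1 j : enorm (a1 j) <= 1 by exact: enorm_polar_cell.
have A2 j : enorm (a2 j) <= 1 by exact: enorm_polar_cell.
have aln nu j : edot (polar_cell nu (C j)) (vmeas nu (C j)) <= fine (tvar nu (C j)).
  rewrite (le_trans (edot_le _ _))// (le_trans _ (enorm_vmeas_le nu (mC j)))//.
  by rewrite ler_piMl ?enorm_ge0// enorm_polar_cell.
have cellb j : (j < K)%N -> \int[leb]_(x in C j) sim (g1 k x) (g2 k x) <=
    cell_sim nu1 nu2 (C j) +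
    (l / 2 * n1 j + l * N2 j + l / 2 * N1 j + 3 / (2 * l) * (E1 j + E2 j)).
  move=> jK; have [tphi phi01 _ p1 p2] := hphi j jK.
  have D10 := Dge j (a1 j) (g1 k) jK (A1 j) d1.1.
  have D20 := Dge j (a2 j) (g2 k) jK (A2 j) d2.1.
  have w1j := w1 (Ordinal jK); have w2j := w2 (Ordinal jK); rewrite /= in w1j w2j.
  rewrite -/(P1 j) -/(N1 j) in D10 w1j; rewrite -/(P2 j) -/(N2 j) in D20 w2j.
  have al1 := aln nu1 j; have al2 := aln nu2 j.
  rewrite -/(a1 j) -/(n1 j) in al1; rewrite -/(a2 j) -/(n2 j) in al2.
  have mphi := measurable_test tphi.
  have n10 : 0 <= n1 j by rewrite fine_ge0 ?tvar_ge0.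
  have n20 : 0 <= n2 j by rewrite fine_ge0 ?tvar_ge0.
  have E10 : 0 <= E1 j.
    by apply: addr_ge0; [rewrite subr_ge0; exact: D10|rewrite mulr_ge0// ltW].
  have E20 : 0 <= E2 j.
    by apply: addr_ge0; [rewrite subr_ge0; exact: D20|rewrite mulr_ge0// ltW].
  have NE1 : N1 j <= n1 j + E1 j := cell_mass (N1 j) p1 w1j al1.
  have NE2 : N2 j <= n2 j + E2 j := cell_mass (N2 j) p2 w2j al2.
  have := cell_upper_bound (mC j) d1.1 d2.1 mphi phi01 (A1 j) (A2 j) l0 n10 n20 E10 E20 NE1 NE2.
  move=> /le_trans; apply.
  rewrite -!cellphi// -/(P1 j) -/(P2 j) -/(N1 j) -/(N2 j) /a1 /a2 /n1 /n2 cell_simE.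
  rewrite -/(n1 j); apply: cell_arith; first exact: l0.
    by rewrite lerDl mulr_ge0// ltW.
  by rewrite lerDl mulr_ge0// ltW.
apply: (@le_trans _ _ (\sum_(j < K) (cell_sim nu1 nu2 (C j) +
    (l / 2 * n1 j + l * N2 j + l / 2 * N1 j + 3 / (2 * l) * (E1 j + E2 j))))).
  by apply: ler_sum => j _; exact: cellb (ltn_ord j).
have := sum_bound K l (fun j => cell_sim nu1 nu2 (C j)) n1 N1 N2 E1 E2.
cbv beta => ->.
have SN1 : \sum_(j < K) N1 j = fine (len (u1 k)) by exact: len_cells (hu1 k) d1 g.
have SN2 : \sum_(j < K) N2 j = fine (len (u2 k)) by exact: len_cells (hu2 k) d2 g.
have Sn1 : \sum_(j < K) n1 j = L1.
  rewrite /L1 -(len_cells hc1 h1 g); apply: eq_bigr => j _.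
  by rewrite /n1 (tvar_density (mC j) h1).
have Sn2 : \sum_(j < K) n2 j = L2.
  rewrite /L2 -(len_cells hc2 h2 g); apply: eq_bigr => j _.
  by rewrite /n2 (tvar_density (mC j) h2).
have SE1 : \sum_(j < K) E1 j <= 6 * eta.
  apply: (sum_defect SN1 l1 Sn1 D1n (ltW eta0) erefl
    (p := fun j => \int[m]_x (phi j x * edot (a1 j) (f1 x)))
    (al := fun j => edot (a1 j) (vmeas nu1 (C j)))) => j jK.
  by have [_ _ _ h _] := hphi j jK; split; [exact: h|exact: (w1 (Ordinal jK))].
have SE2 : \sum_(j < K) E2 j <= 6 * eta.
  apply: (sum_defect SN2 l2 Sn2 D2n (ltW eta0) erefl
    (p := fun j => \int[m]_x (phi j x * edot (a2 j) (f2 x)))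
    (al := fun j => edot (a2 j) (vmeas nu2 (C j)))) => j jK.
  by have [_ _ _ _ h] := hphi j jK; split; [exact: h|exact: (w2 (Ordinal jK))].
have HT : \sum_(j < K) cell_sim nu1 nu2 (C j) <= I + e / 4.
  by move: Tn; rewrite distrC => /(le_trans (ler_norm _)); rewrite lerBlDl.
rewrite Sn1; apply: total_arith e0 B0 _ _ _ SE1 SE2 _ _ HT; [by []|by []|by []| |].
  rewrite SN1; exact: l1.
rewrite SN2; exact: l2.
Qed.

End grid_upper_bound.

(** * The lower bound *)

Section primitive_curves.
Context {R : realType} {d : nat}.
Local Notation mR := (measurableTypeR R).
Local Notation leb := (@lebesgue_measure R).
Variables (g : mR -> 'rV[R]_d) (M : R).
Hypotheses (Ig : vintegrable leb g) (gM : forall x, enorm (g x) <= M)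
  (g0 : forall x, ~ oc01 x -> g x = 0).

Let mu i : {charge set mR -> \bar R} := induced_charge (Ig i).

Let muE : vdensity leb mu g. Proof. by []. Qed.

Lemma enorm_primitive_sub x y : x <= y ->
  enorm (primitive g y - primitive g x) <= \int[leb]_(z in ([set` `]x, y]] : set mR)) enorm (g z).
Proof.
move=> xy; rewrite -!(vmeas_ray_density _ muE) vmeas_ray_sub//.
have mxy : measurable ([set` `]x, y]] : set mR) by exact: measurable_itv.
rewrite -lee_fin (le_trans (vdensity_enorm_vmeas_le mxy muE))//.
rewrite /Rintegral fineK//; apply: integrable_fin_num => //.
exact: integrableS (integrable_enorm Ig).
Qed.

Variable C : 'rV[R]_d.

Lemma primitive_abs_continuous : abs_continuous (fun x => C + primitive g x).
Proof.
have M0 : 0 <= M by exact: le_trans (enorm_ge0 _) (gM 0).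
move=> e e0; exists (e / (M + 1)); first by rewrite divr_gt0// ltr_wpDl.
move=> n a b hab _ hsum.
apply: (@le_lt_trans _ _ (\sum_(k < n) M * (b k - a k))).
  apply: ler_sum => k _; have [_ [ab _]] := hab k.
  rewrite opprD addrACA subrr add0r (le_trans (enorm_primitive_sub ab))//.
  have mab : measurable ([set` `]a k, b k]] : set mR) by exact: measurable_itv.
  have labE : leb ([set` `]a k, b k]] : set mR) = (b k - a k)%:E.
    rewrite lebesgue_measure_itv/= lte_fin -EFinB.
    by move: ab; rewrite le_eqVlt => /predU1P[->|->//]; rewrite ltxx subrr.
  have -> : M * (b k - a k) = \int[leb]_(z in ([set` `]a k, b k]] : set mR)) M.
    by rewrite Rintegral_cst//; congr (M * _); exact: esym (congr1 fine labE).
  apply: le_Rintegral => //; first exact: integrableS (integrable_enorm Ig).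
  apply: measurable_bounded_integrable => //.
    by have := ltry (b k - a k); rewrite -labE.
  by exists `|M|; split; [exact: num_real|move=> y My x _ /=; exact: ltW].
rewrite -mulr_sumr; have S0 : 0 <= \sum_(k < n) (b k - a k).
  by apply: sumr_ge0 => k _; have [_ [ab _]] := hab k; rewrite subr_ge0.
apply: (@le_lt_trans _ _ ((M + 1) * \sum_(k < n) (b k - a k))).
  by rewrite ler_wpM2r// lerDl.
by rewrite mulrC -ltr_pdivlMr// ltr_wpDl.
Qed.

Let mu01 i (A : set mR) : measurable A -> mu i A = mu i (A `&` oo01).
Proof.
move=> mA; rewrite /mu /induced_charge.
rewrite [LHS]integral_mkcond [RHS]integral_mkcond.
apply: (@eq_integral_off_null _ _ _ leb [set 1]) => //; first exact: lebesgue_measure_set1.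
move=> x _ x1; rewrite !patchE in_setI; case: (x \in A) => //=.
case: ifPn => // /negP xo; rewrite /= g0 ?mxE// => -.
rewrite /oc01/= in_itv/= => /andP[h1 h2]; apply: xo; apply/mem_set.
by rewrite /oo01/= in_itv/= h1 lt_neqAle h2 andbT; apply/eqP.
Qed.

Let coordE i x : (C + primitive g x) 0 i = C 0 i + sdf (mu i) x.
Proof. by rewrite !mxE. Qed.

(** Each coordinate is a constant plus the distribution function of the charge with density [g], and
    constants have zero distributional derivative. *)
Lemma primitive_BV : BV (fun x => C + primitive g x).
Proof.
have mI : measurable (unit_itv : set mR) by exact: measurable_itv.
have Ic i : leb.-integrable unit_itv (EFin \o (cst (C 0 i) : R -> R)).
  apply: measurable_bounded_integrable => //.
    by rewrite (_ : _ unit_itv = 1%E) ?ltry//; exact: lebesgue_unit_itv.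
  by exists `|C 0 i|; split; [exact: num_real|move=> y My x _ /=; exact: ltW].
have Is i := integrable_sdf (mu i).
split => [i|].
  have := integrableD mI (Ic i) (Is i).
  by apply: eq_integrable => // x _ /=; rewrite coordE.
exists mu; split => [i A mA|i phi tphi]; first exact: mu01.
under eq_integral do rewrite coordE mulrDl EFinD.
rewrite integralD_EFin//; 
  [|exact: (integrable_mul_test_derive tphi (Ic i))|exact: (integrable_mul_test_derive tphi (Is i))].
rewrite (integral_cst_test_derive (C 0 i) tphi) add0e.
by apply: distr_derivative_sdf => //; exact: mu01.
Qed.

Lemma primitive_derivative :
  {ae leb, forall x, 0 < x < 1 -> curve_derivative (fun x => C + primitive g x) x = g x}.
Proof. exact: (@ae_derive_primitive _ _ _ g C). Qed.

Lemma vmeasurable_primitive : vmeasurable (primitive g : mR -> 'rV[R]_d).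
Proof.
move=> i; rewrite (_ : (fun x => _) = sdf (mu i)); first exact: measurable_sdf.
by apply/funext => x; rewrite mxE.
Qed.

End primitive_curves.

(** [Dcurve u] is obtained by choice and has not been identified with the charge exhibited in
    [primitive_BV]; the classical derivative, almost everywhere equal to the density of [Dcurve u],
    makes the link. *)
Lemma len_derivative {R : realType} {d : nat} (u : R -> 'rV[R]_d)
    (g : measurableTypeR R -> 'rV[R]_d) : BV u -> abs_continuous u ->
  {ae @lebesgue_measure R, forall x, 0 < x < 1 -> curve_derivative u x = g x} ->
  len u = (\int[@lebesgue_measure R]_(x in oc01) (enorm (g x))%:E)%E.
Proof.
move=> hu ac hg; have [g' d' D'] := abs_continuous_derivative hu ac.
rewrite (len_density hu d') integral_oc_oo -!integral_oc_oo.
have [N [mN N0 h]] := ae_null hg; have [N' [mN' N'0 h']] := ae_null D'.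
apply: (@eq_integral_off_null _ _ _ (@lebesgue_measure R) (N `|` N')).
- exact: measurableU.
- by rewrite measureU0.
- move=> x; rewrite /oo01/= in_itv/= => x01 nx.
  by rewrite -h ?h'// => ?; apply: nx; [right|left].
Qed.

Section step_curves.
Context {R : realType} {d : nat}.
Local Notation mR := (measurableTypeR R).
Local Notation leb := (@lebesgue_measure R).
Variables (N : nat) (t : nat -> R) (e : R).
Hypothesis gt : grid N t e.
Variables (p q : nat -> R).
Hypothesis hpq : forall j, (j < N)%N -> [/\ t j <= p j, p j < q j & q j <= t j.+1].

Definition pulse j (x : mR) : R := \1_([set` `]p j, q j]] : set mR) x / (q j - p j).

(** Since a pulse has integral 1, the primitive moves by [v j] across the cell [j] whatever
    subinterval carries the pulse. This freedom lets two curves move at different times in a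
    cell. *)
Definition step (v : nat -> 'rV[R]_d) (x : mR) : 'rV[R]_d :=
  \sum_(j < N) pulse j x *: v j.

Lemma pulse_ge0 j x : (j < N)%N -> 0 <= pulse j x.
Proof.
by move=> /hpq[_ pq _]; rewrite divr_ge0// subr_ge0 ltW.
Qed.

Lemma pulse_out j x : (j < N)%N -> ~ cell t j x -> pulse j x = 0.
Proof.
move=> /hpq[tp pq qt] nx; rewrite /pulse indicE memNset ?mul0r//.
rewrite /= in_itv/= => /andP[px xq]; apply: nx.
by rewrite /cell/= in_itv/= (le_lt_trans tp px) (le_trans xq qt).
Qed.

Lemma cell_sub_oc j : (j < N)%N -> cell t j `<=` oc01.
Proof.
move=> jN x; rewrite /cell /oc01/= !in_itv/= => /andP[tx xt].
have /andP[t0 _] := grid_itv gt (ltnW jN); have /andP[_ t1] := grid_itv gt jN.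
by rewrite (le_lt_trans t0 tx) (le_trans xt t1).
Qed.

Lemma cell_inj i j x : (i < N)%N -> (j < N)%N -> cell t i x -> cell t j x -> i = j.
Proof.
rewrite /cell/= !in_itv/= => iN jN /andP[ix xi] /andP[jx xj].
have [ij|ji|//] := ltngtP i j; exfalso.
  have := @grid_le _ _ _ _ i.+1 j gt; rewrite ij ltnW// => /(_ isT) h.
  by move: (le_lt_trans (le_trans xi h) jx); rewrite ltxx.
have := @grid_le _ _ _ _ j.+1 i gt; rewrite ji ltnW// => /(_ isT) h.
by move: (le_lt_trans (le_trans xj h) ix); rewrite ltxx.
Qed.

Lemma step_cell v j x : (j < N)%N -> cell t j x -> step v x = pulse j x *: v j.
Proof.
move=> jN jx; rewrite /step (bigD1 (Ordinal jN))//= big1 ?addr0// => i /eqP ij.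
rewrite pulse_out ?scale0r// => ix; apply: ij; apply: val_inj => /=.
exact: cell_inj ix jx.
Qed.

Lemma step_out v x : ~ oc01 x -> step v x = 0.
Proof.
move=> nx; rewrite /step big1// => i _; rewrite pulse_out ?scale0r//.
by move=> /(cell_sub_oc (ltn_ord i)).
Qed.

Lemma integrable_pulse j : (j < N)%N -> leb.-integrable setT (EFin \o pulse j).
Proof.
move=> jN; have [_ pq _] := hpq jN.
have I1 : leb.-integrable setT (EFin \o (\1_([set` `]p j, q j]] : set mR) : mR -> R)).
  exact: (integrable_indic_itv (p j) (q j) false false).
by have := integrableZr measurableT (q j - p j)^-1 I1.
Qed.

Lemma Rintegral_pulse j : (j < N)%N -> \int[leb]_(x in cell t j) pulse j x = 1.
Proof.
move=> jN; have [tp pq qt] := hpq jN.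
have mpq : measurable ([set` `]p j, q j]] : set mR) by exact: measurable_itv.
have I1 : leb.-integrable setT (EFin \o (\1_([set` `]p j, q j]] : set mR) : mR -> R)).
  exact: (integrable_indic_itv (p j) (q j) false false).
have mc := measurable_cell t j.
rewrite /pulse RintegralZr//; last exact: integrableS I1.
rewrite /Rintegral integral_indic//.
have -> : ([set` `]p j, q j]] : set mR) `&` cell t j = [set` `]p j, q j]].
  apply/setIidl => x; rewrite /cell/= !in_itv/= => /andP[px xq].
  by rewrite (le_lt_trans tp px) (le_trans xq qt).
have labE : leb ([set` `]p j, q j]] : set mR) = (q j - p j)%:E.
  by rewrite lebesgue_measure_itv/= lte_fin pq EFinB.
rewrite [X in X / _](_ : _ = q j - p j); last exact: (congr1 fine labE).
by rewrite mulfV// gt_eqF// subr_gt0.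
Qed.

Lemma vintegrable_step v : vintegrable leb (step v).
Proof.
move=> i; have Ij (j : 'I_N) : leb.-integrable setT (EFin \o (fun x => v j 0 i * pulse j x)).
  by have := integrableZl measurableT (v j 0 i) (integrable_pulse (ltn_ord j)).
have [Is _] := Rintegral_sum_ord (index_enum 'I_N) measurableT Ij.
apply: eq_integrable Is => // x _ /=.
by rewrite /step summxE; congr EFin; apply: eq_bigr => j _; rewrite mxE mulrC.
Qed.

Lemma step_bounded v : exists M, forall x, enorm (step v x) <= M.
Proof.
exists (\sum_(j < N) (q j - p j)^-1 * enorm (v j)) => x.
have [xo|nx] := pselect (oc01 x); last first.
  rewrite step_out// enorm0; apply: sumr_ge0 => j _; rewrite mulr_ge0 ?enorm_ge0//.
  by have [_ pq _] := hpq (ltn_ord j); rewrite invr_ge0 subr_ge0 ltW.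
rewrite /step; have := enorm_sum N (fun j => pulse j x *: v j); rewrite !big_mkord.
move=> /le_trans; apply; apply: ler_sum => j _; have [_ pq _] := hpq (ltn_ord j).
rewrite enormZ ger0_norm ?pulse_ge0// ler_wpM2r ?enorm_ge0//.
rewrite /pulse ler_piMl ?invr_ge0 ?subr_ge0 ?(ltW pq)//.
Qed.

Lemma Rintegral_step_cell v j i : (j < N)%N ->
  \int[leb]_(x in cell t j) step v x 0 i = v j 0 i.
Proof.
move=> jN; rewrite (@eq_Rintegral _ mR R leb _ (fun x : mR => v j 0 i * pulse j x)); last first.
  by move=> x /set_mem xj; rewrite (step_cell _ jN xj) mxE mulrC.
rewrite RintegralZl ?Rintegral_pulse ?mulr1//; first exact: measurable_cell.
by apply: integrableS (integrable_pulse jN) => //; exact: measurable_cell.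
Qed.

Lemma Rintegral_enorm_step_cell v j : (j < N)%N ->
  \int[leb]_(x in cell t j) enorm (step v x) = enorm (v j).
Proof.
move=> jN; rewrite (@eq_Rintegral _ mR R leb _ (fun x : mR => enorm (v j) * pulse j x)); last first.
  move=> x /set_mem xj; rewrite (step_cell _ jN xj) enormZ ger0_norm ?pulse_ge0//.
  by rewrite mulrC.
rewrite RintegralZl ?Rintegral_pulse ?mulr1//; first exact: measurable_cell.
by apply: integrableS (integrable_pulse jN) => //; exact: measurable_cell.
Qed.

Lemma primitive_step_grid v n : (n <= N)%N -> primitive (step v) (t n) = \sum_(j < n) v j.
Proof.
move=> nN; apply/rowP => i; rewrite mxE summxE; have [t0 _ _ _] := gt.
have Is := vintegrable_step v i.
elim: n nN => [_|n IH nN].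
  rewrite big_ord0 (@eq_Rintegral _ mR R leb _ (fun=> 0)) ?Rintegral_cst ?mul0r//.
    exact: measurable_ray.
  move=> x /set_mem; rewrite t0 /ray/= in_itv/= => x0; rewrite step_out ?mxE//.
  by rewrite /oc01/= in_itv/= => /andP[/lt_le_trans/(_ x0)]; rewrite ltxx.
rewrite big_ord_recr/= -IH 1?ltnW// -(Rintegral_step_cell v i nN).
have tt : t n <= t n.+1 by apply: (grid_le gt); rewrite leqnSn.
have -> : ray (t n.+1) = ray (t n) `|` cell t n.
  rewrite /ray /cell (@itv_bndbnd_setU _ _ _ (BRight (t n)))//.
rewrite Rintegral_setU//; [exact: measurable_ray|exact: measurable_cell| |].
  apply: integrableS Is => //; apply: measurableU; [exact: measurable_ray|exact: measurable_cell].
apply/disj_setPS => x []; rewrite /ray /cell/= !in_itv/= => xt /andP[tx _].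
by move: (le_lt_trans xt tx); rewrite ltxx.
Qed.

Variable c : R -> 'rV[R]_d.
Hypothesis hc : BV c.

Let nu := Dcurve c.
Let nu01 i (A : set mR) : measurable A -> nu i A = nu i (A `&` oo01).
Proof. exact: Dcurve_conc. Qed.
Let v j := vmeas nu (cell t j).
Let g := step v.

Lemma tvar_cells : \sum_(j < N) fine (tvar nu (cell t j)) = fine (len c).
Proof.
have [t0 tN _ _] := gt; rewrite len_oc//.
suff : forall n, (n <= N)%N -> fine (tvar nu [set` `]0, t n]]) =
    \sum_(j < n) fine (tvar nu (cell t j)).
  by move=> /(_ N (leqnn _)) <-; rewrite tN.
elim=> [_|n IH nN]; first by rewrite t0 set_itvoc0 tvar0 big_ord0.
rewrite big_ord_recr/= -IH 1?ltnW//.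
have /andP[tn0 tn1] := grid_itv gt (ltnW nN).
have tnm : t n <= t n.+1 by apply: (grid_le gt); rewrite leqnSn.
rewrite (@itv_bndbnd_setU _ _ _ (BRight (t n))) ?bnd_simp//.
rewrite measureU ?fineD ?tvar_fin//.
apply/seteqP; split => // x [/=]; rewrite !in_itv/= => /andP[_ h1] /andP[h2 _].
by move: (lt_le_trans h2 h1); rewrite ltxx.
Qed.

Lemma vmeas_ray_grid n : (n <= N)%N -> vmeas nu (ray (t n)) = \sum_(j < n) v j.
Proof.
move=> nN; have [t0 tN _ _] := gt.
have tn1 : t n <= 1 by have /andP[] := grid_itv gt nN.
rewrite (vmeas_conc nu01); last exact: measurable_ray.
elim: n nN tn1 => [_ _|n IH nN tn1].
  rewrite big_ord0 (_ : _ `&` _ = set0) ?vmeas0//; apply/seteqP; split => // x.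
  rewrite t0 /ray /oo01/= !in_itv/= => -[x0 /andP[/lt_le_trans/(_ x0)]].
  by rewrite ltxx.
rewrite big_ord_recr/= -IH 1?ltnW//; last by have /andP[] := grid_itv gt (ltnW nN).
have tt : t n <= t n.+1 by apply: (grid_le gt); rewrite leqnSn.
have mo := @measurable_oo01 R.
have mc := measurable_cell t n; rewrite /v (vmeas_conc nu01 mc).
rewrite -vmeasU//.
- congr vmeas; rewrite -setIUl; congr (_ `&` _).
  by rewrite /ray /cell (@itv_bndbnd_setU _ _ _ (BRight (t n))).
- by apply: measurableI => //; exact: measurable_ray.
- by apply: measurableI => //; exact: measurable_cell.
- apply/seteqP; split => // x [[+ _] [+ _]]; rewrite /ray /cell/= !in_itv/=.
  by move=> xt /andP[tx _]; move: (le_lt_trans xt tx); rewrite ltxx.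
Qed.

(** Both functions have the same values at the grid points, and from the left end of the cell each
    moves by at most [|D c|] of the cell. *)
Lemma step_curve_dist j x : (j < N)%N -> cell t j x ->
  enorm (primitive g x - vmeas nu (ray x)) <= 2 * fine (tvar nu (cell t j)).
Proof.
move=> jN; rewrite /cell/= in_itv/= => /andP[tx xt].
have mx : measurable ([set` `]t j, x]] : set mR) by exact: measurable_itv.
have sub : ([set` `]t j, x]] : set mR) `<=` cell t j.
  by move=> y; rewrite /cell/= !in_itv/= => /andP[-> /le_trans->].
have -> : primitive g x - vmeas nu (ray x) =
    (primitive g x - primitive g (t j)) - (vmeas nu (ray x) - vmeas nu (ray (t j))).
  rewrite (primitive_step_grid v (ltnW jN)) (vmeas_ray_grid (ltnW jN)).
  by rewrite opprB addrA subrK.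
have Ig := vintegrable_step v.
have Ie : leb.-integrable (cell t j) (EFin \o (fun x => enorm (g x))).
  by apply: integrableS (integrable_enorm Ig) => //; exact: measurable_cell.
rewrite (le_trans (enormB _ _))// mulr_natl mulr2n lerD//.
  rewrite (le_trans (enorm_primitive_sub Ig (ltW tx)))//.
  apply: (le_trans _ (enorm_vmeas_le nu (measurable_cell t j))).
  rewrite -(Rintegral_enorm_step_cell v jN) -lee_fin /Rintegral.
  rewrite !fineK; last 2 first.
  - by apply: integrable_fin_num => //; exact: measurable_cell.
  - by apply: integrable_fin_num => //; apply: integrableS (integrable_enorm Ig).
  apply: ge0_subset_integral => //; first exact: measurable_cell.
    exact: measurable_int Ie.
  by move=> y _; rewrite lee_fin enorm_ge0.
rewrite (vmeas_ray_sub nu (ltW tx)); apply: (le_trans (enorm_vmeas_le nu mx)).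
have mc := measurable_cell t j; rewrite fine_le ?tvar_fin//.
by apply: le_measure; rewrite ?inE.
Qed.

(** The last bound integrates [step_curve_dist]: on a cell the distance is at most twice the
    variation of [c] there, and the cell has length at most [e]. *)
Lemma step_curve : exists u, [/\ abs_continuous u, BV u,
  {ae leb, forall x, 0 < x < 1 -> curve_derivative u x = g x},
  len u = (\sum_(j < N) enorm (v j))%:E &
  (\int[leb]_(x in unit_itv) (enorm (u x - c x))%:E <= (2 * e * fine (len c))%:E)%E].
Proof.
have [C hC] := BV_representation hc; have Ig := vintegrable_step v.
have [M hM] := step_bounded v.
have ac := primitive_abs_continuous Ig hM C.
have bv := primitive_BV Ig (@step_out v) C.
have de := primitive_derivative Ig C.
exists (fun x => C + primitive g x); split => //.
  have Ie : leb.-integrable oc01 (EFin \o (fun x => enorm (g x))).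
    exact: integrableS (integrable_enorm Ig).
  rewrite (len_derivative bv ac de).
  rewrite -[LHS]fineK; last by apply: integrable_fin_num.
  congr EFin; rewrite -[LHS]/(\int[leb]_(x in oc01) enorm (g x)).
  by rewrite (Rintegral_cells gt Ie); apply: eq_bigr => j _; rewrite Rintegral_enorm_step_cell.
pose h (x : mR) := (enorm (primitive g x - vmeas nu (ray x)))%:E.
have mh : measurable_fun setT h.
  apply/measurable_EFinP; apply: measurable_enorm => i.
  rewrite (_ : (fun x => _) = fun x => primitive g x 0 i - sdf (nu i) x); last first.
    by apply/funext => x; rewrite !mxE.
  by apply: measurable_funB; [exact: vmeasurable_primitive|exact: measurable_sdf].
have h0 x : (0 <= h x)%E by rewrite lee_fin enorm_ge0.
rewrite (@integral_unit_oo _ _ h); last first.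
  apply: ae_imp hC _ => x hx x01; congr (enorm _)%:E; apply/rowP => i.
  by rewrite !mxE hx//; rewrite /sdf; ring.
rewrite integral_oc_oo (integral_cells _ gt)//; last exact: measurable_funTS.
apply: (@le_trans _ _ (\sum_(j < N) (2 * fine (tvar nu (cell t j)) * (t j.+1 - t j))%:E)%E).
  apply: lee_sum => j _; have jN := ltn_ord j; have mc := measurable_cell t j.
  have [_ _ /(_ j jN) tt _] := gt.
  rewrite EFinM.
  have -> : (t j.+1 - t j)%:E = leb (cell t j).
    by rewrite /cell lebesgue_measure_itv/= lte_fin tt EFinB.
  rewrite -integral_cst//; apply: ge0_le_integral => //.
  - exact: measurable_funTS.
  - by move=> x xj; rewrite lee_fin; exact: step_curve_dist.
have Stv : \sum_(j < N) fine (tvar nu (cell t j)) = fine (len c).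
  exact: tvar_cells.
rewrite sumEFin lee_fin -Stv mulr_sumr; apply: ler_sum => j _.
have [_ _ _ /(_ j (ltn_ord j)) te] := gt.
rewrite mulrAC ler_wpM2r ?fine_ge0 ?tvar_ge0//.
by rewrite ler_pM2l.
Qed.

End step_curves.

(** Replacing the larger [n_i] by [|v_i|] can only increase a nonnegative product, and a negative
    one is cut off at 0. *)
Lemma normalized_sim_le {R : realType} {d : nat} (v1 v2 : 'rV[R]_d) (n1 n2 : R) :
  enorm v1 <= n1 -> enorm v2 <= n2 ->
  Num.max (edot ((Num.sqrt n1)^-1 *: v1) ((Num.sqrt n2)^-1 *: v2)) 0 <=
  if 0 <= edot v1 v2 then sim v1 v2 else 0.
Proof.
move=> h1 h2; rewrite /sim /srv !edotZl !edotZr.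
have i1 : 0 <= (Num.sqrt n1)^-1 by rewrite invr_ge0 sqrtr_ge0.
have i2 : 0 <= (Num.sqrt n2)^-1 by rewrite invr_ge0 sqrtr_ge0.
case: ifPn => [b|]; last first.
  by rewrite -ltNge => b; rewrite ge_max lexx andbT mulr_ge0_le0// mulr_ge0_le0// ltW.
have j1 : 0 <= (Num.sqrt (enorm v1))^-1 by rewrite invr_ge0 sqrtr_ge0.
have j2 : 0 <= (Num.sqrt (enorm v2))^-1 by rewrite invr_ge0 sqrtr_ge0.
rewrite ge_max (mulr_ge0 j1 (mulr_ge0 j2 b)) andbT.
have [->|v1N0] := eqVneq v1 0; first by rewrite edot0l !mulr0.
have [->|v2N0] := eqVneq v2 0; first by rewrite edot0r !mulr0.
have inv (w : 'rV[R]_d) n : w != 0 -> enorm w <= n ->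
    (Num.sqrt n)^-1 <= (Num.sqrt (enorm w))^-1.
  move=> w0 wn; have w1 : 0 < enorm w by rewrite enorm_gt0.
  have n0 : 0 < n := lt_le_trans w1 wn.
  by rewrite lef_pV2 ?ler_wsqrtr// posrE sqrtr_gt0.
rewrite ler_pM ?mulr_ge0 ?inv// ler_wpM2r// inv//.
Qed.

Section recovery.
Context {R : realType} {d : nat}.
Local Notation mR := (measurableTypeR R).
Local Notation leb := (@lebesgue_measure R).
Variables c1 c2 : R -> 'rV[R]_d.
Hypotheses (hc1 : BV c1) (hc2 : BV c2).
Let nu1 := Dcurve c1.
Let nu2 := Dcurve c2.

Lemma cell_sim_le (A : set mR) : measurable A -> cell_sim nu1 nu2 A <=
  if 0 <= edot (vmeas nu1 A) (vmeas nu2 A) then sim (vmeas nu1 A) (vmeas nu2 A) else 0.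
Proof.
by move=> mA; apply: normalized_sim_le; exact: enorm_vmeas_le.
Qed.

Lemma recovery_pair N t (e : R) : grid N t e -> exists u1 u2,
  [/\ abs_continuous u1 /\ abs_continuous u2, BV u1 /\ BV u2,
  len u1 = (\sum_(j < N) enorm (vmeas nu1 (cell t j)))%:E /\
  len u2 = (\sum_(j < N) enorm (vmeas nu2 (cell t j)))%:E,
  (\int[leb]_(x in unit_itv) (enorm (u1 x - c1 x))%:E <= (2 * e * fine (len c1))%:E)%E /\
  (\int[leb]_(x in unit_itv) (enorm (u2 x - c2 x))%:E <= (2 * e * fine (len c2))%:E)%E &
  ((\sum_(j < N) cell_sim nu1 nu2 (cell t j))%:E <= similarity u1 u2)%E].
Proof.
(* Where the increments point in opposite directions, the two curves move on
   different halves of the cell. *)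
move=> g; pose v1 j := vmeas nu1 (cell t j); pose v2 j := vmeas nu2 (cell t j).
pose b j := 0 <= edot (v1 j) (v2 j); pose mid j := (t j + t j.+1) / 2.
pose q1 j := if b j then t j.+1 else mid j; pose p2 j := if b j then t j else mid j.
have tm j : (j < N)%N -> t j < mid j /\ mid j < t j.+1.
  move=> jN; have [_ _ /(_ j jN) tt _] := g; rewrite /mid; split.
    by rewrite ltr_pdivlMr// mulr_natr mulr2n ltrD2l.
  by rewrite ltr_pdivrMr// mulr_natr mulr2n ltrD2r.
have h1 j : (j < N)%N -> [/\ t j <= t j, t j < q1 j & q1 j <= t j.+1].
  move=> jN; have [m1 m2] := tm j jN; have [_ _ /(_ j jN) tt _] := g.
  by rewrite /q1; case: ifP; split => //; exact: ltW.
have h2 j : (j < N)%N -> [/\ t j <= p2 j, p2 j < t j.+1 & t j.+1 <= t j.+1].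
  move=> jN; have [m1 m2] := tm j jN; have [_ _ /(_ j jN) tt _] := g.
  by rewrite /p2; case: ifP; split => //; exact: ltW.
have [u1 [ac1 bv1 de1 le1 di1]] := step_curve g h1 hc1.
have [u2 [ac2 bv2 de2 le2 di2]] := step_curve g h2 hc2.
exists u1, u2; split => //.
rewrite (similarity_density de1 de2) integral_oc_oo.
have I1 := vintegrable_step h1 v1; have I2 := vintegrable_step h2 v2.
have Is : leb.-integrable oc01 (EFin \o (fun x => sim (step N t q1 v1 x) (step N p2 (fun j => t j.+1) v2 x))).
  exact: integrable_sim.
rewrite -[leRHS]fineK; last by apply: integrable_fin_num.
rewrite lee_fin -[leRHS]/(\int[leb]_(x in oc01) sim (step N t q1 v1 x) (step N p2 (fun j => t j.+1) v2 x)).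
rewrite (Rintegral_cells g Is); apply: ler_sum => j _; have jN := ltn_ord j.
have mc := measurable_cell t j; apply: (le_trans (cell_sim_le mc)).
rewrite -/(v1 j) -/(v2 j) -/(b j).
(* If [b j] holds, both curves have the same pulse, and homogeneity takes it out of [sim]; otherwise
   the pulses have disjoint supports and [sim] vanishes. *)
rewrite (@eq_Rintegral _ mR R leb _
  (fun x : mR => (if b j then sim (v1 j) (v2 j) else 0) * pulse t q1 j x)); last first.
  move=> x /set_mem xj; rewrite (step_cell g h1 v1 jN xj) (step_cell g h2 v2 jN xj).
  case: ifPn => bj.
    have -> : pulse p2 (fun j => t j.+1) j x = pulse t q1 j x by rewrite /pulse /p2 /q1 bj.
    by rewrite simZ ?(pulse_ge0 h1)// mulrC.
  rewrite mul0r; have [xm|mx] := leP x (mid j).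
    have -> : pulse p2 (fun j => t j.+1) j x = 0.
      rewrite /pulse indicE memNset ?mul0r// /p2 (negbTE bj)/= in_itv/= => /andP[h _].
      by move: (lt_le_trans h xm); rewrite ltxx.
    by rewrite scale0r sim0r.
  have -> : pulse t q1 j x = 0.
    rewrite /pulse indicE memNset ?mul0r// /q1 (negbTE bj)/= in_itv/= => /andP[_ h].
    by move: (lt_le_trans mx h); rewrite ltxx.
  by rewrite scale0r sim0l.
rewrite RintegralZl//; last by apply: integrableS (integrable_pulse h1 jN).
by rewrite (Rintegral_pulse h1 jN) mulr1.
Qed.

End recovery.

(** * Densities with respect to a common reference measure, and the first formula *)

Section density_setup.
Context {R : realType} {d : nat}.
Local Notation mR := (measurableTypeR R).
Variables (c : R -> 'rV[R]_d) (m : {finite_measure set mR -> \bar R}).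
Hypothesis tm : forall A : set mR, measurable A -> (tvar (Dcurve c) A <= m A)%E.
Let nu := Dcurve c.

(** The factorization is the chain rule for Radon-Nikodym derivatives through [|D c|]. The
    derivative has norm at most 1 only almost everywhere; it is set to 0 elsewhere, since the bounds
    on cells are pointwise. *)
Lemma polar_density : exists f N, [/\ vdensity m nu f, forall x, enorm (f x) <= 1,
  measurable N, m N = 0%E & forall x, ~ N x ->
    f x = variation_density c m x *: polar c x /\ enorm (f x) = variation_density c m x].
Proof.
have nut i : nu i `<< tvar nu.
  apply/null_content_dominatesP => A mA A0.
  have : enorm (vmeas nu A) <= 0 by rewrite (le_trans (enorm_vmeas_le nu mA))// A0.
  move=> vA; have : vmeas nu A = 0 by apply/eqP; rewrite -enorm_eq0 eq_le vA enorm_ge0.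
  move=> /(congr1 (fun v : 'rV[R]_d => v 0 i)); rewrite !mxE => h.
  by rewrite -[LHS]fineK ?h// fin_num_measure.
have tvm : charge_of_finite_measure (tvar nu) `<< m.
  apply/null_content_dominatesP => A mA A0; apply/eqP.
  by rewrite -[X in X == _]/(tvar nu A) eq_le tvar_ge0 andbT -A0 tm.
have num i : nu i `<< m := null_dominates_trans (nut i) tvm.
pose F x : 'rV[R]_d := \row_i fine (Radon_Nikodym (nu i) m x).
have FE i : EFin \o (fun x => F x 0 i) = Radon_Nikodym (nu i) m.
  by apply/funext => x /=; rewrite mxE fineK// Radon_Nikodym_fin_num.
have hF : vdensity m nu F.
  split => [i|i A mA]; first by rewrite FE; exact: Radon_Nikodym_integrable.
  by rewrite (Radon_Nikodym_integral (num i) mA) -FE.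
have IF := integrable_enorm hF.1.
have [N1 [mN1 N10 h1]] : exists N : set mR, [/\ measurable N, m N = 0%E &
    forall x, ~ N x -> enorm (F x) = variation_density c m x].
  apply: ae_null.
  have := @density_RN _ _ _ m (tvar nu) (fun x => enorm (F x)) IF
    (fun A mA => tvar_density mA hF).
  by apply: filterS => x /(_ I) h; rewrite /variation_density h.
have [N2 [mN2 N20 h2]] : exists N : set mR, [/\ measurable N, m N = 0%E &
    forall x, ~ N x -> F x = variation_density c m x *: polar c x].
  have hi i := @Radon_Nikodym_chain_rule _ _ _ (nu i) m (tvar nu) (nut i) tvm.
  have : {ae m, forall x i, F x 0 i = variation_density c m x * polar c x 0 i}.
    apply: filter_forall => i; apply: filterS (hi i) => x /(_ I) h.
    rewrite !mxE /variation_density h fineM; first by rewrite mulrC.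
      exact: Radon_Nikodym_fin_num.
    exact: Radon_Nikodym_fin_num.
  move=> /ae_null[N [mN N0 h]]; exists N; split => // x /h {}h.
  by apply/rowP => i; rewrite h [RHS]mxE.
have [N3 [mN3 N30 h3]] : exists N : set mR, [/\ measurable N, m N = 0%E &
    forall x, ~ N x -> enorm (F x) <= 1].
  apply: ae_null.
  have I1 : m.-integrable setT (EFin \o (fun x => enorm (F x) - 1)).
    exact: integrable_subc.
  apply: filterS (ae_le0_of_integral_le0 I1 _) => [x|B mB]; first by rewrite subr_le0.
  have IB : m.-integrable B (EFin \o (fun x => enorm (F x))) by exact: integrableS IF.
  have IB1 : m.-integrable B (EFin \o (fun x => enorm (F x) - 1)) by exact: integrableS I1.
  rewrite -[leLHS]fineK; last by apply: integrable_fin_num.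
  rewrite lee_fin -[leLHS]/(\int[m]_(x in B) (enorm (F x) - 1)) Rintegral_subc//.
  rewrite mul1r subr_le0 -[leLHS]/(fine (\int[m]_(x in B) (enorm (F x))%:E)%E).
  rewrite -(tvar_density mB hF) fine_le ?tvar_fin ?fin_num_measure//.
  exact: tm.
pose D : set mR := [set x | enorm (F x) <= 1].
have mF := vintegrable_measurable hF.1.
have mD : measurable D.
  have := measurable_enorm mF; move=> /(_ measurableT [set` `]-oo, 1]]).
  rewrite setTI (_ : _ @^-1` _ = D).
    by apply; exact: measurable_itv.
  by apply/seteqP; split => x; rewrite /D/= in_itv.
pose f x := \1_D x *: F x.
have fF x : ~ N3 x -> f x = F x.
  by move=> /h3 h; rewrite /f indicE mem_set ?scale1r.
have mf : vmeasurable f by apply: vmeasurable_scale => //; exact: measurable_indic.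
exists f, (N1 `|` N2 `|` N3); split.
- split => [i|i A mA].
    apply: (@le_integrableR _ _ _ m _ _ (fun x => F x 0 i)) => //; last exact: hF.1.
    move=> x _; rewrite mxE normrM ler_piMl// indicE ger0_norm// lern1 leq_b1 //.
  rewrite hF.2//; apply: (@eq_integral_off_null _ _ _ m N3) => // x _ nx.
  by rewrite fF.
- move=> x; rewrite /f indicE; case: (boolP (x \in D)) => [/set_mem|_].
    by rewrite scale1r.
  by rewrite scale0r enorm0 ler01.
- by apply: measurableU => //; exact: measurableU.
- rewrite measureU0//; last exact: measurableU.
  by rewrite measureU0.
- move=> x nx; have n1 : ~ N1 x by move=> ?; apply: nx; left; left.
  have n2 : ~ N2 x by move=> ?; apply: nx; left; right.
  have n3 : ~ N3 x by move=> ?; apply: nx; right.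
  by rewrite fF// h1// h2.
Qed.

End density_setup.

Section limit_superior.
Context {R : realType}.
Implicit Types (u v : (\bar R)^nat).

Lemma limn_esup_le u (l : R) :
  (forall e, 0 < e -> \forall k \near \oo, (u k <= (l + e)%:E)%E) -> (limn_esup u <= l%:E)%E.
Proof.
move=> h; apply/lee_addgt0Pr => e e0; rewrite -EFinD.
apply: (@le_trans _ _ (ereal_sup (u @` [set k | (u k <= (l + e)%:E)%E]))).
  by apply: ereal_inf_lbound; eexists; [exact: h e e0|].
by apply: ge_ereal_sup => _ [k /= uk <-].
Qed.

Lemma limn_esup_ge u v (l : \bar R) : v @ \oo --> l -> (forall k, (v k <= u k)%E) ->
  (l <= limn_esup u)%E.
Proof.
move=> vl vu; have [_ <-] := cvg_limn_einf_sup vl.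
apply: le_ereal_inf_tmp => _ [V Voo <-].
apply: (@le_trans _ _ (ereal_sup (v @` V))); first by apply: ereal_inf_lbound; exists V.
apply: ge_ereal_sup => _ [k Vk <-]; apply: (le_trans (vu k)).
by apply: ereal_sup_ubound; exists k.
Qed.

End limit_superior.

Section relaxed_similarity_formula.
Context {R : realType} {d : nat}.
Local Notation mR := (measurableTypeR R).
Local Notation leb := (@lebesgue_measure R).

(** As [|v| <= n] on each cell, [n - |v| <= n - |v|^2 / n], and the sum of the latter is the defect
    that vanishes on fine grids. *)
Lemma cvg_sum_enorm_cells (c : R -> 'rV[R]_d) (m : {finite_measure set mR -> \bar R})
    (f : mR -> 'rV[R]_d) (N : nat -> nat) (t : nat -> nat -> R) (nu := Dcurve c) :
  BV c -> grids N t -> vdensity m nu f ->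
  (fun n => \sum_(j < N n) enorm (vmeas nu (cell (t n) j))) @ \oo --> fine (len c).
Proof.
move=> hc gr hf; apply/cvgrPdist_le => e e0.
apply: filterS (defect_near gr hf e0) => n.
have mc j := measurable_cell (t n) j.
rewrite sumrB (tvar_cells (gr n) hc) => h; rewrite ger0_norm.
  apply: le_trans h; rewrite lerD2l lerN2; apply: ler_sum => j _.
  rewrite (le_trans (edot_le _ _))// ler_piMl ?enorm_ge0//.
  exact: enorm_polar_cell.
rewrite subr_ge0 -(tvar_cells (gr n) hc); apply: ler_sum => j _.
exact: enorm_vmeas_le.
Qed.

Variables (c1 c2 : R -> 'rV[R]_d) (m : {finite_measure set mR -> \bar R}).
Variables f1 f2 : mR -> 'rV[R]_d.
Hypotheses (hc1 : BV c1) (hc2 : BV c2) (m1 : m [set 1] = 0%E).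
Hypotheses (h1 : vdensity m (Dcurve c1) f1) (h2 : vdensity m (Dcurve c2) f2).
Hypotheses (b1 : forall x, enorm (f1 x) <= 1) (b2 : forall x, enorm (f2 x) <= 1).

Let strict_cvg_steps c f (N : nat -> nat) (t : nat -> nat -> R) (u : nat -> R -> 'rV[R]_d) :
  BV c -> grids N t -> vdensity m (Dcurve c) f -> (forall n, BV (u n)) ->
  (forall n, len (u n) = (\sum_(j < N n) enorm (vmeas (Dcurve c) (cell (t n) j)))%:E) ->
  (forall n, (\int[leb]_(x in unit_itv) (enorm (u n x - c x))%:E <=
    (2 * (2 / n.+1%:R) * fine (len c))%:E)%E) -> strict_cvg u c.
Proof.
move=> hc gr hf bu lu du; split => //.
  apply: (@squeeze_cvge _ _ _ _ (fun=> 0%E) _ (fun n => (2 * (2 / n.+1%:R) * fine (len c))%:E)).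
  - apply: nearW => n; rewrite du andbT; apply: integral_ge0 => x _.
    by rewrite lee_fin enorm_ge0.
  - exact: cvg_cst.
  - apply: cvg_EFin; first exact: nearW.
    rewrite (_ : _ \o _ = fun n => (4 * fine (len c)) * harmonic n); last first.
      by apply/funext => n /=; rewrite /harmonic/=; move: (n.+1%:R^-1) => y; ring.
    rewrite -[X in _ --> X](mulr0 (4 * fine (len c))).
    by apply: cvgM; [exact: cvg_cst|exact: cvg_harmonic].
rewrite (_ : (fun k => len (u k)) = EFin \o
    (fun n => \sum_(j < N n) enorm (vmeas (Dcurve c) (cell (t n) j)))); last first.
  by apply/funext => n /=; exact: lu.
rewrite -(fineK (len_fin hc)); apply: cvg_EFin; first exact: nearW.
exact: cvg_sum_enorm_cells hc gr hf.
Qed.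

Lemma relaxed_similarity_density : relaxed_similarity c1 c2 =
  (\int[m]_(x in oc01) psim (f1 x) (f2 x))%:E.
Proof.
apply/eqP; rewrite eq_le; apply/andP; split.
  apply: ge_ereal_sup => _ [u1 [u2 [ac s1 s2 ->]]].
  apply: limn_esup_le => e e0.
  exact: similarity_near ac s1 s2 m1 h1 h2 b1 b2 e0.
have [N [t [gr _]]] := exists_grids m.
have /choice[u hu] n : exists u : (R -> 'rV[R]_d) * (R -> 'rV[R]_d),
  [/\ abs_continuous u.1 /\ abs_continuous u.2, BV u.1 /\ BV u.2,
  len u.1 = (\sum_(j < N n) enorm (vmeas (Dcurve c1) (cell (t n) j)))%:E /\
  len u.2 = (\sum_(j < N n) enorm (vmeas (Dcurve c2) (cell (t n) j)))%:E,
  (\int[leb]_(x in unit_itv) (enorm (u.1 x - c1 x))%:E <=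
    (2 * (2 / n.+1%:R) * fine (len c1))%:E)%E /\
  (\int[leb]_(x in unit_itv) (enorm (u.2 x - c2 x))%:E <=
    (2 * (2 / n.+1%:R) * fine (len c2))%:E)%E &
  ((\sum_(j < N n) cell_sim (Dcurve c1) (Dcurve c2) (cell (t n) j))%:E <=
    similarity u.1 u.2)%E].
  by have [u1 [u2 h]] := recovery_pair hc1 hc2 (gr n); exists (u1, u2).
apply: (@le_trans _ _ (limn_esup (fun n => similarity (u n).1 (u n).2))).
  apply: (@limn_esup_ge _ _ (EFin \o (fun n =>
    \sum_(j < N n) cell_sim (Dcurve c1) (Dcurve c2) (cell (t n) j)))).
    apply: cvg_EFin; first exact: nearW.
    have := cell_sim_cvg gr h1 h2 b1 b2; exact.
  by move=> n; have [_ _ _ _] := hu n.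
apply: ereal_sup_ubound; exists (fun n => (u n).1), (fun n => (u n).2); split => //.
- by move=> n; have [] := hu n.
- apply: (strict_cvg_steps hc1 gr h1) => n; have [_ [? ?] [? ?] [? ?] _] := hu n; by [].
- apply: (strict_cvg_steps hc2 gr h2) => n; have [_ [? ?] [? ?] [? ?] _] := hu n; by [].
Qed.

End relaxed_similarity_formula.

Section variation_sum_formula.
Context {R : realType} {d : nat}.
Local Notation mR := (measurableTypeR R).
Variables c1 c2 : R -> 'rV[R]_d.
Hypotheses (hc1 : BV c1) (hc2 : BV c2).
Let m : {finite_measure set mR -> \bar R} := variation_sum c1 c2.

Lemma variation_sum_out (A : set mR) : measurable A -> A `&` oo01 = set0 -> m A = 0%E.
Proof.
move=> mA A0; rewrite /m/= /variation_sum measure_addE.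
have z c (hc : BV c) : tvar (Dcurve c) A = 0%E.
  by rewrite (tvar_conc (Dcurve_conc hc) mA) A0 tvar0.
by rewrite [X in (X + _)%E](z _ _ hc1) [X in (_ + X)%E](z _ _ hc2) adde0.
Qed.

Lemma variation_sum_densities : exists f1 f2 : mR -> 'rV[R]_d,
  [/\ vdensity m (Dcurve c1) f1 /\ vdensity m (Dcurve c2) f2,
  forall x, enorm (f1 x) <= 1, forall x, enorm (f2 x) <= 1 &
  (\int[variation_sum c1 c2]_(x in unit_itv)
      (let r1 := variation_density c1 (variation_sum c1 c2) x in
       let r2 := variation_density c2 (variation_sum c1 c2) x in
       if (r1 == 0%R) || (r2 == 0%R) then 0%R
       else Num.max (edot (polar c1 x) (polar c2 x)) 0 * Num.sqrt (r1 * r2))%:E)%E =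
  (\int[m]_(x in oc01) psim (f1 x) (f2 x))%:E].
Proof.
have t1 (A : set mR) : measurable A -> (tvar (Dcurve c1) A <= m A)%E.
  by move=> mA; rewrite /m/= /variation_sum measure_addE leeDl// tvar_ge0.
have t2 (A : set mR) : measurable A -> (tvar (Dcurve c2) A <= m A)%E.
  by move=> mA; rewrite /m/= /variation_sum measure_addE leeDr// tvar_ge0.
have [f1 [N1 [d1 b1 mN1 N10 h1]]] := polar_density t1.
have [f2 [N2 [d2 b2 mN2 N20 h2]]] := polar_density t2.
exists f1, f2; split => //.
have Ip := integrable_psim (@measurable_oc01 R) d1.1 d2.1 b1 b2.
rewrite [RHS]fineK; last by apply: integrable_fin_num.
rewrite [LHS]integral_mkcond [RHS]integral_mkcond.
apply: (@eq_integral_off_null _ _ _ m (N1 `|` N2 `|` [set 0])).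
- by apply: measurableU => //; exact: measurableU.
- rewrite measureU0//; [|exact: measurableU|].
    by rewrite measureU0.
  apply: variation_sum_out => //; apply/seteqP; split => // x [/= ->].
  by rewrite /oo01/= in_itv/= ltxx.
- move=> x _ nx; have n1 : ~ N1 x by move=> ?; apply: nx; left; left.
  have n2 : ~ N2 x by move=> ?; apply: nx; left; right.
  have x0 : x != 0 by apply/eqP => ?; apply: nx; right.
  rewrite !patchE; have -> : (x \in unit_itv) = (x \in (oc01 : set mR)).
    apply/idP/idP => /set_mem; rewrite /unit_itv /oc01/= in_itv/= => /andP[p q];
      apply/mem_set; rewrite /= in_itv/= q andbT ?(ltW p)//.
    by rewrite lt_neqAle eq_sym x0.
  case: ifP => // _; congr EFin.
  have [e1 r1] := h1 x n1; have [e2 r2] := h2 x n2.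
  have dir c (f : mR -> 'rV[R]_d) : f x = variation_density c m x *: polar c x ->
      enorm (f x) = variation_density c m x -> variation_density c m x != 0 ->
      direction (f x) = polar c x.
    by move=> fe fr r0; rewrite /direction fr fe scalerA mulVf ?scale1r.
  rewrite /= -[variation_density c1 _ x]/(variation_density c1 m x).
  rewrite -[variation_density c2 _ x]/(variation_density c2 m x).
  case: ifPn => [/orP[]/eqP r0|].
  - have -> : f1 x = 0 by apply/eqP; rewrite -enorm_eq0 r1 r0.
    by rewrite psim0l.
  - have -> : f2 x = 0 by apply/eqP; rewrite -enorm_eq0 r2 r0.
    by rewrite psim0r.
  - rewrite negb_or => /andP[r10 r20].
    by rewrite psimE r1 r2 (dir c1)// (dir c2).
Qed.

End variation_sum_formula.

(** * Jumps and special functions of bounded variation *)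

Lemma vdensity_induced {R : realType} {disp} {T : measurableType disp} {d : nat}
    (mu : {measure set T -> \bar R}) (f : T -> 'rV[R]_d) (If : vintegrable mu f) :
  vdensity mu (fun i => induced_charge (If i)) f.
Proof. by []. Qed.

Section jumps.
Context {R : realType} {d : nat}.
Local Notation mR := (measurableTypeR R).
Local Notation leb := (@lebesgue_measure R).
Variable c : R -> 'rV[R]_d.
Hypothesis hc : BV c.
Let nu := Dcurve c.

Let nu01 i (A : set mR) : measurable A -> nu i A = nu i (A `&` oo01).
Proof. exact: Dcurve_conc. Qed.

Lemma ae_and (P Q : R -> Prop) : {ae leb, forall x, P x} -> {ae leb, forall x, Q x} ->
  {ae leb, forall x, P x /\ Q x}.
Proof.
move=> /ae_null[A [mA A0 PA]] /ae_null[B [mB B0 QB]].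
exists (A `|` B); split; [exact: measurableU|by rewrite measureU0|].
move=> x /= nPQ; apply: contrapT => nAB; apply: nPQ; split.
  by apply: PA => Ax; apply: nAB; left.
by apply: QB => Bx; apply: nAB; right.
Qed.

Let ess_lim_unique (u : R -> 'rV[R]_d) (l l' : 'rV[R]_d) :
  (forall e, 0 < e -> exists y, enorm (u y - l) < e /\ enorm (u y - l') < e) -> l = l'.
Proof.
move=> h; apply/eqP; rewrite -subr_eq0 -enorm_eq0 eq_le enorm_ge0 andbT.
apply/ler_addgt0Pr => e e0; rewrite add0r.
have e2 : 0 < e / 2 by rewrite divr_gt0.
have [y [h1 h2]] := h _ e2.
have -> : l - l' = (u y - l') - (u y - l) by apply/rowP => i; rewrite !mxE; ring.
by rewrite (le_trans (enormB _ _))// (splitr e) lerD// ltW.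
Qed.

Lemma left_ess_lim_unique (u : R -> 'rV[R]_d) x l l' :
  is_left_ess_lim u x l -> is_left_ess_lim u x l' -> l = l'.
Proof.
move=> h h'; apply: (@ess_lim_unique u) => e e0.
have [d1 d10 a1] := h e e0; have [d2 d20 a2] := h' e e0.
have xd : x - Num.min d1 d2 < x by rewrite ltrBlDr ltrDl lt_min d10.
have [y /andP[xy yx] [h1 h2]] := ae_dense (ae_and a1 a2) xd.
move: xy; rewrite ltrBlDr -ltrBlDl lt_min => /andP[yd1 yd2].
by exists y; split; [apply: h1|apply: h2]; rewrite yx ltrBlDr -ltrBlDl ?yd1 ?yd2.
Qed.

Lemma right_ess_lim_unique (u : R -> 'rV[R]_d) x l l' :
  is_right_ess_lim u x l -> is_right_ess_lim u x l' -> l = l'.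
Proof.
move=> h h'; apply: (@ess_lim_unique u) => e e0.
have [d1 d10 a1] := h e e0; have [d2 d20 a2] := h' e e0.
have xd : x < x + Num.min d1 d2 by rewrite ltrDl lt_min d10.
have [y /andP[xy yx] [h1 h2]] := ae_dense (ae_and a1 a2) xd.
move: yx; rewrite -ltrBlDl lt_min => /andP[yd1 yd2].
by exists y; split; [apply: h1|apply: h2]; rewrite xy -ltrBlDl ?yd1 ?yd2.
Qed.

(** The essential limits are read on the representative [C + vmeas nu (ray x)]: the right one is its
    value at [x], the left one misses the mass of [x]. *)
Lemma jump_vmeas x : 0 < x < 1 -> jump c x = vmeas nu [set x].
Proof.
move=> /andP[x0 x1]; have [C hC] := BV_representation hc.
have hC' : {ae leb, forall y, 0 < y < 1 -> c y = C + vmeas nu (ray y)}.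
  apply: ae_imp hC _ => y hy y01; apply/rowP => i.
  by rewrite hy// !mxE.
have L : is_left_ess_lim c x (C + vmeas nu (ray x) - vmeas nu [set x]).
  move=> e e0; have e2 : 0 < e / 2 by rewrite divr_gt0.
  have [d0 d00 h] := vmeas_ray_left nu x e2.
  (* The bound by [x] keeps [y] positive, where the representation of [c] holds. *)
  exists (Num.min d0 x); first by rewrite lt_min d00.
  apply: ae_imp hC' _ => y hy /andP[].
  rewrite ltrBlDr -ltrBlDl lt_min => /andP[yd yx'] yx.
  have y0 : 0 < y by move: yx'; rewrite ltrBlDr ltrDl.
  rewrite hy ?y0 ?(lt_trans yx)//.
  have /h : x - d0 <= y < x by rewrite yx lerBlDr -lerBlDl ltW.
  move=> he; rewrite enormBC (_ : _ - _ = vmeas nu (ray x) - vmeas nu [set x] - vmeas nu (ray y)).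
    by apply: le_lt_trans he _; rewrite ltr_pdivrMr// ltr_pMr// ltr1n.
  by apply/rowP => i; rewrite !mxE; ring.
have Rt : is_right_ess_lim c x (C + vmeas nu (ray x)).
  move=> e e0; have e2 : 0 < e / 2 by rewrite divr_gt0.
  have [d0 d00 h] := vmeas_ray_right nu x e2.
  exists (Num.min d0 (1 - x)); first by rewrite lt_min d00 subr_gt0.
  apply: ae_imp hC' _ => y hy /andP[xy].
  rewrite -ltrBlDl lt_min => /andP[yd yx'].
  have y1 : y < 1 by move: yx'; rewrite ltrD2r.
  rewrite hy ?y1 ?(lt_trans x0)//.
  have /h : x <= y <= x + d0 by rewrite ltW//= -lerBlDl ltW.
  move=> he; rewrite opprD addrACA subrr add0r.
  by apply: le_lt_trans he _; rewrite ltr_pdivrMr// ltr_pMr// ltr1n.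
rewrite /jump /right_lim /left_lim (xget_unique _ Rt); last first.
  by move=> l hl; exact: right_ess_lim_unique hl Rt.
rewrite (xget_unique _ L); last by move=> l hl; exact: left_ess_lim_unique hl L.
by apply/rowP => i; rewrite !mxE; ring.
Qed.

Lemma vmeas_set1_out x : ~ (0 < x < 1) -> vmeas nu [set x] = 0.
Proof.
move=> nx; rewrite (vmeas_conc nu01)// (_ : _ `&` _ = set0) ?vmeas0//.
by apply/seteqP; split => // y [/= ->]; rewrite /oo01/= in_itv.
Qed.

Lemma jump_setE x : jump_set c x <-> 0 < x < 1 /\ vmeas nu [set x] <> 0.
Proof.
split=> -[x01 h]; split => //; first rewrite -jump_vmeas//.
  by move=> /subr0_eq e; apply: h.
by move=> e; apply: h; rewrite -jump_vmeas// /jump e subrr.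
Qed.

Lemma atomsE x : atoms c x <-> vmeas nu [set x] <> 0.
Proof.
split=> [[i ni] v0|v0].
  move: ni; rewrite -[Dcurve c i _]fineK ?fin_num_measure//.
  have := congr1 (fun v : 'rV[R]_d => v 0 i) v0; rewrite !mxE => ->.
  by rewrite eqxx.
apply: contrapT => na; apply: v0; apply/rowP => i; rewrite !mxE.
have [->//|ni] := eqVneq (nu i [set x]) 0%E.
by exfalso; apply: na; exists i.
Qed.

End jumps.

Section sbv_density.
Context {R : realType} {d : nat}.
Local Notation mR := (measurableTypeR R).
Local Notation leb := (@lebesgue_measure R).
Variable c : R -> 'rV[R]_d.

(** [xget] returns either a density or the zero function, and both are integrable. *)
Lemma vintegrable_ac_derivative : vintegrable leb (ac_derivative c : mR -> 'rV[R]_d).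
Proof.
move=> i; rewrite (_ : _ \o _ = EFin \o
    xget (cst 0) [set f | is_ac_density (Dcurve c i) f]); last first.
  by apply/funext => x; rewrite /= mxE.
case: xgetP => [f _ [If _]//|_].
by rewrite (_ : _ \o _ = cst 0%E)//; exact: integrable0.
Qed.

Lemma SBV_density i (A : set mR) : SBV c -> measurable A -> A `&` atoms c = set0 ->
  Dcurve c i A = (\int[leb]_(x in A) (ac_derivative c x 0 i)%:E)%E.
Proof.
move=> [hc h] mA A0; have := h i A mA; rewrite /cantor_part /jump_part A0 charge0 sube0.
have fI : (\int[leb]_(x in A) (ac_derivative c x 0 i)%:E)%E \is a fin_num.
  by apply: integrable_fin_num => //; apply: integrableS (vintegrable_ac_derivative i).
by move=> /eqP; rewrite sube_eq ?add0e// ?fin_num_adde_defl// => [/eqP|]; rewrite ?fin_num_measure.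
Qed.

End sbv_density.

Lemma tvar_eq_on {R : realType} {disp} {T : measurableType disp} {d : nat}
    (nu nu' : 'I_d -> {charge set T -> \bar R}) (A : set T) :
  (forall B, measurable B -> B `<=` A -> vmeas nu B = vmeas nu' B) -> tvar nu A = tvar nu' A.
Proof.
move=> h; rewrite /tvar; congr (ereal_sup (_ `|` _)).
by apply/seteqP; split => _ [F FA <-]; exists F => //; apply: eq_eseriesr => n _;
  have [mF _ FU] := FA; rewrite h// -FU; exact: bigcup_sup.
Qed.

Lemma Rintegral_set1_atom {R : realType} (mu : {finite_measure set (measurableTypeR R) -> \bar R})
    (f : measurableTypeR R -> R) (x : R) :
  (\int[mu]_(y in [set x]) (f y)%:E = (f x)%:E * mu [set x])%E.
Proof.
rewrite -integral_cst; last exact: measurable_set1.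
by apply: eq_integral => y /set_mem ->.
Qed.

Lemma integral_countable {R : realType} (mu : {finite_measure set (measurableTypeR R) -> \bar R})
    (K : set (measurableTypeR R)) (f : measurableTypeR R -> R) : countable K ->
  measurable_fun setT f -> (forall x, 0 <= f x) ->
  (\int[mu]_(x in K) (f x)%:E = \esum_(x in K) ((f x)%:E * mu [set x]))%E.
Proof.
move=> /countable_bijP[B] KB mf f0.
have /card_set_bijP[e be] : (B #= K)%card by rewrite card_eq_sym.
have [eB eI eS] := be.
pose F n : set (measurableTypeR R) := if n \in B then [set e n] else set0.
have mF n : measurable (F n) by rewrite /F; case: ifP.
have FK : \bigcup_n F n = K.
  apply/seteqP; split => [x [n _]|x /eS[n Bn <-]].
    by rewrite /F; case: ifPn => // /set_mem Bn ->; exact: eB.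
  by exists n => //; rewrite /F mem_set.
have tF : trivIset setT F.
  move=> i j _ _ [x []]; rewrite /F; case: ifPn => // Bi -> ; case: ifPn => // Bj eij.
  exact: eI.
rewrite -[in LHS]FK ge0_integral_bigcup//; last 2 first.
- by apply/measurable_EFinP; exact: measurable_funTS.
- by move=> x _; rewrite lee_fin.
rewrite nneseries_esumT; last first.
  by move=> n; apply: integral_ge0 => x _; rewrite lee_fin.
rewrite (@reindex_esum _ _ _ B K e _ be) [RHS]esum_mkcond; apply: eq_esum => n _.
rewrite /F; case: ifP => // _; last by rewrite integral_set0.
exact: Rintegral_set1_atom.
Qed.

Section sbv_formula.
Context {R : realType} {d : nat}.
Local Notation mR := (measurableTypeR R).
Local Notation leb := (@lebesgue_measure R).
Variables c1 c2 : R -> 'rV[R]_d.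
Hypotheses (sc1 : SBV c1) (sc2 : SBV c2).
Let m : {finite_measure set mR -> \bar R} := variation_sum c1 c2.
Variables f1 f2 : mR -> 'rV[R]_d.
Hypotheses (h1 : vdensity m (Dcurve c1) f1) (h2 : vdensity m (Dcurve c2) f2).
Hypotheses (b1 : forall x, enorm (f1 x) <= 1) (b2 : forall x, enorm (f2 x) <= 1).
Let a1 : mR -> 'rV[R]_d := ac_derivative c1.
Let a2 : mR -> 'rV[R]_d := ac_derivative c2.

Let Ia1 : vintegrable leb a1 := vintegrable_ac_derivative c1.
Let Ia2 : vintegrable leb a2 := vintegrable_ac_derivative c2.
Let mu1 i : {charge set mR -> \bar R} := induced_charge (Ia1 i).
Let mu2 i : {charge set mR -> \bar R} := induced_charge (Ia2 i).
(* Off the atoms, [m] coincides with [la], which has density [h]. *)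
Let la : {finite_measure set mR -> \bar R} := measure_add (tvar mu1) (tvar mu2).
Let h (x : mR) : R := enorm (a1 x) + enorm (a2 x).

Let Ih : leb.-integrable setT (EFin \o h).
Proof.
by have := integrableD measurableT (integrable_enorm Ia1) (integrable_enorm Ia2).
Qed.

Let laE (A : set mR) : measurable A -> la A = (\int[leb]_(x in A) (h x)%:E)%E.
Proof.
move=> mA; rewrite /la/= measure_addE.
have d1 : vdensity leb mu1 a1 := vdensity_induced Ia1.
have d2 : vdensity leb mu2 a2 := vdensity_induced Ia2.
rewrite [X in (X + _)%E](tvar_density mA d1) [X in (_ + X)%E](tvar_density mA d2).
rewrite -ge0_integralD//.
- by move=> x _; rewrite lee_fin enorm_ge0.
- by apply: measurable_funTS; exact: measurable_int (integrable_enorm Ia1).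
- by move=> x _; rewrite lee_fin enorm_ge0.
- by apply: measurable_funTS; exact: measurable_int (integrable_enorm Ia2).
Qed.

Let msub (A B : set mR) : A `&` B = set0 -> forall E, E `<=` A -> E `&` B = set0.
Proof.
move=> AB E EA; apply/seteqP; split => // x [/EA Ax Bx].
by rewrite -AB.
Qed.

Let la_eq (D : set mR) : D `&` atoms c1 = set0 -> D `&` atoms c2 = set0 ->
  forall A, measurable A -> A `<=` D -> m A = la A.
Proof.
move=> D1 D2 A mA AD; rewrite /m /la/= /variation_sum !measure_addE; congr (_ + _)%E.
  apply: tvar_eq_on => B mB BA; apply/rowP => i; rewrite !mxE SBV_density//.
  exact: msub D1 _ (subset_trans BA AD).
apply: tvar_eq_on => B mB BA; apply/rowP => i; rewrite !mxE SBV_density//.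
exact: msub D2 _ (subset_trans BA AD).
Qed.

(** On [D] the measure [m] is [h] times the Lebesgue measure, so there [D c] has the two Lebesgue
    densities [ac_derivative c] and [h f], which agree almost everywhere. *)
Let base_change (c : R -> 'rV[R]_d) (f : mR -> 'rV[R]_d) (D : set mR) : SBV c ->
  vdensity m (Dcurve c) f -> (forall x, enorm (f x) <= 1) -> measurable D ->
  D `&` atoms c = set0 -> D `&` atoms c1 = set0 -> D `&` atoms c2 = set0 ->
  {ae leb, forall x, D x -> ac_derivative c x = h x *: f x}.
Proof.
move=> sc hf bf mD Dc D1 D2.
have Ia := vintegrable_ac_derivative c.
have hi i : {ae leb, forall x, D x -> ac_derivative c x 0 i = f x 0 i * h x}.
  have mfi := vintegrable_measurable hf.1 i.
  have Ifi E : measurable E -> la.-integrable E (EFin \o (fun x => f x 0 i)).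
    move=> mE; apply: bounded_integrable => //; first exact: measurable_funTS.
    by exists 1 => x; exact: le_trans (enorm_coord _ _) (bf x).
  have := @integral_ae_eq _ mR R leb D mD (EFin \o (fun x => f x 0 i * h x))
    (EFin \o (fun x => ac_derivative c x 0 i)).
  move=> /(_ _ _ _)/ae_imp; apply.
  - by apply: integrableS (Ia i).
  - apply/measurable_EFinP; apply: measurable_funTS; apply: measurable_funM => //.
    by apply/measurable_EFinP; exact: measurable_int Ih.
  - move=> E ED mE; rewrite -[LHS](SBV_density _ sc mE); last exact: msub Dc _ ED.
    rewrite hf.2// (@eq_measure_integral _ _ _ _ la); last first.
      by move=> A mA AE; apply: la_eq D1 D2 _ mA _; exact: subset_trans ED.
    exact: (integral_density Ih laE mE (Ifi E mE)).
  - by move=> x hx Dx; have [] := hx Dx.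
apply: ae_imp (ae_forall_ord hi) _ => x hx Dx; apply/rowP => i.
by rewrite hx// mxE mulrC.
Qed.

Let mpsim (g1 g2 : mR -> 'rV[R]_d) : vmeasurable g1 -> vmeasurable g2 ->
  measurable_fun setT (fun x => psim (g1 x) (g2 x)).
Proof. exact: measurable_psim. Qed.

(** By homogeneity, [h psim (f1, f2) = psim (h f1, h f2)], which is [psim (a1, a2)] by
    [base_change]. *)
Lemma integral_off_atoms (D : set mR) : measurable D ->
  D `&` atoms c1 = set0 -> D `&` atoms c2 = set0 ->
  (\int[m]_(x in D) (psim (f1 x) (f2 x))%:E =
   \int[leb]_(x in D) (psim (a1 x) (a2 x))%:E)%E.
Proof.
move=> mD D1 D2; rewrite (eq_measure_integral la); last exact: la_eq.
have Ip : la.-integrable D (EFin \o (fun x => psim (f1 x) (f2 x))).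
  apply: bounded_integrable => //; last exact: psim_bounded.
  apply: measurable_funTS; apply: mpsim; apply: vintegrable_measurable; [exact: h1.1|exact: h2.1].
rewrite (integral_density Ih laE mD Ip).
have [N1 [mN1 N10 e1]] := ae_null (base_change sc1 h1 b1 mD D1 D1 D2).
have [N2 [mN2 N20 e2]] := ae_null (base_change sc2 h2 b2 mD D2 D1 D2).
apply: (@eq_integral_off_null _ _ _ leb (N1 `|` N2)).
- exact: measurableU.
- by rewrite measureU0.
- move=> x Dx nx; rewrite /a1 /a2 e1 ?e2//; last 2 first.
  - by move=> ?; apply: nx; right.
  - by move=> ?; apply: nx; left.
  by rewrite psimZ ?addr_ge0 ?enorm_ge0// mulrC.
Qed.

(** Homogeneity again, now with the factor [m {x}]: [D c_i {x} = m {x} f_i x]. *)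
Lemma integral_on_atoms (K : set mR) : countable K ->
  (\int[m]_(x in K) (psim (f1 x) (f2 x))%:E =
   \esum_(x in K) (psim (vmeas (Dcurve c1) [set x]) (vmeas (Dcurve c2) [set x]))%:E)%E.
Proof.
move=> cK; rewrite integral_countable//.
- apply: eq_esum => x _.
  have mx : measurable ([set x] : set mR) by exact: measurable_set1.
  have vE c f : vdensity m (Dcurve c) f -> vmeas (Dcurve c) [set x] = fine (m [set x]) *: f x.
    move=> hf; apply/rowP => i; rewrite !mxE hf.2// Rintegral_set1_atom fineM ?fin_num_measure//.
    by rewrite mulrC.
  rewrite (vE _ _ _ h1) (vE _ _ _ h2) psimZ ?fine_ge0// mulrC EFinM fineK//.
  by rewrite fin_num_measure.
- apply: mpsim.
    exact: vintegrable_measurable h1.1.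
  exact: vintegrable_measurable h2.1.
- by move=> x; exact: psim_ge0.
Qed.

Lemma sbv_formula : (\int[m]_(x in oc01) psim (f1 x) (f2 x))%:E =
  (\int[leb]_(x in unit_itv)
       (let v1 := ac_derivative c1 x in
        let v2 := ac_derivative c2 x in
        if (v1 == 0%R) || (v2 == 0%R) then 0%R
        else Num.max (edot (direction v1) (direction v2)) 0
             * Num.sqrt (enorm v1 * enorm v2))%:E
     + \esum_(x in jump_set c1 `&` jump_set c2)
         (Num.max (edot (direction (jump c1 x)) (direction (jump c2 x))) 0
          * Num.sqrt (enorm (jump c1 x) * enorm (jump c2 x)))%:E)%E.
Proof.
have hc1 := sc1.1; have hc2 := sc2.1.
have Ip := integrable_psim (@measurable_oc01 R) h1.1 h2.1 b1 b2.
rewrite [LHS]fineK; last by apply: integrable_fin_num.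
(* [K] contains the atoms of both curves and is countable, hence Lebesgue null: its complement
   carries the absolutely continuous part alone. *)
pose K : set mR := [set x | m [set x] != 0%E].
have cK : countable K := countable_atoms m.
have mK : measurable K by apply: countable_measurable => // x; exact: measurable_set1.
have lK : leb K = 0%E by exact: countable_lebesgue_measure0.
have Koc : K `<=` oc01.
  move=> x /negP mx; apply: contrapT => nx; apply: mx; apply/eqP.
  apply: (variation_sum_out hc1 hc2) => //.
  apply/seteqP; split => // y [/= ->]; rewrite /oo01/= in_itv/= => /andP[p q].
  by apply: nx; rewrite /oc01/= in_itv/= p ltW.
have Ka c : (forall A : set mR, measurable A -> (tvar (Dcurve c) A <= m A)%E) -> atoms c `<=` K.
  move=> tm x /atomsE vx; apply/negP => /eqP mx; apply: vx.
  have mx1 : measurable ([set x] : set mR) by exact: measurable_set1.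
  have t0 : tvar (Dcurve c) [set x] = 0%E.
    by apply/eqP; rewrite eq_le tvar_ge0 andbT -mx tm.
  apply/eqP; rewrite -enorm_eq0 eq_le enorm_ge0 andbT.
  by rewrite (le_trans (enorm_vmeas_le (Dcurve c) mx1))//= t0.
have K1 : atoms c1 `<=` K.
  by apply: Ka => A mA; rewrite /m/= /variation_sum measure_addE leeDl// tvar_ge0.
have K2 : atoms c2 `<=` K.
  by apply: Ka => A mA; rewrite /m/= /variation_sum measure_addE leeDr// tvar_ge0.
have mo := @measurable_oc01 R.
have dis c : atoms c `<=` K -> (oc01 `\` K) `&` atoms c = set0.
  by move=> Kc; apply/seteqP; split => // x [[_ nK] /Kc].
rewrite -(setDUK Koc) setUC ge0_integral_setU//; last 4 first.
- exact: measurableD.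
- rewrite setUC setDUK//.
  by apply: measurable_int Ip.
- by move=> x _; rewrite lee_fin psim_ge0.
- by apply/disj_setPS => x [[_ nK] /nK].
congr (_ + _)%E.
  rewrite integral_off_atoms ?dis//; last exact: measurableD.
  rewrite [LHS]integral_mkcond [RHS]integral_mkcond.
  apply: (@eq_integral_off_null _ _ _ leb (K `|` [set 0])).
  - exact: measurableU.
  - by rewrite measureU0//; exact: lebesgue_measure_set1.
  - move=> x _ nx; rewrite !patchE.
    have nK : ~ K x by move=> ?; apply: nx; left.
    have x0 : x != 0 by apply/eqP => ?; apply: nx; right.
    have -> : (x \in (oc01 `\` K)) = (x \in (unit_itv : set R)).
      apply/idP/idP => /set_mem; rewrite /unit_itv /oc01/= in_itv/=.
        by move=> [/andP[p q] _]; apply/mem_set; rewrite /= in_itv/= q ltW.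
      move=> /andP[p q]; apply/mem_set; split => //=; rewrite in_itv/= q andbT.
      by rewrite lt_neqAle eq_sym x0.
    case: ifP => // _; congr EFin; rewrite /= -/(a1 x) -/(a2 x).
    case: ifPn => [/orP[]/eqP->|_]; rewrite ?psim0l ?psim0r//.
    exact: psimE.
rewrite integral_on_atoms// [LHS]esum_mkcond [RHS]esum_mkcond; apply: eq_esum => x _.
(* At a point of [K] that is not a jump of both curves, one of the two masses is 0 and so is
   [psim]. *)
have [xJ|nJ] := boolP (x \in jump_set c1 `&` jump_set c2).
  have [/(jump_setE hc1)[x01 v1] /(jump_setE hc2)[_ v2]] := set_mem xJ.
  rewrite mem_set; last by apply: K1; apply/atomsE.
  by rewrite !jump_vmeas// psimE.
case: ifP => // _.
have [v1|v1] := eqVneq (vmeas (Dcurve c1) [set x]) 0; first by rewrite v1 psim0l.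
have [v2|v2] := eqVneq (vmeas (Dcurve c2) [set x]) 0; first by rewrite v2 psim0r.
exfalso; move/negP: nJ; apply; apply/mem_set.
have x01 : 0 < x < 1.
  by apply: contrapT => /(vmeas_set1_out hc1) v0; move/eqP: v1; apply.
by split; [apply/(jump_setE hc1)|apply/(jump_setE hc2)]; split => //; apply/eqP.
Qed.

End sbv_formula.

Local Open Scope ereal_scope.

Theorem theorem1 (R : realType) (d : nat) (c1 c2 : R -> 'rV[R]_d)
    (hc1 : BV c1) (hc2 : BV c2) :
  relaxed_similarity c1 c2 =
    \int[variation_sum c1 c2]_(x in unit_itv)
      (let r1 := variation_density c1 (variation_sum c1 c2) x in
       let r2 := variation_density c2 (variation_sum c1 c2) x in
       if (r1 == 0%R) || (r2 == 0%R) then 0%R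
       else Num.max (edot (polar c1 x) (polar c2 x)) 0 * Num.sqrt (r1 * r2))%:E
  /\
  (SBV c1 -> SBV c2 ->
   relaxed_similarity c1 c2 =
     \int[@lebesgue_measure R]_(x in unit_itv)
       (let v1 := ac_derivative c1 x in
        let v2 := ac_derivative c2 x in
        if (v1 == 0%R) || (v2 == 0%R) then 0%R
        else Num.max (edot (direction v1) (direction v2)) 0
             * Num.sqrt (enorm v1 * enorm v2))%:E
     + \esum_(x in jump_set c1 `&` jump_set c2)
         (Num.max (edot (direction (jump c1 x)) (direction (jump c2 x))) 0
          * Num.sqrt (enorm (jump c1 x) * enorm (jump c2 x)))%:E).
Proof.
have [f1 [f2 [[d1 d2] b1 b2 E]]] := variation_sum_densities hc1 hc2.
have m1 : variation_sum c1 c2 [set 1%R] = 0.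
  apply: (variation_sum_out hc1 hc2) => //.
  by apply/seteqP; split => // x [/= ->]; rewrite /oo01/= in_itv/= ltxx andbF.
have rel := relaxed_similarity_density hc1 hc2 m1 d1 d2 b1 b2.
split; first by rewrite rel E.
by move=> s1 s2; rewrite rel; exact: (sbv_formula s1 s2 d1 d2 b1 b2).
Qed.
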